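(* Let $X$ be a Banach space of cotype $r$, $2\le r<\infty$, with cotype-$r$ constant $C_r(X)$. Let $0<p\le2$ and let $u\in H^p_X$, $u\neq0$, with Haar expansion $u=\sum_{I\in\mathcal D}x_Ih_I$ ($x_I\in X$) and atomic decomposition $(u_i,\mathcal G_i,I_i)_{i\in\mathcal N}$. Then for each $i\in\mathcal N$ there exists $\mu^{(i)}\in\ell^1(\mathcal G_i)$ with $$\mu^{(i)}_I\ge0\ \text{ for all } I\in\mathcal G_i\qquad\text{and}\qquad\sum_{I\in\mathcal G_i}\mu^{(i)}_I=1,$$ so that the following holds: the sequence $(\omega_I)_{I\in\mathcal D}$ defined by $$\omega_I=\frac{\|u_i\|_{H^2_X}^p|I_i|^{1-\frac p2}}{A_p\|u\|_{H^p_X}^p}\,\mu^{(i)}_I,\qquad I\in\mathcal G_i,\ i\in\mathcal N,$$ satisfies $$\sum_{I\in\mathcal D}\omega_I\le1,$$ and for all $s>r$ there exists a constant $K_{s,r,p}>0$ (depending only on $s,r,p$) such that for each $\varphi=(\varphi_I)_{I\in\mathcal D}\in\ell^\infty(\mathcal D)$ $$\|\varphi\cdot u\|_{H^p_X}\le K_{s,r,p}\,C_r(X)\,\|u\|_{H^p_X}\Big(\sum_{I\in\mathcal D}|\varphi_I|^s\omega_I\Big)^{\frac1s}.$$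
   Context: Dyadic intervals: $\mathcal D$ is the set of all intervals $\left[\frac{k-1}{2^n},\frac{k}{2^n}\right)$ with $n\in\mathbb N_0$, $1\le k\le 2^n$; $|I|$ is the length of $I$; $\mathcal D_n=\{I\in\mathcal D:|I|\ge2^{-n}\}$. $\ell^\infty(\mathcal D)$ is the space of bounded real sequences indexed by $\mathcal D$; for $\mathcal G\subseteq\mathcal D$, $\ell^1(\mathcal G)$ is the space of absolutely summable real sequences indexed by $\mathcal G$. The Haar function $h_I$ is $1$ on the left half of $I$, $-1$ on the right half, $0$ elsewhere. Cotype: let $(r_n)$ be the independent Rademacher system on $[0,1]$. $X$ is of cotype $r$ if there is a constant $C$ such that $\big(\sum_{n=1}^N\|x_n\|^r\big)^{1/r}\le C\big(\int_0^1\|\sum_{n=1}^Nr_n(t)x_n\|_X^2dt\big)^{1/2}$ for all finite sequences $(x_n)$ in $X$; the smallest such $C$ is $C_r(X)$. Vector-valued dyadic Hardy spaces: let $(r_I)_{I\in\mathcal D}$ be an enumeration of the independent Rademacher system. For a sequence $f=(x_I)_{I\in\mathcal D}$ in $X$, identified with its formal Haar series $\sum_I x_Ih_I$, put $$\mathbb S(f)(t)=\lim_{n\to\infty}\Big(\int_0^1\Big\|\sum_{I\in\mathcal D_n}r_I(s)x_Ih_I(t)\Big\|_X^2ds\Big)^{1/2},\quad t\in[0,1],$$ and $\|f\|_{H^p_X}=\|\mathbb S(f)\|_{L^p([0,1])}$. $H^p_X$ ($0<p\le2$) is the set of $f$ with $\|f\|_{H^p_X}<\infty$. For $\varphi\in\ell^\infty(\mathcal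 D)$, $\varphi\cdot u=\sum_{I\in\mathcal D}\varphi_Ix_Ih_I$. Blocks: a collection $\mathcal C\subseteq\mathcal D$ is a block of dyadic intervals if it has a unique maximal interval $I$ (with respect to inclusion) and, whenever $J\in\mathcal C$, $K\in\mathcal D$ and $J\subseteq K\subseteq I$, then $K\in\mathcal C$. The Carleson constant of a non-empty $\mathcal E\subseteq\mathcal D$ is $\llbracket\mathcal E\rrbracket=\sup_{I\in\mathcal E}\frac1{|I|}\sum_{J\in\mathcal E,\,J\subseteq I}|J|$. Atomic decomposition (known result): for every $0<p\le2$ there are constants $a_p,A_p>0$, depending only on $p$ and fixed once and for all, such that every $u=\sum_{J\in\mathcal D}x_Jh_J\in H^p_X$ admits an atomic decomposition, i.e. an index set $\mathcal N\subseteq\mathbb N$ and blocks of dyadic intervals $(\mathcal G_i)_{i\in\mathcal N}$ such that, with $u_i=\sum_{J\in\mathcal G_i}x_Jh_J$: (i) $(\mathcal G_i)_{i\in\mathcal N}$ is a disjoint partition of $\mathcal D$; (ii) $I_i:=\bigcup_{J\in\mathcal G_i}J$ is a dyadic interval and $\mathcal E:=\{I_i:i\in\mathcal N\}$ satisfies $\llbracket\mathcal E\rrbracket\le4$; (iii) $a_p\|u\|_{H^p_X}^p\le\sum_{i\in\mathcal N}\|u_i\|_{H^p_X}^p\le\sum_{i\in\mathcal N}|I_i|\,\|\mathbb S(u_i)\|_\infty^p\le A_p\|u\|_{H^p_X}^p$. The family $(u_i,\mathcal G_i,I_i)_{i\in\mathcal N}$ is called an atomic decomposition of $u$. *)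

(* Defs.v *)
From HB Require Import structures.
From mathcomp Require Import all_boot all_order all_algebra.
From mathcomp Require Import all_classical all_reals all_analysis.

Set Implicit Arguments.
Unset Strict Implicit.
Unset Printing Implicit Defensive.

Import Order.TTheory GRing.Theory Num.Theory.
Import numFieldNormedType.Exports.

Local Open Scope classical_set_scope.
Local Open Scope ring_scope.

(* The pair (n, k) with k < 2 ^ n encodes the interval [k / 2^n, (k + 1) / 2^n[;
   this encoding is injective. *)
Definition dyadic : Type := {n : nat & 'I_(2 ^ n)}.

Definition dy_level (I : dyadic) : nat := tag I.
Definition dy_pos (I : dyadic) : nat := nat_of_ord (tagged I).

Definition dy_interval (R : realType) (n k : nat) : set R :=
  `[k%:R / 2 ^+ n, k.+1%:R / 2 ^+ n[%classic.
Arguments dy_interval : clear implicits.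

Definition dy_itv (R : realType) (I : dyadic) : set R :=
  dy_interval R (dy_level I) (dy_pos I).
Arguments dy_itv : clear implicits.

Definition dy_len (R : realType) (I : dyadic) : R := (2 ^+ dy_level I)^-1.
Arguments dy_len : clear implicits.

Definition dy_sub (R : realType) (I J : dyadic) : Prop :=
  dy_itv R I `<=` dy_itv R J.

Definition dy_upto (R : realType) (n : nat) : set dyadic :=
  [set I | (2 ^+ n)^-1 <= dy_len R I].

(* The left and right halves of (n, k) are (n + 1, 2k) and (n + 1, 2k + 1). *)
Definition haar (R : realType) (I : dyadic) (t : R) : R :=
  \1_(dy_interval R (dy_level I).+1 (dy_pos I).*2) t
  - \1_(dy_interval R (dy_level I).+1 (dy_pos I).*2.+1) t.

(* On [0, 1[ this is the Rademacher function usually written r_(n + 1). *)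
Definition rademacher (R : realType) (n : nat) (t : R) : R :=
  (-1) ^+ Num.truncn (2 ^+ n.+1 * t).

(* (n, k) |-> 2 ^ n + k - 1 is a bijection from dyadic onto nat. *)
Definition rademacherD (R : realType) (I : dyadic) : R -> R :=
  @rademacher R (2 ^ dy_level I + dy_pos I).-1.

Definition Lp01 (R : realType) (p : \bar R) (f : R -> \bar R) : \bar R :=
  Lnorm (@lebesgue_measure R) p (f \_ `[0, 1]%classic).

Definition cotype_bound (R : realType) (X : normedModType R) (r C : R) : Prop :=
  0 <= C /\
  forall (N : nat) (x : 'I_N -> X),
    (((\sum_(n < N) `|x n| `^ r) `^ r^-1)%:E <=
     C%:E * Lp01 2%:E (fun t => `|\sum_(n < N) rademacher n t *: x n|%:E))%E.

Definition has_cotype (R : realType) (X : normedModType R) (r : R) : Prop :=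
  exists C : R, cotype_bound X r C.

Definition cotype_const (R : realType) (X : normedModType R) (r : R) : R :=
  inf [set C | cotype_bound X r C].

(* The limit is that of a nondecreasing sequence; its value may be +oo. *)
Definition square_fun (R : realType) (X : normedModType R) (x : dyadic -> X)
    (t : R) : \bar R :=
  limn (fun n : nat => Lp01 2%:E (fun s =>
    `|\sum_(I \in dy_upto R n) (rademacherD I s * haar I t) *: x I|%:E)).

Definition hardy_norm (R : realType) (X : normedModType R) (p : R)
    (x : dyadic -> X) : \bar R :=
  Lp01 p%:E (square_fun x).

Definition hardy (R : realType) (X : normedModType R) (p : R) :
    set (dyadic -> X) :=
  [set x | (hardy_norm p x < +oo)%E].

Definition linfty (R : realType) : set (dyadic -> R) :=
  [set phi | exists M : R, forall I, `|phi I| <= M].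

Definition haar_mul (R : realType) (X : normedModType R) (phi : dyadic -> R)
    (x : dyadic -> X) : dyadic -> X := fun I => phi I *: x I.

Definition haar_restr (R : realType) (X : normedModType R) (G : set dyadic)
    (x : dyadic -> X) : dyadic -> X := patch (fun=> 0) G x.

Definition dy_maximal (R : realType) (C : set dyadic) (I : dyadic) : Prop :=
  C I /\ forall J, C J -> dy_sub R I J -> J = I.

Definition dy_block (R : realType) (C : set dyadic) : Prop :=
  exists I, unique (dy_maximal R C) I /\
    forall J K, C J -> dy_sub R J K -> dy_sub R K I -> C K.

Definition carleson (R : realType) (E : set dyadic) : \bar R :=
  ereal_sup [set ((dy_len R I)^-1%:E *
    \esum_(J in [set J | E J /\ dy_sub R J I]) (dy_len R J)%:E)%E | I in E].

(* [top i] is the dyadic interval I_i; the constants a_p and A_p are [a] and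
   [A]. *)
Definition atomic_decomposition (R : realType) (X : normedModType R)
    (a A p : R) (x : dyadic -> X)
    (N : set nat) (G : nat -> set dyadic) (top : nat -> dyadic) : Prop :=
  [/\ forall i, N i -> dy_block R (G i),
      trivIset N G /\ \bigcup_(i in N) G i = setT,
      (forall i, N i -> \bigcup_(J in G i) dy_itv R J = dy_itv R (top i)) /\
        (carleson R (top @` N) <= 4%:E)%E
    & [/\ (a%:E * hardy_norm p x `^ p <=
           \esum_(i in N) hardy_norm p (haar_restr (G i) x) `^ p)%E,
          (\esum_(i in N) hardy_norm p (haar_restr (G i) x) `^ p <=
           \esum_(i in N) (dy_len R (top i))%:E *
             Lp01 +oo (square_fun (haar_restr (G i) x)) `^ p)%E
        & (\esum_(i in N) (dy_len R (top i))%:E *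
             Lp01 +oo (square_fun (haar_restr (G i) x)) `^ p <=
           A%:E * hardy_norm p x `^ p)%E]].

(* Main.v *)
Require Import Defs.
From HB Require Import structures.
From mathcomp Require Import all_boot all_order all_algebra.
From mathcomp Require Import all_classical all_reals all_analysis.
From mathcomp Require Import measurable_realfun ess_sup_inf ring lra zify.

Set Implicit Arguments.
Unset Strict Implicit.
Unset Printing Implicit Defensive.

Import Order.TTheory GRing.Theory Num.Theory.
Import numFieldNormedType.Exports.

Local Open Scope classical_set_scope.
Local Open Scope ring_scope.

(* On one atom, phi |-> ||phi . u_i|| in H^2 is a lattice seminorm on sequences,
   and cotype r gives it a lower r-estimate over colourings of the index set.
   As in Pisier's factorization theorem, a colouring maximizing the sum of the
   r-th powers yields a measure mu with ||1_B . u_i||^r <= const * mu(B).  This is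
   done on the finitely many intervals of length at least 2^-n, and the measures
   converge along an ultrafilter.  Cutting phi at its dyadic level sets then
   gives the L^s(mu) estimate for every s > r with the same mu.

   The atoms are put together as follows.  The square function of an atom is
   constant on each I_j strictly inside I_i, so the Carleson condition bounds
   the p-th power of the H^p norm of a sum of atoms by the sum of the
   |I_i|^(1 - p/2) times the p-th powers of their H^2 norms,
   for all 0 < p <= 2; Jensen's inequality with exponent p / s concludes.

   Every Hardy norm is a supremum of norms of truncations to intervals of length
   at least 2^-n, and those are finite averages over signs and cells. *)

(** * Inequalities for real powers *)

(** Cotype reaches [phi] only through indicators: the measure dominates the seminorm on sets.
    Passing to all [phi] sums a geometric series of ratio [2 ^ (1 - s / r)], finite because s > r;
    since s enters only there, [mu] can be chosen before s.

    For p < 1 there is no triangle inequality across atoms. On a small cell the tops I_i containing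
    it form a chain. Giving a top the weight m (m + 1), where m counts the tops of the chain from it
    downwards, bounds the square of a sum by the weighted sum of squares, and subadditivity of
    t^(p/2) then covers every p <= 2 at once. The Carleson condition bounds these weights only on
    average over cells, so a weight can be averaged away only where the square function it
    multiplies is constant. This holds on the next smaller top but not on the top itself, hence the
    shift to the next marked level. The factor 98 is 2 + 3 * 32, with 32 = 2 * 4 * 4 coming from two
    uses of the Carleson constant 4.

    A limit of finite measures may lose mass, and the cotype bound may vanish. The missing mass is
    put on the top interval of the atom, which only improves the domination and makes the total
    exactly 1. *)

Lemma powR_tangent (R : realType) (r a b : R) :
  1 <= r -> 0 <= a -> 0 <= b ->
  a `^ r - b `^ r <= r * a `^ (r - 1) * (a - b).
Proof.
move=> r1 a0 b0.
have r0 : 0 < r by lra.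
have ar : a * a `^ (r - 1) = a `^ r by rewrite mulr_powRB1.
have [->|r1'] := eqVneq r 1.
  by rewrite subrr powRr0 !powRr1// !mul1r.
have r1lt : 1 < r by rewrite lt_neqAle eq_sym r1' r1.
(* Young's inequality for [b] and [a ^ (r - 1)], with exponents r and r / (r - 1), is the tangent
   inequality rearranged; r = 1 has no finite conjugate exponent and was treated apart. *)
have q0 : 0 < r / (r - 1) by rewrite divr_gt0//; lra.
have inv : r^-1 + (r / (r - 1))^-1 = 1.
  rewrite invf_div -[X in X + _]mul1r -mulrDl.
  by rewrite addrC subrK divff// gt_eqF.
have := conjugate_powR b0 (powR_ge0 a (r - 1)) r0 q0 inv.
rewrite -powRrM [(r - 1) * _]mulrC divfK ?subr_eq0// => H.
have H2 : r * (b * a `^ (r - 1)) <= b `^ r + (r - 1) * a `^ r.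
  have -> : b `^ r + (r - 1) * a `^ r =
     r * (b `^ r / r + a `^ r / (r / (r - 1))).
    by field; rewrite !gt_eqF// subr_gt0.
  by rewrite ler_pM2l.
have -> : r * a `^ (r - 1) * (a - b) =
  r * (a * a `^ (r - 1)) - r * (b * a `^ (r - 1)) by ring.
rewrite ar; lra.
Qed.

(** Sum the tangent inequality at the mean y. A total weight W below 1 is allowed because it leaves
    a spare term (r - 1) (1 - W) y^r of the right sign. *)
Lemma powR_jensen (R : realType) (I : finType) (P : pred I) (w x : I -> R)
    (r : R) :
  1 <= r -> (forall i, 0 <= w i) -> (forall i, 0 <= x i) ->
  \sum_(i | P i) w i <= 1 ->
  (\sum_(i | P i) w i * x i) `^ r <= \sum_(i | P i) w i * x i `^ r.
Proof.
move=> r1 w0 x0 w1.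
set y := \sum_(i | P i) w i * x i.
have y0 : 0 <= y by apply: sumr_ge0 => i _; exact: mulr_ge0.
have r0 : 0 < r by lra.
have yr : y * y `^ (r - 1) = y `^ r by rewrite mulr_powRB1.
have H : \sum_(i | P i) w i * (y `^ r - x i `^ r) <=
         \sum_(i | P i) w i * (r * y `^ (r - 1) * (y - x i)).
  by apply: ler_sum => i _; rewrite ler_wpM2l// powR_tangent.
have E1 : \sum_(i | P i) w i * (y `^ r - x i `^ r) =
    (\sum_(i | P i) w i) * y `^ r - \sum_(i | P i) w i * x i `^ r.
  by rewrite mulr_suml -sumrB; apply: eq_bigr => i _; rewrite mulrBr.
have E2 : \sum_(i | P i) w i * (r * y `^ (r - 1) * (y - x i)) =
    r * y `^ (r - 1) * ((\sum_(i | P i) w i) * y - y).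
  have -> : (\sum_(i | P i) w i) * y - y = \sum_(i | P i) w i * (y - x i).
    by under [RHS]eq_bigr do rewrite mulrBr; rewrite sumrB -mulr_suml.
  by rewrite mulr_sumr; apply: eq_bigr => i _; ring.
move: H; rewrite E1 E2; set W := \sum_(i | P i) w i => H.
have H3 : r * y `^ (r - 1) * (W * y - y) = r * (W - 1) * y `^ r.
  by rewrite -yr; ring.
rewrite H3 in H.
have : 0 <= (r - 1) * (1 - W) * y `^ r.
  by rewrite mulr_ge0 ?powR_ge0// mulr_ge0// subr_ge0.
nra.
Qed.

Lemma powR_subadd (R : realType) (p a b : R) :
  0 < p <= 1 -> 0 <= a -> 0 <= b -> (a + b) `^ p <= a `^ p + b `^ p.
Proof.
move=> /andP[p0 p1] a0 b0.
have [ab0|ab0] := eqVneq (a + b) 0.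
  by rewrite ab0 powR0 ?gt_eqF// addr_ge0 ?powR_ge0.
have s0 : 0 < a + b by rewrite lt_neqAle eq_sym ab0 addr_ge0.
(* A share c / (a + b) lies in [0, 1], where a power p <= 1 does not decrease it; the two shares add
   up to 1. *)
have key c : 0 <= c <= a + b -> c / (a + b) * (a + b) `^ p <= c `^ p.
  move=> /andP[c0 cs].
  have [->|cn0] := eqVneq c 0; first by rewrite !mul0r powR_ge0.
  have cp : 0 < c by rewrite lt_neqAle eq_sym cn0.
  have -> : c `^ p = (c / (a + b)) `^ p * (a + b) `^ p.
    by rewrite -powRM ?divr_ge0 ?(ltW s0)// divfK.
  rewrite ler_wpM2r ?powR_ge0// ger1_powR// divr_gt0//=.
  by rewrite ler_pdivrMr// mul1r.
have ha := key a; have hb := key b.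
have -> : (a + b) `^ p = a / (a + b) * (a + b) `^ p + b / (a + b) * (a + b) `^ p.
  by rewrite -mulrDl -mulrDl divff// mul1r.
apply: lerD; [apply: ha | apply: hb]; lra.
Qed.

Lemma powR_sum_subadd (R : realType) (I : Type) (s : seq I) (P : pred I)
    (x : I -> R) (p : R) :
  0 < p <= 1 -> (forall i, 0 <= x i) ->
  (\sum_(i <- s | P i) x i) `^ p <= \sum_(i <- s | P i) x i `^ p.
Proof.
move=> p01 x0.
have p0 : p != 0 by case/andP: p01 => p0 _; rewrite gt_eqF.
elim: s => [|i s IH]; first by rewrite !big_nil powR0.
rewrite !big_cons; case: ifP => // _.
apply: (le_trans (powR_subadd p01 _ _)) => //.
  by apply: sumr_ge0.
by rewrite lerD2l.
Qed.

(** * Sublinear functionals and sign-invariant seminorms *)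

Definition sublinear (R : realType) (V : lmodType R) (p : V -> R) : Prop :=
  (forall x y, p (x + y) <= p x + p y) /\
  (forall c x, 0 <= c -> p (c *: x) = c * p x).

Lemma sublinear0 (R : realType) (V : lmodType R) (p : V -> R) :
  sublinear p -> p 0 = 0.
Proof. by move=> [_ h]; rewrite -(scale0r (0 : V)) h// mul0r. Qed.

(** The one-direction step of Hahn-Banach: the infimum of [p (x + t *: e) - t * p e] over t >= 0
    stays sublinear and becomes linear along [e] without changing the value there. *)
Lemma sublinear_inf_ray (R : realType) (V : lmodType R) (p : V -> R) (e : V) :
  sublinear p ->
  exists q : V -> R, [/\ sublinear q, forall x, q x <= p x, q e = p e
    & q (- e) = - p e].
Proof.
move=> sp; have [pD pZ] := sp; have p0 := sublinear0 sp.
pose A x := [set p (x + t *: e) - t * p e | t in [set t : R | 0 <= t]].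
pose q x := inf (A x).
have lbA x : lbound (A x) (- p (- x)).
  move=> _ [t /= t0 <-].
  rewrite -(pZ _ _ t0).
  by have := pD (x + t *: e) (- x); rewrite addrAC subrr add0r; lra.
have hA x : has_inf (A x).
  split; last by exists (- p (- x)); exact: lbA.
  by exists (p (x + 0 *: e) - 0 * p e), 0 => //=.
have qle x t : 0 <= t -> q x <= p (x + t *: e) - t * p e.
  by move=> t0; apply: ge_inf; [exact: (hA x).2 | exists t].
have qge x y : (forall t, 0 <= t -> y <= p (x + t *: e) - t * p e) -> y <= q x.
  move=> h; apply: lb_le_inf; first exact: (hA x).1.
  by move=> _ [t /= t0 <-]; exact: h.
have qp x : q x <= p x by have := qle x 0 (lexx _); rewrite scale0r mul0r addr0 subr0.
have qD x y : q (x + y) <= q x + q y.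
  rewrite -lerBlDr; apply: (qge) => t t0; rewrite lerBlDr -lerBlDl.
  apply: (qge) => s s0; rewrite lerBlDl.
  apply: le_trans (qle _ (t + s) (addr_ge0 t0 s0)) _.
  have := pD (x + t *: e) (y + s *: e).
  by rewrite addrACA -scalerDl; lra.
have qZle c x : 0 < c -> q (c *: x) <= c * q x.
  move=> c0; rewrite mulrC -ler_pdivrMr//; apply: (qge) => t t0.
  rewrite ler_pdivrMr//.
  apply: le_trans (qle _ (c * t) (mulr_ge0 (ltW c0) t0)) _.
  by rewrite -scalerA -scalerDr pZ ?(ltW c0)// -mulrA -mulrBr [leLHS]mulrC.
have q0 : q 0 = 0.
  apply/eqP; rewrite eq_le; apply/andP; split; first by have := qp 0; rewrite p0.
  by apply: (qge) => t t0; rewrite add0r pZ// subrr.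
have qZ c x : 0 <= c -> q (c *: x) = c * q x.
  rewrite le_eqVlt => /predU1P[<-|c0]; first by rewrite scale0r mul0r.
  apply/eqP; rewrite eq_le qZle//=.
  have c0' : 0 < c^-1 by rewrite invr_gt0.
  have := qZle c^-1 (c *: x) c0'; rewrite scalerA mulVf ?gt_eqF// scale1r.
  by rewrite mulrC ler_pdivlMr// mulrC.
have qNe : q (- e) <= - p e.
  by have := qle (- e) 1 ler01; rewrite scale1r addNr p0 mul1r sub0r.
have qe := qp e.
have := qD e (- e); rewrite subrr q0 => h.
exists q; split => //; apply/eqP; rewrite eq_le; apply/andP; split=> //; lra.
Qed.

(** A sublinear minorant of a functional odd at [z] must agree with it at [z] and [- z], so
    linearity gained in one direction survives the later steps. *)
Lemma sublinear_linear_on (R : realType) (V : lmodType R) (p : V -> R) (e : V)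
    (s : seq V) :
  sublinear p ->
  exists q : V -> R, [/\ sublinear q, forall x, q x <= p x, q e = p e
    & forall y, y \in e :: s -> q (- y) = - q y].
Proof.
move=> sp; elim: s => [|y s [q [sq qp qe qN]]].
  have [q [sq qp qe qN]] := sublinear_inf_ray e sp; exists q; split => // y.
  by rewrite inE => /eqP ->; rewrite qN qe.
have [q' [sq' q'q q'y q'Ny]] := sublinear_inf_ray y sq.
have lin z : q (- z) = - q z -> q' z = q z /\ q' (- z) = - q z.
  move=> qz; have := q'q z; have := q'q (- z).
  have := sq'.1 z (- z); rewrite subrr (sublinear0 sq') qz.
  by move=> h1 h2 h3; split; apply/eqP; rewrite eq_le; apply/andP; split; lra.
exists q'; split => //.
- by move=> x; exact: le_trans (q'q _) (qp _).
- by rewrite (lin e (qN _ (mem_head _ _))).1.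
- move=> z; rewrite !inE => /or3P[/eqP->|/eqP->|zs].
  + by have [-> ->] := lin e (qN _ (mem_head _ _)).
  + by rewrite q'Ny q'y.
  + have zes : z \in e :: s by rewrite inE zs orbT.
    by have [-> ->] := lin z (qN _ zes).
Qed.

Lemma hahn_banach_finite (R : realType) (T : finType) (p : (T -> R) -> R)
    (e : T -> R) :
  sublinear (V := (T -> R)) p ->
  exists c : T -> R, (forall f, \sum_t f t * c t <= p f) /\
    \sum_t e t * c t = p e.
Proof.
move=> sp.
(* Oddness on the Dirac functions suffices: they span, and sublinearity bounds the functional by the
   linear one on [f] and on [- f]. *)
pose d (t : T) : T -> R := fun u => (u == t)%:R.
have [q [sq qp qe qN]] := sublinear_linear_on e (map d (enum T)) sp.
have qd t : q (- d t) = - q (d t).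
  by apply: qN; rewrite inE map_f ?orbT// mem_enum.
have qZd a t : q (a *: d t) = a * q (d t).
  have [a0|a0] := lerP 0 a; first by rewrite sq.2.
  have -> : a *: d t = (- a) *: (- d t) by rewrite scaleNr scalerN opprK.
  by rewrite sq.2 ?qd ?mulrNN// oppr_ge0 ltW.
have qsum (s : seq T) (F : T -> (T -> R)) :
    q (\sum_(t <- s) F t) <= \sum_(t <- s) q (F t).
  elim: s => [|t s IH]; first by rewrite !big_nil (sublinear0 sq).
  by rewrite !big_cons (le_trans (sq.1 _ _))// lerD2l.
have decomp (f : T -> R) : f = \sum_t f t *: d t.
  have dE t u : (f t *: d t) u = f t * (u == t)%:R by [].
  apply/funext => u; rewrite fct_sumE (bigD1 u)//= [X in _ + X]big1 ?addr0.
    by rewrite dE eqxx mulr1.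
  by move=> t tu; rewrite dE eq_sym (negbTE tu) mulr0.
have upper (f : T -> R) : q f <= \sum_t f t * q (d t).
  rewrite {1}(decomp f); apply: le_trans (qsum _ _) _.
  by apply: ler_sum => t _; rewrite qZd.
have lower (f : T -> R) : \sum_t f t * q (d t) <= q f.
  have := upper (- f); have := sq.1 f (- f); rewrite subrr (sublinear0 sq).
  have -> : \sum_t (- f) t * q (d t) = - \sum_t f t * q (d t).
    by rewrite -sumrN; apply: eq_bigr => t _; rewrite -mulNr.
  lra.
exists (fun t => q (d t)); split => [f|]; first exact: le_trans (lower f) (qp f).
by rewrite -qe; apply/eqP; rewrite eq_le upper lower.
Qed.

(** * Lattice seminorms and domination by a measure *)

Definition sign_seminorm (R : realType) (T : finType) (N : (T -> R) -> R) : Prop :=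
  [/\ forall f g, N (fun t => f t + g t) <= N f + N g,
      forall c f, N (fun t => c * f t) = `|c| * N f
    & forall (e : T -> bool) f, N (fun t => (-1) ^+ e t * f t) = N f].

Definition ind (R : realType) (T : finType) (A : {set T}) : T -> R :=
  fun t => (t \in A)%:R.
Arguments ind : clear implicits.

Lemma sign_seminorm_ge0 (R : realType) (T : finType) (N : (T -> R) -> R) f :
  sign_seminorm N -> 0 <= N f.
Proof.
move=> [ND NZ _].
have h0 : N (fun t => f t + (-1) * f t) = 0.
  have -> : (fun t => f t + (-1) * f t) = (fun t => 0 * f t).
    by apply/funext => t; ring.
  by rewrite NZ normr0 mul0r.
by have := ND f (fun t => (-1) * f t); rewrite NZ normrN1 mul1r h0; lra.
Qed.

(** Sign changes generate the lattice property: shrinking one coordinate is a convex combination of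
    the function and its reflection in that coordinate. *)
Lemma sign_seminorm_le (R : realType) (T : finType) (N : (T -> R) -> R)
    (f g : T -> R) :
  sign_seminorm N -> (forall t, `|f t| <= `|g t|) -> N f <= N g.
Proof.
move=> sN fg; have [ND NZ NS] := sN.
have one u (h1 h2 : T -> R) : (forall t, t != u -> h1 t = h2 t) ->
    `|h1 u| <= `|h2 u| -> N h1 <= N h2.
  move=> h12 hu.
  have [h20|h20] := eqVneq (h2 u) 0.
    have -> : h1 = h2 => //; apply/funext => t.
    have [->|/h12//] := eqVneq t u.
    by move: hu; rewrite h20 normr0 normr_le0 => /eqP.
  pose a := h1 u / h2 u.
  have a1 : `|a| <= 1.
    by rewrite normrM normfV ler_pdivrMr ?normr_gt0// mul1r.
  have := a1; rewrite ler_norml => /andP[a1l a1r].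
  pose k t := (-1) ^+ (t == u) * h2 t.
  (* the value at u is averaged between h2 u and - h2 u *)
  have -> : h1 = (fun t => (1 + a) / 2 * h2 t + (1 - a) / 2 * k t).
    apply/funext => t; rewrite /k; case: (eqVneq t u) => [->|tu] /=.
      by rewrite expr1 /a; field.
    by rewrite expr0 h12//; field.
  apply: le_trans (ND _ _) _.
  rewrite !NZ /k NS -mulrDl !ger0_norm; lra.
(* Hybrids between [g] and [f], replacing one coordinate at a time along the enumeration of [T]. *)
pose h (n : nat) t := if (enum_rank t < n)%N then f t else g t.
have hn n : N (h n) <= N g.
  elim: n => [|n IH].
    by rewrite (_ : h 0%N = g)//; apply/funext => t; rewrite /h ltn0.
  apply: le_trans IH.
  have [nT|Tn] := ltnP n #|T|; last first.
    rewrite (_ : h n.+1 = h n)//; apply/funext => t; rewrite /h.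
    by rewrite !(leq_trans (ltn_ord (enum_rank t)))// (leq_trans Tn).
  apply: (one (enum_val (Ordinal nT))) => [t tn|]; rewrite /h.
    rewrite ltnS leq_eqVlt.
    case: eqP => //= tn'; case/negP: tn; apply/eqP.
    by apply: enum_rank_inj; rewrite enum_valK; apply: val_inj.
  by rewrite enum_valK /= ltnn ltnSn.
have <- : h #|T| = f by apply/funext => t; rewrite /h ltn_ord.
exact: hn.
Qed.

(** Take a Hahn-Banach functional at the indicator of [A] and replace its coefficients by absolute
    values: sign invariance of [N] keeps it dominated on every indicator, and its value at [A]
    cannot drop. *)
Lemma norming_functional (R : realType) (T : finType) (N : (T -> R) -> R)
    (A : {set T}) :
  sign_seminorm N ->
  exists c : T -> R, [/\ forall t, 0 <= c t, \sum_(t in A) c t = N (ind R T A)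
    & forall B : {set T}, \sum_(t in B) c t <= N (ind R T B)].
Proof.
move=> sN; have [ND NZ NS] := sN.
have sub : sublinear (V := (T -> R)) N.
  by split => [f g|c f c0]; [exact: ND | rewrite [LHS]NZ ger0_norm].
have [c [cN cA]] := hahn_banach_finite (ind R T A) sub.
have le (B : {set T}) : \sum_(t in B) `|c t| <= N (ind R T B).
  rewrite -(NS (fun t => c t < 0)).
  apply: le_trans (cN _); rewrite big_mkcond /=.
  apply: ler_sum => t _; rewrite /ind; case: (t \in B); last by rewrite mulr0 mul0r.
  rewrite mulr1; case: ltrP => ct; first by rewrite expr1 ltr0_norm// mulN1r.
  by rewrite expr0 mul1r ger0_norm.
exists (fun t => `|c t|); split => //.
apply/eqP; rewrite eq_le le /= -cA [X in _ <= X]big_mkcond /=.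
apply: ler_sum => t _; rewrite /ind; case: (t \in A); last by rewrite mul0r.
by rewrite mul1r ler_norm.
Qed.

(* Take a colouring maximizing the sum.  Recolouring B with an unused colour
   cannot increase it, and the loss on each colour class is controlled by a
   functional norming the class. *)
Lemma pisier_domination (R : realType) (T : finType) (N : (T -> R) -> R)
    (r V : R) :
  sign_seminorm N -> 1 <= r ->
  (forall chi : {ffun T -> 'I_#|T|.+1},
     \sum_j N (ind R T [set t | chi t == j]%SET) `^ r <= V) ->
  exists nu : T -> R, [/\ forall t, 0 <= nu t, \sum_t nu t <= V
    & forall B : {set T}, N (ind R T B) `^ r <= r * \sum_(t in B) nu t].
Proof.
move=> sN r1 hV.
pose cls (chi : {ffun T -> 'I_#|T|.+1}) j : {set T} := [set t | chi t == j]%SET.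
pose W chi := \sum_j N (ind R T (cls chi j)) `^ r.
pose chi := [arg max_(chi > [ffun=> ord0] : {ffun T -> 'I_#|T|.+1}) W chi]%O.
have Wmax chi' : W chi' <= W chi.
  by rewrite /chi; case: Order.TotalTheory.arg_maxP => //= i _; apply.
have cP j := norming_functional (cls chi j) sN.
pose c j := projT1 (cid (cP j)).
have c_ge0 j t : 0 <= c j t by rewrite /c; case: cid => ? [].
have c_cls j : \sum_(t in cls chi j) c j t = N (ind R T (cls chi j)).
  by rewrite /c; case: cid => ? [].
have c_le j (B : {set T}) : \sum_(t in B) c j t <= N (ind R T B).
  by rewrite /c; case: cid => ? [].
have N0 (B : {set T}) : 0 <= N (ind R T B) by exact: sign_seminorm_ge0.
(* Up to the factor r, this is the derivative of the r-th power at the seminorm of the class, times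
   the norming functional; the class then has mass exactly its r-th power. *)
pose nu t := N (ind R T (cls chi (chi t))) `^ (r - 1) * c (chi t) t.
have nu_sum (B : {set T}) : \sum_(t in B) nu t =
    \sum_j N (ind R T (cls chi j)) `^ (r - 1) * \sum_(t in cls chi j :&: B) c j t.
  rewrite (partition_big chi xpredT)//=; apply: eq_bigr => j _.
  rewrite mulr_sumr; apply: eq_big => [t|t /andP[_ /eqP <-]//].
  by rewrite !inE andbC.
exists nu; split.
- by move=> t; rewrite mulr_ge0 ?powR_ge0.
- have -> : \sum_t nu t = W chi; last exact: hV.
  have := nu_sum [set: T]%SET; under eq_bigl do rewrite inE.
  move=> ->; apply: eq_bigr => j _; rewrite finset.setIT c_cls mulrC mulr_powRB1//; lra.
- move=> B.
  (* Pigeonhole: there is one colour more than there are points. *)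
  have [k kP] : exists k, k \notin codom chi.
    apply/existsP; rewrite -negb_forall; apply/negP => /forallP onto.
    have : (#|'I_#|T|.+1| <= #|codom chi|)%N.
      by apply: subset_leq_card; apply/fintype.subsetP => j _; exact: onto.
    by rewrite card_ord => /leq_trans/(_ (leq_image_card _ _)); rewrite ltnn.
  have clsk : cls chi k = finset.set0.
    apply/setP => t; rewrite !inE; apply/negP => /eqP tk.
    by move/negP: kP; apply; rewrite -tk codom_f.
  pose chi' : {ffun T -> 'I_#|T|.+1} := [ffun t => if t \in B then k else chi t].
  have cls'k : cls chi' k = B.
    apply/setP => t; rewrite !inE ffunE; case: ifP => [_|_]; first by rewrite eqxx.
    by have := congr1 (fun C : {set T} => t \in C) clsk; rewrite !inE.
  have cls'j j : j != k -> cls chi' j = cls chi j :\: B.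
    move=> jk; apply/setP => t; rewrite !inE ffunE; case: ifP => //= _.
    by rewrite eq_sym (negbTE jk).
  have N00 : N (ind R T finset.set0) `^ r = 0.
    rewrite (_ : ind R T finset.set0 = fun t => 0 * ind R T finset.set0 t).
      by have [_ -> _] := sN; rewrite normr0 mul0r powR0//; apply/eqP; lra.
    by apply/funext => t; rewrite mul0r /ind inE.
  have e1 : W chi' = N (ind R T B) `^ r +
      \sum_(j | j != k) N (ind R T (cls chi j :\: B)) `^ r.
    rewrite /W [LHS](bigD1 k)//= cls'k; congr (_ + _).
    by apply: eq_bigr => j jk; rewrite cls'j.
  have e2 : W chi = \sum_(j | j != k) N (ind R T (cls chi j)) `^ r.
    by rewrite /W [LHS](bigD1 k)//= clsk N00 add0r.
  have := Wmax chi'; rewrite e1 e2 -lerBrDr -sumrB => /le_trans; apply.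
  rewrite nu_sum [X in _ <= _ * X](bigD1 k)//= clsk finset.set0I big_set0 mulr0 add0r mulr_sumr.
  apply: ler_sum => j jk.
  apply: le_trans (powR_tangent r1 (N0 _) (N0 _)) _.
  rewrite mulrA ler_wpM2l ?mulr_ge0 ?powR_ge0//; first by lra.
  rewrite lerBlDr; apply: le_trans (_ : _ <= \sum_(t in cls chi j :&: B) c j t +
    \sum_(t in cls chi j :\: B) c j t) _; last by rewrite lerD2l.
  by rewrite -c_cls (big_setID B).
Qed.

(** * From indicators to arbitrary sequences *)

Lemma sign_seminorm_sum (R : realType) (T : finType) (N : (T -> R) -> R)
    (n : nat) (F : nat -> T -> R) :
  sign_seminorm N ->
  N (fun t => \sum_(k < n) F k t) <= \sum_(k < n) N (F k).
Proof.
move=> sN; have [ND NZ _] := sN; elim: n => [|n IH].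
  rewrite big_ord0 (_ : (fun t => _) = (fun t => 0 * F 0%N t)).
    by rewrite NZ normr0 mul0r.
  by apply/funext => t; rewrite big_ord0 mul0r.
rewrite big_ord_recr /= (_ : (fun t => _) =
    (fun t => (\sum_(k < n) F k t) + F n t)).
  by rewrite (le_trans (ND _ _))// lerD2r.
by apply/funext => t; rewrite big_ord_recr.
Qed.

(** The 1 pays for the values of [phi] below the threshold, and the fraction for the geometric
    series over the dyadic level sets above it. *)
Definition lorentz_const (R : realType) (s r : R) : R :=
  1 + 2 / (1 - 2 `^ (1 - s / r)).

Lemma powR2_lt1 (R : realType) (s r : R) :
  0 < r -> r < s -> 2 `^ (1 - s / r) < 1 :> R.
Proof.
move=> r0 rs; have h : 1 - s / r < 0.
  by rewrite subr_lt0 ltr_pdivlMr// mul1r.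
rewrite /powR pnatr_eq0/= expR_lt1 nmulr_rlt0// ln_gt0//; lra.
Qed.

Lemma lorentz_const_ge1 (R : realType) (s r : R) :
  0 < r -> r < s -> 1 <= lorentz_const s r.
Proof.
move=> r0 rs; have := powR2_lt1 r0 rs => h.
by rewrite /lorentz_const lerDl divr_ge0// subr_ge0 ltW.
Qed.

Lemma geometric_sum_le (R : realType) (q : R) (n : nat) :
  0 <= q < 1 -> \sum_(k < n) q ^+ k <= (1 - q)^-1.
Proof.
move=> /andP[q0 q1]; have q1' : 0 < 1 - q by lra.
rewrite -[leRHS]mul1r ler_pdivlMr//.
have := subrX1 q n; have := exprn_ge0 n q0; lra.
Qed.

(* Bound phi by its dyadic level sets {|phi| > lam 2^k}. *)
Lemma lorentz_le_aux (R : realType) (T : finType) (N : (T -> R) -> R)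
    (kap r s lam : R) (mu phi : T -> R) :
  sign_seminorm N -> 1 <= r -> r < s -> 0 <= kap -> 0 < lam ->
  (forall t, 0 <= mu t) -> \sum_t mu t <= 1 ->
  (forall B : {set T}, N (ind R T B) <= kap * (\sum_(t in B) mu t) `^ r^-1) ->
  \sum_t `|phi t| `^ s * mu t <= lam `^ s ->
  N phi <= kap * lorentz_const s r * lam.
Proof.
move=> sN r1 rs kap0 lam0 mu0 mu1 hN hphi.
have [ND NZ _] := sN.
have r0 : 0 < r by lra.
have s0 : 0 < s by lra.
pose B k : {set T} := [set t | lam * 2 ^+ k < `|phi t|]%SET.
have [n hn] : exists n, forall t, `|phi t| <= lam * 2 ^+ n.
  have := archi_boundP (_ : 0 <= (\sum_t `|phi t|) / lam).
  set n := Num.bound _ => hb; exists n => t.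
  have b0 : 0 <= (\sum_t `|phi t|) / lam.
    by rewrite divr_ge0 ?(ltW lam0)// sumr_ge0.
  have /ltW := hb b0; rewrite ler_pdivrMr// mulrC => /(le_trans _) hle.
  apply: le_trans (_ : _ <= lam * n%:R) _; first apply: hle.
    by rewrite (bigD1 t)//= lerDl sumr_ge0.
  by rewrite ler_wpM2l ?(ltW lam0)// -natrX ler_nat ltnW// ltn_expl.
(* If |phi| exceeds [lam * 2 ^+ m], the single term of [B m] already reaches the next threshold;
   otherwise the induction hypothesis applies. *)
have dom m t : `|phi t| <= lam * 2 ^+ m ->
    `|phi t| <= lam + \sum_(k < m) lam * 2 ^+ k.+1 * ind R T (B k) t.
  elim: m => [|m IH] h; first by rewrite big_ord0 addr0 (le_trans h)// expr0 mulr1.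
  rewrite big_ord_recr /= addrA.
  have [hm|hm] := lerP `|phi t| (lam * 2 ^+ m).
    by rewrite (le_trans (IH hm))// lerDl !mulr_ge0 ?(ltW lam0)// ?exprn_ge0// ler0n.
  rewrite /ind !inE hm mulr1 (le_trans h)// lerDr addr_ge0 ?(ltW lam0)//.
  by apply: sumr_ge0 => k _; rewrite !mulr_ge0 ?(ltW lam0)// ?exprn_ge0// ler0n.
pose g t := lam * ind R T [set: T]%SET t +
  \sum_(k < n) lam * 2 ^+ k.+1 * ind R T (B k) t.
have phig : N phi <= N g.
  apply: sign_seminorm_le => // t; rewrite [X in _ <= X]ger0_norm.
    by rewrite /g {1}/ind inE mulr1; exact: dom.
  rewrite addr_ge0 ?mulr_ge0 ?(ltW lam0) ?ler0n//.
  by apply: sumr_ge0 => k _; rewrite !mulr_ge0 ?(ltW lam0)// ?exprn_ge0// ler0n.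
apply: le_trans phig _; apply: le_trans (ND _ _) _.
have hT : N (ind R T [set: T]%SET) <= kap.
  apply: le_trans (hN _) _; rewrite -[leRHS]mulr1 ler_wpM2l//.
  under eq_bigl do rewrite inE.
  have -> : 1 = 1 `^ r^-1 :> R by rewrite powR1.
  rewrite ge0_ler_powR ?invr_ge0 ?nnegrE ?sumr_ge0 ?(ltW r0)//.
(* Chebyshev's inequality: [B k] has mass at most [2 ^ (- k s)]. *)
have hB k : N (ind R T (B k)) <= kap * (2 `^ (- s / r)) ^+ k.
  apply: le_trans (hN _) _; rewrite ler_wpM2l//.
  have -> : (2 `^ (- s / r)) ^+ k = ((2 ^+ k) `^ (- s)) `^ r^-1 :> R.
    by rewrite -!powR_mulrn ?powR_ge0// -!powRrM; congr (_ `^ _); ring.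
  rewrite ge0_ler_powR ?invr_ge0 ?nnegrE ?sumr_ge0 ?(ltW r0) ?powR_ge0//.
  rewrite powRN -[leRHS]mul1r ler_pdivlMr ?powR_gt0 ?exprn_gt0//.
  have ls0 : 0 < lam `^ s by rewrite powR_gt0.
  rewrite -(ler_pM2l ls0) mulr1 mulrCA -powRM ?(ltW lam0) ?exprn_ge0//.
  apply: le_trans hphi; rewrite mulr_suml [leLHS]big_mkcond /=.
  apply: ler_sum => t _; rewrite inE; case: ifP => ht.
    rewrite mulrC ler_wpM2r// ge0_ler_powR ?nnegrE ?(ltW s0) ?(ltW ht)//.
    by rewrite mulr_ge0 ?exprn_ge0// ltW.
  by rewrite mulr_ge0 ?powR_ge0.
have hS : N (fun t => \sum_(k < n) lam * 2 ^+ k.+1 * ind R T (B k) t) <=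
    \sum_(k < n) lam * 2 ^+ k.+1 * (kap * (2 `^ (- s / r)) ^+ k).
  apply: le_trans (sign_seminorm_sum n
    (fun k t => lam * 2 ^+ k.+1 * ind R T (B k) t) sN) _.
  apply: ler_sum => k _; rewrite NZ ger0_norm ?mulr_ge0 ?exprn_ge0 ?(ltW lam0)//.
  by rewrite ler_wpM2l ?hB// mulr_ge0 ?exprn_ge0 ?(ltW lam0).
have q1 := powR2_lt1 r0 rs.
have hG : \sum_(k < n) lam * 2 ^+ k.+1 * (kap * (2 `^ (- s / r)) ^+ k) <=
    kap * lam * (2 / (1 - 2 `^ (1 - s / r))).
  rewrite (_ : \sum_(k < n) _ = kap * lam * 2 * \sum_(k < n) (2 `^ (1 - s / r)) ^+ k).
    rewrite [leRHS]mulrA ler_wpM2l ?mulr_ge0 ?(ltW lam0)//.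
    by rewrite geometric_sum_le// powR_ge0.
  rewrite mulr_sumr; apply: eq_bigr => k _.
  have -> : 2 `^ (1 - s / r) = 2 * 2 `^ (- s / r) :> R.
    by rewrite powRD ?pnatr_eq0 ?implybT// powRr1// mulNr.
  by rewrite exprMn exprS; ring.
rewrite NZ ger0_norm ?(ltW lam0)//.
apply: le_trans (lerD (ler_wpM2l (ltW lam0) hT) (le_trans hS hG)) _.
rewrite /lorentz_const; lra.
Qed.

Lemma lorentz_le (R : realType) (T : finType) (N : (T -> R) -> R)
    (kap r s : R) (mu phi : T -> R) :
  sign_seminorm N -> 1 <= r -> r < s -> 0 <= kap ->
  (forall t, 0 <= mu t) -> \sum_t mu t <= 1 ->
  (forall B : {set T}, N (ind R T B) <= kap * (\sum_(t in B) mu t) `^ r^-1) ->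
  N phi <= kap * lorentz_const s r * (\sum_t `|phi t| `^ s * mu t) `^ s^-1.
Proof.
move=> sN r1 rs kap0 mu0 mu1 hN.
set S := \sum_t _; have r0 : 0 < r by lra.
have s0 : 0 < s by lra.
have S0 : 0 <= S by apply: sumr_ge0 => t _; rewrite mulr_ge0 ?powR_ge0.
have K0 : 0 <= kap * lorentz_const s r.
  by rewrite mulr_ge0// (le_trans ler01)// lorentz_const_ge1.
have lamS : (S `^ s^-1) `^ s = S by rewrite -powRrM mulVf ?gt_eqF// powRr1.
(* The threshold must be positive while [S] may vanish, so it is taken slightly above [S ^ (1 / s)].
   When the constant in front is zero, any excess will do. *)
apply/ler_addgt0Pr => e e0.
have [K00|Kn0] := eqVneq (kap * lorentz_const s r) 0.
  have := @lorentz_le_aux R T N kap r s (S `^ s^-1 + 1) mu phi sN r1 rs kap0.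
  rewrite K00 !mul0r add0r => h; apply: le_trans (ltW e0); apply: h => //.
    by have := powR_ge0 S s^-1; lra.
  rewrite -[leLHS]lamS ge0_ler_powR ?nnegrE ?powR_ge0 ?(ltW s0)//.
    by have := powR_ge0 S s^-1; lra.
  lra.
have Kp : 0 < kap * lorentz_const s r by rewrite lt_neqAle eq_sym Kn0.
have := @lorentz_le_aux R T N kap r s
  (S `^ s^-1 + e / (kap * lorentz_const s r)) mu phi sN r1 rs kap0.
have -> : kap * lorentz_const s r * (S `^ s^-1 + e / (kap * lorentz_const s r)) =
    kap * lorentz_const s r * S `^ s^-1 + e by rewrite mulrDr [X in _ + X]mulrC divfK.
move=> h; apply: h => //.
  by have := powR_ge0 S s^-1; have := divr_gt0 e0 Kp; lra.
have := divr_gt0 e0 Kp => eK.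
rewrite -[leLHS]lamS ge0_ler_powR ?nnegrE ?powR_ge0 ?(ltW s0)//.
  by have := powR_ge0 S s^-1; lra.
lra.
Qed.

(** * Rademacher averages *)

Lemma l2_triangle (R : realType) (W : finType) (a b c : W -> R) :
  (forall w, 0 <= a w) -> (forall w, 0 <= b w) -> (forall w, 0 <= c w) ->
  (forall w, c w <= a w + b w) ->
  Num.sqrt (\sum_w c w ^+ 2) <=
  Num.sqrt (\sum_w a w ^+ 2) + Num.sqrt (\sum_w b w ^+ 2).
Proof.
move=> a0 b0 c0 cab; apply/ler_addgt0Pr => e e0.
pose A := Num.sqrt (\sum_w a w ^+ 2); pose B := Num.sqrt (\sum_w b w ^+ 2).
have A0 : 0 <= A by exact: sqrtr_ge0.
have B0 : 0 <= B by exact: sqrtr_ge0.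
have AE : \sum_w a w ^+ 2 = A ^+ 2 by rewrite sqr_sqrtr// sumr_ge0// => w _; exact: sqr_ge0.
have BE : \sum_w b w ^+ 2 = B ^+ 2 by rewrite sqr_sqrtr// sumr_ge0// => w _; exact: sqr_ge0.
rewrite -/A -/B.
(* Cauchy-Schwarz with these weights; the shift by [e / 2] keeps them positive when [A] or [B]
   vanishes. *)
pose al := A + e / 2; pose be := B + e / 2.
have al0 : 0 < al by rewrite /al; lra.
have be0 : 0 < be by rewrite /be; lra.
have -> : A + B + e = al + be by rewrite /al /be; lra.
have abe0 : 0 <= al + be by lra.
rewrite -(ger0_norm abe0) -sqrtr_sqr ler_wsqrtr//.
have step w : c w ^+ 2 <= (al + be) * (a w ^+ 2 / al + b w ^+ 2 / be).
  apply: le_trans (_ : (a w + b w) ^+ 2 <= _).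
    by rewrite ler_pXn2r ?nnegrE ?addr_ge0.
  have -> : (al + be) * (a w ^+ 2 / al + b w ^+ 2 / be) =
     (a w + b w) ^+ 2 + (be * a w - al * b w) ^+ 2 / (al * be).
    by field; rewrite !gt_eqF.
  by rewrite lerDl divr_ge0 ?sqr_ge0// mulr_ge0// ltW.
apply: le_trans (ler_sum _ (fun w _ => step w)) _.
rewrite -mulr_sumr big_split /= -!mulr_suml AE BE expr2 ler_wpM2l//.
have h (x y : R) : 0 <= x -> x <= y -> 0 < y -> x ^+ 2 / y <= y.
  by move=> x0 xy y0; rewrite ler_pdivrMr// -expr2 ler_pXn2r// nnegrE ltW.
by rewrite lerD// h// /al /be; lra.
Qed.

(** Minkowski's inequality for a weighted sum of vectors of l^rho: normalize each vector by its norm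
    [m v] and apply Jensen with the weights [w v * m v / S]. *)
Lemma l1_powR_le (R : realType) (J W : finType) (w : W -> R) (a : J -> W -> R)
    (rho : R) :
  1 <= rho -> (forall v, 0 <= w v) -> (forall j v, 0 <= a j v) ->
  \sum_j (\sum_v w v * a j v) `^ rho <=
  (\sum_v w v * (\sum_j a j v `^ rho) `^ rho^-1) `^ rho.
Proof.
move=> rho1 w0 a0.
have rho0 : 0 < rho by lra.
have rho_n0 : rho != 0 by rewrite gt_eqF.
pose m v := (\sum_j a j v `^ rho) `^ rho^-1.
have m0 v : 0 <= m v by exact: powR_ge0.
have mE v : m v `^ rho = \sum_j a j v `^ rho.
  rewrite -powRrM mulVf// powRr1// sumr_ge0// => j _; exact: powR_ge0.
have am j v : a j v <= m v.
  have -> : a j v = (a j v `^ rho) `^ rho^-1 by rewrite -powRrM divff// powRr1.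
  rewrite ge0_ler_powR ?invr_ge0 ?(ltW rho0) ?nnegrE ?powR_ge0//.
    by apply: sumr_ge0 => i _; exact: powR_ge0.
  by rewrite (bigD1 j)//= lerDl sumr_ge0// => i _; exact: powR_ge0.
rewrite -/(m _); set S := \sum_v w v * m v.
have S0 : 0 <= S by apply: sumr_ge0 => v _; exact: mulr_ge0.
have [S00|Sn0] := eqVneq S 0.
  rewrite big1 ?powR_ge0// => j _.
  rewrite big1 ?powR0// => v _.
  have /eqP : w v * m v = 0.
    apply/eqP; rewrite eq_le mulr_ge0// andbT -S00 /S (bigD1 v)//= lerDl.
    by apply: sumr_ge0 => u _; exact: mulr_ge0.
  rewrite mulf_eq0 => /orP[/eqP->|/eqP mv]; first by rewrite mul0r.
  have : a j v <= 0 by rewrite -mv.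
  by move=> h; have := a0 j v; move=> h'; rewrite (_ : a j v = 0) ?mulr0//; lra.
have Sp : 0 < S by rewrite lt_neqAle eq_sym Sn0.
pose x j v := a j v / m v.
have x0 j v : 0 <= x j v by rewrite divr_ge0.
have wa j v : w v * a j v = S * (w v * m v / S * x j v).
  have [mv|mv] := eqVneq (m v) 0.
    have -> : a j v = 0 by have := am j v; have := a0 j v; rewrite mv; lra.
    by rewrite mv !(mulr0,mul0r).
  by rewrite /x; field; rewrite mv Sn0.
have bound j : (\sum_v w v * a j v) `^ rho <=
    S `^ rho * \sum_v w v * m v / S * x j v `^ rho.
  under eq_bigr do rewrite wa.
  have Sx0 : 0 <= \sum_v w v * m v / S * x j v.
    by apply: sumr_ge0 => v _; rewrite !mulr_ge0// invr_ge0.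
  rewrite -mulr_sumr powRM//.
  rewrite ler_wpM2l ?powR_ge0//; apply: powR_jensen => //.
    by move=> v; rewrite !mulr_ge0// invr_ge0.
  by rewrite -mulr_suml divff.
apply: le_trans (ler_sum _ (fun j _ => bound j)) _.
rewrite -mulr_sumr -[leRHS]mulr1 ler_wpM2l ?powR_ge0// exchange_big /=.
apply: le_trans (_ : \sum_v w v * m v / S <= _); last by rewrite -mulr_suml divff.
apply: ler_sum => v _; rewrite -mulr_sumr -[leRHS]mulr1 ler_wpM2l//.
  by rewrite !mulr_ge0// invr_ge0.
have [mv|mv] := eqVneq (m v) 0.
  by rewrite big1// => j _; rewrite /x mv invr0 mulr0 powR0.
have mvp : 0 < m v `^ rho by rewrite powR_gt0// lt_neqAle eq_sym mv m0.
rewrite (_ : \sum_j _ = (\sum_j a j v `^ rho) / m v `^ rho).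
  by rewrite -mE divff// gt_eqF.
rewrite mulr_suml; apply: eq_bigr => j _.
by rewrite /x powRM ?invr_ge0// -powR_inv1// -powRrM mulN1r powRN.
Qed.

Definition rad (R : realType) (X : normedModType R) (L : finType) (y : L -> X) : R :=
  Num.sqrt ((2 ^+ #|L|)^-1 *
    \sum_(e : {ffun L -> bool}) `|\sum_l (-1) ^+ e l *: y l| ^+ 2).

Definition flip (L : finType) (d : L -> bool) (e : {ffun L -> bool}) :
  {ffun L -> bool} := [ffun l => d l (+) e l].

Lemma flipK (L : finType) (d : L -> bool) : involutive (flip d).
Proof. by move=> e; apply/ffunP => l; rewrite !ffunE addbA addbb addFb. Qed.

Section rad.
Variables (R : realType) (X : normedModType R).
Implicit Types (L : finType).

Lemma rad_ge0 L (y : L -> X) : 0 <= rad y.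
Proof. exact: sqrtr_ge0. Qed.

Lemma rad_sqr L (y : L -> X) : rad y ^+ 2 = (2 ^+ #|L|)^-1 *
    \sum_(e : {ffun L -> bool}) `|\sum_l (-1) ^+ e l *: y l| ^+ 2.
Proof.
rewrite sqr_sqrtr// mulr_ge0 ?invr_ge0 ?exprn_ge0//.
by apply: sumr_ge0 => e _; exact: sqr_ge0.
Qed.

Lemma sum_flip L (d : L -> bool) (F : {ffun L -> bool} -> R) :
  \sum_e F (flip d e) = \sum_e F e.
Proof.
rewrite [RHS](reindex_inj (h := flip d))//; exact: inv_inj (flipK d).
Qed.

Lemma rad_sign L (d : L -> bool) (y : L -> X) :
  rad (fun l => (-1) ^+ d l *: y l) = rad y.
Proof.
congr (Num.sqrt (_ * _)); rewrite -[RHS](sum_flip d).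
apply: eq_bigr => e _; congr (`|_| ^+ 2); apply: eq_bigr => l _.
by rewrite scalerA ffunE signr_addb mulrC.
Qed.

Lemma radZ L (c : R) (y : L -> X) : rad (fun l => c *: y l) = `|c| * rad y.
Proof.
apply/eqP; rewrite -(@eqrXn2 _ 2)// ?mulr_ge0 ?rad_ge0//.
rewrite exprMn !rad_sqr mulrCA; apply/eqP; congr (_ * _).
rewrite mulr_sumr; apply: eq_bigr => e _; rewrite -exprMn -normrZ scaler_sumr.
congr (`|_| ^+ 2); apply: eq_bigr => l _.
by rewrite !scalerA mulrC.
Qed.

Lemma rad_triangle L (y z : L -> X) : rad (fun l => y l + z l) <= rad y + rad z.
Proof.
rewrite /rad !sqrtrM ?invr_ge0 ?exprn_ge0// -mulrDr ler_wpM2l ?sqrtr_ge0//.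
apply: (@l2_triangle R {ffun L -> bool} (fun e => `|\sum_l (-1) ^+ e l *: y l|)
  (fun e => `|\sum_l (-1) ^+ e l *: z l|)
  (fun e => `|\sum_l (-1) ^+ e l *: (y l + z l)|)) => // e.
under eq_bigr do rewrite scalerDr.
by rewrite big_split ler_normD.
Qed.

Lemma rad0 L : rad (fun _ : L => 0 : X) = 0.
Proof.
have := radZ (L := L) 0 (fun=> 0 : X); rewrite normr0 mul0r => <-.
by congr rad; apply/funext => l; rewrite scale0r.
Qed.

Lemma rad_sum L (I : Type) (s : seq I) (P : pred I) (y : I -> L -> X) :
  rad (fun l => \sum_(i <- s | P i) y i l) <= \sum_(i <- s | P i) rad (y i).
Proof.
elim: s => [|i s IH].
  by rewrite big_nil (_ : (fun _ => _) = (fun=> 0)) ?rad0//; apply/funext => l; rewrite big_nil.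
rewrite big_cons; case: ifP => Pi.
  rewrite (_ : (fun _ => _) = (fun l => y i l + \sum_(j <- s | P j) y j l)).
    by rewrite (le_trans (rad_triangle _ _))// lerD2l.
  by apply/funext => l; rewrite big_cons Pi.
rewrite (_ : (fun _ => _) = (fun l => \sum_(j <- s | P j) y j l))//.
by apply/funext => l; rewrite big_cons Pi.
Qed.

Lemma rad_sign_seminorm L (y : L -> X) :
  sign_seminorm (fun phi : L -> R => rad (fun l => phi l *: y l)).
Proof.
split => [f g|c f|d f].
- by under [X in rad X]eq_fun do rewrite scalerDl; exact: rad_triangle.
- by under [X in rad X]eq_fun do rewrite -scalerA; exact: radZ.
- by under [X in rad X]eq_fun do rewrite -scalerA; exact: rad_sign.
Qed.

(* The signs read off the larger index set are uniformly distributed: average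
   over all translations of the smaller one. *)
Lemma rad_inj L L' (f : L' -> L) (y : L -> X) :
  injective f -> (forall l, l \notin codom f -> y l = 0) ->
  rad y = rad (y \o f).
Proof.
move=> f_inj y0.
pose G (d : {ffun L' -> bool}) := `|\sum_l (-1) ^+ d l *: y (f l)| ^+ 2.
pose res (e : {ffun L -> bool}) : {ffun L' -> bool} := [ffun l => e (f l)].
have resE (e : {ffun L -> bool}) : `|\sum_l (-1) ^+ e l *: y l| ^+ 2 = G (res e).
  rewrite /G; congr (`|_| ^+ 2).
  under [RHS]eq_bigr do rewrite ffunE.
  rewrite (bigID (mem (f @: [set: L']%SET)%SET))/= [X in _ + X]big1 ?addr0.
    by rewrite big_imset/=; [apply: eq_bigl => l; rewrite inE | move=> ? ? _ _ /f_inj].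
  move=> l lf; rewrite y0 ?scaler0//; apply: contra lf => /codomP[l' ->].
  by rewrite imset_f// inE.
pose ext (d : {ffun L' -> bool}) l :=
  if [pick l' | f l' == l] is Some l' then d l' else false.
have extE (d : {ffun L' -> bool}) l : ext d (f l) = d l.
  by rewrite /ext; case: pickP => [l' /eqP/f_inj ->//|/(_ l)]; rewrite eqxx.
have key : (2 ^ #|L'|)%:R * \sum_e G (res e) = (2 ^ #|L|)%:R * \sum_d G d.
  have cd (A : finType) : #|{ffun A -> bool}| = (2 ^ #|A|)%N.
    by rewrite card_ffun card_bool.
  have sumc (A : finType) (x : R) : \sum_(d : {ffun A -> bool}) x = (2 ^ #|A|)%:R * x.
    by rewrite sumr_const cd mulr_natl.
  rewrite -!sumc.
  transitivity (\sum_(d : {ffun L' -> bool}) \sum_e G (res (flip (ext d) e))).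
    by apply: eq_bigr => d _; rewrite (sum_flip (ext d) (fun e => G (res e))).
  rewrite exchange_big; apply: eq_bigr => e _ /=.
  rewrite -(sum_flip (res e) G); apply: eq_bigr => d _; congr G.
  by apply/ffunP => l; rewrite !ffunE extE addbC.
rewrite /rad; congr Num.sqrt; under eq_bigr do rewrite resE.
move: key; rewrite !natrX => key.
apply: (@mulfI _ (2 ^+ #|L'| * 2 ^+ #|L|)).
  by rewrite mulf_neq0// expf_neq0// pnatr_eq0.
rewrite [LHS]mulrA mulfK ?expf_neq0 ?pnatr_eq0// key.
rewrite -[RHS]mulrA [X in _ = X]mulrCA mulVKf ?expf_neq0 ?pnatr_eq0//.
Qed.

(** * Lower estimates from cotype *)

Definition disc_cotype (r C : R) : Prop :=
  0 <= C /\ forall (n : nat) (y : 'I_n -> X),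
    (\sum_j `|y j| `^ r) `^ r^-1 <= C * rad y.

(** The H^2 norm of a truncation, in the abstract: [k] runs over cells, [l] over levels, and
    [tau k l] is the interval whose multiplier acts at that place. *)
Definition bnorm (K L T : finType) (c : R) (tau : K -> L -> T) (y : K -> L -> X)
    (phi : T -> R) : R :=
  Num.sqrt (c * \sum_k rad (fun l => phi (tau k l) *: y k l) ^+ 2).

Lemma bnorm_sign_seminorm (K L T : finType) (c : R) (tau : K -> L -> T)
    (y : K -> L -> X) :
  0 <= c -> sign_seminorm (bnorm c tau y).
Proof.
move=> c0; split => [f g|a f|d f]; rewrite /bnorm.
- rewrite !sqrtrM// -mulrDr ler_wpM2l ?sqrtr_ge0//.
  apply: (@l2_triangle R K (fun k => rad (fun l => f (tau k l) *: y k l))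
    (fun k => rad (fun l => g (tau k l) *: y k l))
    (fun k => rad (fun l => (f (tau k l) + g (tau k l)) *: y k l)));
    try by move=> k; exact: rad_ge0.
  move=> k; under [X in rad X]eq_fun do rewrite scalerDl.
  exact: rad_triangle.
- rewrite -sqrtr_sqr -sqrtrM ?sqr_ge0// mulrCA; congr (Num.sqrt (_ * _)).
  rewrite mulr_sumr; apply: eq_bigr => k _.
  under [X in rad X]eq_fun do rewrite -scalerA.
  by rewrite radZ exprMn real_normK ?num_real.
- congr (Num.sqrt (_ * _)); apply: eq_bigr => k _; congr (_ ^+ 2).
  under [X in rad X]eq_fun do rewrite -scalerA.
  exact: (rad_sign (fun l => d (tau k l))).
Qed.

(** Cotype is applied to the colour components at each fixed cell and sign pattern. Minkowski in
    l^(r/2), available since r >= 2, interchanges the sum over colours with the average over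
    patterns. *)
Lemma bnorm_lower (K L T : finType) (c r C : R) (tau : K -> L -> T)
    (y : K -> L -> X) (M : nat) (chi : {ffun T -> 'I_M}) :
  0 <= c -> 2 <= r -> disc_cotype r C ->
  \sum_j bnorm c tau y (ind R T [set t | chi t == j]%SET) `^ r <=
  (C * bnorm c tau y (fun=> 1)) `^ r.
Proof.
move=> c0 r2 [C0 hC].
have r0 : 0 < r by lra.
pose W := (K * {ffun L -> bool})%type.
pose w0 := c * (2 ^+ #|L|)^-1.
have w00 : 0 <= w0 by rewrite mulr_ge0// invr_ge0 exprn_ge0.
pose F (j : 'I_M) (w : W) : X :=
  \sum_l (-1) ^+ w.2 l *: (ind R T [set t | chi t == j]%SET (tau w.1 l) *: y w.1 l).
have bE j : bnorm c tau y (ind R T [set t | chi t == j]%SET) =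
    (\sum_(w : W) w0 * `|F j w| ^+ 2) `^ 2^-1.
  rewrite powR12_sqrt; last by apply: sumr_ge0 => w _; rewrite mulr_ge0 ?sqr_ge0.
  congr Num.sqrt; rewrite -mulr_sumr /w0 -mulrA; congr (_ * _).
  rewrite mulr_sumr -(pair_bigA _ (fun k e => (2 ^+ #|L|)^-1 * `|F j (k, e)| ^+ 2))/=.
  by apply: eq_bigr => k _; rewrite rad_sqr mulr_sumr.
pose rho := r / 2.
have rho1 : 1 <= rho by rewrite /rho; lra.
have lhsE : \sum_j bnorm c tau y (ind R T [set t | chi t == j]%SET) `^ r =
    \sum_j (\sum_(w : W) w0 * `|F j w| ^+ 2) `^ rho.
  by apply: eq_bigr => j _; rewrite bE -powRrM mulrC.
rewrite lhsE; apply: le_trans (l1_powR_le rho1 (fun=> w00) (fun j v => sqr_ge0 _)) _.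
pose Q (w : W) := rad (fun j => F j w) ^+ 2.
have step (w : W) : (\sum_j (`|F j w| ^+ 2) `^ rho) `^ rho^-1 <= C ^+ 2 * Q w.
  have -> : \sum_j (`|F j w| ^+ 2) `^ rho = \sum_j `|F j w| `^ r.
    apply: eq_bigr => j _; rewrite -powR_mulrn// -powRrM /rho mulrC divfK//.
  have -> : rho^-1 = r^-1 * 2 by rewrite /rho invf_div mulrC.
  rewrite powRrM powR_mulrn ?powR_ge0// /Q -exprMn.
  by rewrite ler_pXn2r ?nnegrE ?powR_ge0 ?hC// mulr_ge0// rad_ge0.
have EQ : \sum_(w : W) w0 * Q w = bnorm c tau y (fun=> 1) ^+ 2.
  rewrite /bnorm sqr_sqrtr; last first.
    by rewrite mulr_ge0// sumr_ge0// => k _; exact: sqr_ge0.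
  rewrite -mulr_sumr /w0 -mulrA; congr (_ * _).
  rewrite -(pair_bigA _ (fun k e => Q (k, e)))/= mulr_sumr; apply: eq_bigr => k _.
  rewrite rad_sqr; congr (_ * _).
  under eq_bigr do rewrite /Q rad_sqr.
  rewrite -mulr_sumr exchange_big /=.
  (* Each index has just one colour, so a sign attached to the colour is absorbed by the sign of the
     index, and averaging over both is averaging over the latter. *)
  have inner (d : {ffun 'I_M -> bool}) :
      \sum_(e : {ffun L -> bool}) `|\sum_j (-1) ^+ d j *: F j (k, e)| ^+ 2 =
      \sum_(e : {ffun L -> bool}) `|\sum_l (-1) ^+ e l *: (1 *: y k l)| ^+ 2.
    rewrite -[RHS](sum_flip (fun l => d (chi (tau k l)))).
    apply: eq_bigr => e _; congr (`|_| ^+ 2); rewrite /F /=.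
    under eq_bigr do rewrite scaler_sumr.
    rewrite exchange_big; apply: eq_bigr => l _ /=.
    rewrite (bigD1 (chi (tau k l)))//= [X in _ + X]big1 ?addr0.
      by rewrite /ind inE eqxx !scalerA ffunE signr_addb !mulr1.
    move=> j jc; rewrite /ind inE eq_sym (negbTE jc).
    by rewrite scale0r !scaler0.
  under eq_bigr do rewrite inner.
  rewrite sumr_const card_ffun card_bool card_ord -[X in _ * X]mulr_natl natrX mulKf//.
have -> : (C * bnorm c tau y (fun=> 1)) `^ r =
    (\sum_(w : W) w0 * (C ^+ 2 * Q w)) `^ rho.
  under eq_bigr do rewrite mulrCA.
  rewrite -mulr_sumr EQ -exprMn -powR_mulrn ?mulr_ge0 ?sqrtr_ge0//.
  by rewrite -powRrM; congr (_ `^ _); rewrite /rho mulrC divfK.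
apply: ge0_ler_powR; rewrite ?nnegrE; first lra.
- by apply: sumr_ge0 => w _; apply: mulr_ge0; [exact: w00 | exact: powR_ge0].
- apply: sumr_ge0 => w _; apply: mulr_ge0; first exact: w00.
  by apply: mulr_ge0; exact: sqr_ge0.
- by apply: ler_sum => w _; rewrite ler_wpM2l.
Qed.

End rad.

(** * Carleson families of dyadic intervals *)

(** Conditioning on [f]: as [H] is constant on fibres, [w] may be replaced by its average over each
    fibre, which need be controlled only where [H] does not vanish. *)
Lemma sum_cond_le (R : realType) (K : finType) (Q : eqType) (f : K -> Q)
    (H w : K -> R) (c : R) :
  (forall k, 0 <= H k) -> (forall k k', f k = f k' -> H k = H k') ->
  (forall k0, H k0 != 0 -> \sum_(k | f k == f k0) w k <=
                           c * \sum_(k | f k == f k0) 1) ->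
  \sum_k H k * w k <= c * \sum_k H k.
Proof.
move=> H0 Hf hw.
pose N k0 : R := \sum_(k | f k == f k0) 1.
have N0 k0 : 0 < N k0.
  by rewrite /N (bigD1 k0)//= ltr_wpDr// sumr_ge0.
have Nf k k' : f k = f k' -> N k = N k' by move=> e; rewrite /N e.
have -> : \sum_k H k * w k =
    \sum_k0 H k0 / N k0 * \sum_(k | f k == f k0) w k.
  under [RHS]eq_bigr do rewrite mulr_sumr.
  rewrite (exchange_big_dep xpredT)//=; apply: eq_bigr => k _.
  transitivity (\sum_(k0 | f k0 == f k) H k / N k * w k).
    by rewrite -mulr_suml -(mulr1 (H k / N k)) -mulr_sumr -/(N k) divfK ?gt_eqF.
  by apply: eq_big => [k0|k0 /eqP e]; [rewrite eq_sym | rewrite (Hf _ _ e) (Nf _ _ e)].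
rewrite mulr_sumr; apply: ler_sum => k0 _.
have [->|h] := eqVneq (H k0) 0; first by rewrite !(mul0r,mulr0).
rewrite -mulrA [leRHS]mulrC ler_wpM2l//.
by rewrite mulrC ler_pdivrMr// hw.
Qed.

(** [e] marks the levels of a branch at which its interval is a top; this counts the marks from
    level [l] down to [n]. *)
Definition mult (e : nat -> bool) (n l : nat) : nat :=
  (\sum_(l <= i < n.+1) e i)%N.

Lemma mult_ltn (e : nat -> bool) (n l : nat) :
  (l <= n)%N -> mult e n l = (e l + mult e n l.+1)%N.
Proof. by move=> ln; rewrite /mult big_ltn. Qed.

Lemma mult_geq (e : nat -> bool) (n l : nat) : (n < l)%N -> mult e n l = 0%N.
Proof. by move=> nl; rewrite /mult big_geq. Qed.

Lemma down_ind (n : nat) (P : nat -> Prop) :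
  (forall l, (n < l)%N -> P l) -> (forall l, (l <= n)%N -> P l.+1 -> P l) ->
  forall l, P l.
Proof.
move=> h0 h1 l.
have [d dE] : exists d, (n.+1 - l)%N = d by exists (n.+1 - l)%N.
elim: d l dE => [|d IH] l dE; first by apply: h0; lia.
by apply: h1; [lia | apply: IH; lia].
Qed.

Lemma mult_triangular (e : nat -> bool) (n l : nat) :
  (mult e n l * (mult e n l).+1 = 2 * \sum_(l <= i < n.+1) e i * mult e n i)%N.
Proof.
elim/(down_ind (n := n)): l => l ln; first by rewrite mult_geq// big_geq.
move=> IH; rewrite [in RHS]big_ltn// mulnDr -IH mult_ltn//.
by case: (e l); rewrite ?mul0n ?add0n ?muln0//; lia.
Qed.

(** Cauchy-Schwarz with weights m (m + 1). Along the marked levels m takes each value from 1 to M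
    once, so the sum of 1 / (m (m + 1)) telescopes to M / (M + 1). Keeping this exact ratio makes
    the induction close. *)
Lemma chain_sqr (R : realType) (e : nat -> bool) (g : nat -> R) (n l : nat) :
  (forall i, 0 <= g i) ->
  (mult e n l).+1%:R * (\sum_(l <= i < n.+1) (e i)%:R * g i) ^+ 2 <=
  (mult e n l)%:R *
    \sum_(l <= i < n.+1) (e i)%:R * (mult e n i * (mult e n i).+1)%:R * g i ^+ 2.
Proof.
move=> g0; elim/(down_ind (n := n)): l => l ln.
  by rewrite !big_geq// expr0n /= mulr0 mulr0.
move=> IH; rewrite ![\sum_(l <= i < n.+1) _]big_ltn//= mult_ltn//.
case: (e l); last by rewrite !mul0r !add0r add0n.
move: IH; rewrite add1n !mul1r.
set S := \sum_(_ <= _ < _) _; set Q := \sum_(_ <= _ < _) _.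
set M := mult e n l.+1; rewrite natrM -!natr1 => IH.
have S0 : 0 <= S by apply: sumr_ge0 => i _; rewrite mulr_ge0// ler0n.
have Q0 : 0 <= Q.
  by apply: sumr_ge0 => i _; rewrite !mulr_ge0 ?ler0n// sqr_ge0.
have [M0|M0] := posnP M.
  have : S = 0.
    move: IH; rewrite M0 mul0r add0r mul1r => h.
    by apply/eqP; rewrite -sqrf_eq0 eq_le h sqr_ge0.
  by move=> ->; rewrite M0 addr0; nra.
set x : R := M%:R in IH *; have x1 : 1 <= x by rewrite /x ler1n.
have g0' := g0 l; set y := g l in g0' *.
(* 2 y S <= x (x + 2) y^2 + S^2 / (x (x + 2)) *)
have key : 0 <= (x * (x + 1 + 1) * y - S) ^+ 2 by exact: sqr_ge0.
rewrite -(ler_pM2l (lt_le_trans ltr01 x1)).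
have h1 : x * ((x + 1 + 1) * (y + S) ^+ 2) =
  x * (x + 1 + 1) * (y ^+ 2 + S ^+ 2) + 2 * y * S * (x * (x + 1 + 1)) by ring.
nra.
Qed.

Lemma chain_powR (R : realType) (e : nat -> bool) (g : nat -> R) (n : nat) (p : R) :
  (forall i, 0 <= g i) -> 0 < p <= 2 ->
  (\sum_(0 <= i < n.+1) (e i)%:R * g i) `^ p <=
  \sum_(0 <= i < n.+1) (e i)%:R * (mult e n i * (mult e n i).+1)%:R * g i `^ p.
Proof.
move=> g0 /andP[p0 p2]; have := chain_sqr e n 0 g0.
set S := \sum_(_ <= _ < _) _; set Q := \sum_(_ <= _ < _) _ => h.
have S0 : 0 <= S by apply: sumr_ge0 => i _; rewrite mulr_ge0// ler0n.
have Q0 : 0 <= Q.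
  by apply: sumr_ge0 => i _; rewrite !mulr_ge0 ?ler0n// sqr_ge0.
have SQ : S ^+ 2 <= Q.
  have m0 : 0 < (mult e n 0).+1%:R :> R by rewrite ltr0n.
  rewrite -(ler_pM2l m0) (le_trans h)// ler_wpM2r// ler_nat//.
have -> : S `^ p = (S ^+ 2) `^ (p / 2).
  by rewrite -powR_mulrn// -powRrM; congr (_ `^ _); rewrite mulrC divfK.
apply: le_trans (_ : Q `^ (p / 2) <= _).
  by rewrite ge0_ler_powR ?nnegrE ?sqr_ge0//; lra.
apply: le_trans (powR_sum_subadd _ _ _ _) _; first by lra.
  by move=> i; rewrite !mulr_ge0 ?ler0n// sqr_ge0.
rewrite !big_mkord; apply: ler_sum => -[i /= iln] _.
case ei : (e i); last by rewrite !mul0r powR0// gt_eqF//; lra.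
rewrite !mul1r powRM ?ler0n ?sqr_ge0//.
rewrite -[in (g i ^+ 2)]powR_mulrn// -powRrM.
have -> : 2 * (p / 2) = p by rewrite mulrC divfK.
rewrite ler_wpM2r ?powR_ge0// ler1_powR ?ler1n//; last by lra.
by rewrite mult_ltn -1?ltnS// ei.
Qed.

(** Meaningful for l < l' only, a range which the sums starting at [l.+1] impose. *)
Definition nextb (e : nat -> bool) (l l' : nat) : bool :=
  e l' && [forall i : 'I_l', (l < i)%N ==> ~~ e i].

(** With m marks strictly below [l], the left side is (m + 1) (m + 2): it equals 2 when m = 0 and is
    at most 3 m (m + 1) otherwise. The weight thus moves from a mark to the next one. *)
Lemma nextb_mult (e : nat -> bool) (n l : nat) :
  (l <= n)%N -> e l ->
  (mult e n l * (mult e n l).+1 <=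
   2 + 3 * \sum_(l.+1 <= i < n.+1) nextb e l i * (mult e n i * (mult e n i).+1))%N.
Proof.
move=> ln el; rewrite mult_ltn// el add1n.
have [M0|M0] := posnP (mult e n l.+1); first by rewrite M0; lia.
have ex : exists i, (l < i <= n)%N && e i.
  apply: contrapT => nex; move: M0; rewrite /mult big_nat_cond big1// => i.
  rewrite andbT ltnS => li; case ei : (e i) => //.
  by exfalso; apply: nex; exists i; rewrite li ei.
have [i /andP[/andP[li iln] ei] imin] := ex_minnP ex.
have mE : mult e n l.+1 = mult e n i.
  rewrite /mult (big_cat_nat (n := i))//=; last by lia.
  rewrite big_nat_cond big1 ?add0n// => j; rewrite andbT => /andP[lj ji].
  case ej : (e j) => //; have := imin j; rewrite ej andbT => h.
  have : (i <= j)%N by apply: h; lia.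
  by rewrite leqNgt ji.
have nxt : nextb e l i.
  rewrite /nextb ei/=; apply/forallP => j; apply/implyP => lj; apply/negP => ej.
  have := imin j; rewrite ej andbT => h.
  have : (i <= j)%N by apply: h; have := ltn_ord j; lia.
  by rewrite leqNgt ltn_ord.
rewrite mE in M0 *.
have : (mult e n i * (mult e n i).+1 <=
    \sum_(l.+1 <= j < n.+1) nextb e l j * (mult e n j * (mult e n j).+1))%N.
  rewrite (big_cat_nat (n := i))//=; last by lia.
  by rewrite [X in (_ <= _ + X)%N]big_ltn ?ltnS// nxt mul1n; lia.
nia.
Qed.

Lemma nextb_le1 (e : nat -> bool) (n l : nat) :
  (\sum_(l.+1 <= i < n.+1) nextb e l i <= 1)%N.
Proof.
case: (pselect (exists i, (l < i <= n)%N && nextb e l i)) => [ex|nex]; last first.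
  rewrite big_nat_cond big1// => i; rewrite andbT ltnS => li.
  by case ei : (nextb e l i) => //; exfalso; apply: nex; exists i; rewrite li.
case: ex => i /andP[/andP[li iln] ni].
have uni j : (l < j <= n)%N -> nextb e l j -> j = i.
  move=> /andP[lj jn] /andP[ej /forallP hj]; case/andP: ni => ei /forallP hi.
  case: (ltngtP i j) => // ij.
    by have := hj (Ordinal ij); rewrite /= li ei.
  by have := hi (Ordinal ij); rewrite /= lj ej.
rewrite (bigD1_seq i) ?iota_uniq ?mem_index_iota ?ltnS ?li//=.
rewrite big_nat_cond big1 ?addn0 ?leq_b1// => j.
rewrite ltnS => /andP[lj] ji; case nj : (nextb e l j) => //.
by rewrite (uni j lj nj) eqxx in ji.
Qed.

Lemma big_mulb (R : realType) (b : bool) (x : R) : b%:R * x = if b then x else 0.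
Proof. by case: b; rewrite ?mul1r ?mul0r. Qed.

(** Deleting the last [n - l] binary digits of a cell of level [n] gives the position of its
    ancestor of level [l]. *)
Definition anc (n k l : nat) : nat := k %/ 2 ^ (n - l).

Lemma anc_anc (n k l l' : nat) : (l <= l')%N -> (l' <= n)%N ->
  anc n k l = (anc n k l' %/ 2 ^ (l' - l))%N.
Proof.
by move=> ll' l'n; rewrite /anc -divnMA -expnD; congr (_ %/ 2 ^ _)%N; lia.
Qed.

Lemma anc_eq_le (n k k' l l' : nat) : (l <= l')%N -> (l' <= n)%N ->
  anc n k l' = anc n k' l' -> anc n k l = anc n k' l.
Proof. by move=> ll' l'n e; rewrite !(anc_anc _ ll' l'n) e. Qed.

Section tree.
Variables (R : realType) (n : nat) (E : nat -> nat -> bool).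

Let K := 'I_(2 ^ n).
Let e (k : K) (l : nat) := E l (anc n k l).
Let m (k : K) (l : nat) := mult (e k) n l.

Hypothesis carl : forall (l : nat) (k0 : K), (l <= n)%N -> e k0 l ->
  \sum_(k : K | anc n k l == anc n k0 l) (m k l)%:R <=
  4 * \sum_(k : K | anc n k l == anc n k0 l) 1 :> R.

(** A second moment from a first moment: m (m + 1) is twice the sum of the counts at the marks of
    the chain. The Carleson bound is used once below each mark and once more at [l], giving 2 * 4 *
    4. *)
Lemma carleson_sqr (l : nat) (k0 : K) : (l <= n)%N -> e k0 l ->
  \sum_(k : K | anc n k l == anc n k0 l) (m k l * (m k l).+1)%:R <=
  32 * \sum_(k : K | anc n k l == anc n k0 l) 1 :> R.
Proof.
move=> ln ek0.
have step l' : (l <= l')%N -> (l' <= n)%N ->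
    \sum_(k : K | anc n k l == anc n k0 l) (e k l')%:R * (m k l')%:R <=
    4 * \sum_(k : K | anc n k l == anc n k0 l) (e k l')%:R :> R.
  move=> ll' l'n.
  have := @sum_cond_le R K nat (fun k => anc n k l')
    (fun k => (anc n k l == anc n k0 l)%:R * (e k l')%:R) (fun k => (m k l')%:R) 4.
  under eq_bigr do rewrite -mulrA big_mulb.
  under [X in _ <= _ * X]eq_bigr do rewrite big_mulb.
  rewrite -!big_mkcond; apply.
  - by move=> k; rewrite mulr_ge0 ?ler0n.
  - by move=> k k' kk'; rewrite (anc_eq_le ll' l'n kk') /e kk'.
  - move=> k1; rewrite mulf_eq0 negb_or => /andP[_]; rewrite pnatr_eq0 eqb0 negbK.
    by move=> ek1; exact: carl.
under eq_bigr do rewrite mult_triangular natrM natr_sum.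
rewrite -mulr_sumr exchange_big /=.
have -> : 32 = 2 * (4 * 4) :> R by lra.
rewrite -[leRHS]mulrA ler_wpM2l// -mulrA.
apply: le_trans (_ : \sum_(l <= l' < n.+1)
    4 * \sum_(k : K | anc n k l == anc n k0 l) (e k l')%:R <= _).
  rewrite [leLHS]big_nat_cond [leRHS]big_nat_cond.
  apply: ler_sum => l'; rewrite andbT ltnS => /andP[ll' l'n].
  by apply: le_trans (step l' ll' l'n); apply: ler_sum => k _; rewrite natrM.
rewrite -mulr_sumr ler_wpM2l// exchange_big /=.
apply: le_trans (carl ln ek0); apply: ler_sum => k _.
by rewrite /m /mult natr_sum.
Qed.

Variable g : nat -> K -> R.
Hypothesis g0 : forall l k, 0 <= g l k.
Hypothesis g_const : forall (l l' : nat) (k k' : K), (l < l')%N -> (l' <= n)%N ->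
  e k l -> e k l' -> anc n k l' = anc n k' l' -> g l k = g l k'.

(** At level [l] itself [g l] varies over the cells of a top and cannot be pulled out of an average.
    [nextb_mult] moves the weight to the next top, where [g l] is constant and [carleson_sqr]
    applies: 2 + 3 * 32 = 98. *)
Lemma level_sum (p : R) (l : nat) : (l <= n)%N ->
  \sum_k (e k l)%:R * (m k l * (m k l).+1)%:R * g l k `^ p <=
  98 * \sum_k (e k l)%:R * g l k `^ p.
Proof.
move=> ln.
pose H l' k : R := (e k l)%:R * (nextb (e k) l l')%:R * g l k `^ p.
have H0 l' k : 0 <= H l' k by rewrite !mulr_ge0 ?ler0n// powR_ge0.
have step l' : (l < l')%N -> (l' <= n)%N ->
    \sum_k H l' k * (m k l' * (m k l').+1)%:R <= 32 * \sum_k H l' k.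
  move=> ll' l'n; apply: (@sum_cond_le R K nat (fun k => anc n k l')) => //.
    move=> k k' kk'.
    have ee i : (i <= l')%N -> e k i = e k' i.
      by move=> il'; rewrite /e (anc_eq_le il' l'n kk').
    rewrite /H -(ee l (ltnW ll')).
    have -> : nextb (e k') l l' = nextb (e k) l l'.
      rewrite /nextb ee//; congr andb; apply: eq_forallb => i.
      by rewrite ee// ltnW.
    case ekl : (e k l); last by rewrite !mul0r.
    case nkl : (nextb _ _ _); last by rewrite mulr0 !mul0r.
    by rewrite (g_const ll' l'n ekl _ kk')//; case/andP: nkl.
  move=> k1; rewrite /H !mulf_eq0 !negb_or => /andP[/andP[_]].
  rewrite pnatr_eq0 eqb0 negbK => /andP[ek1 _] _.
  exact: carleson_sqr.
have pw k : (e k l)%:R * (m k l * (m k l).+1)%:R * g l k `^ p <=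
    2 * ((e k l)%:R * g l k `^ p) +
    3 * \sum_(l.+1 <= i < n.+1) H i k * (m k i * (m k i).+1)%:R.
  rewrite /H; case ekl : (e k l); last first.
    by rewrite !mul0r mulr0 add0r mulr_ge0// sumr_ge0// => i _; rewrite !mul0r.
  have := nextb_mult ln ekl; rewrite -(ler_nat R) natrD (natrM _ 3) natr_sum => h.
  rewrite !mul1r mulrC; apply: le_trans (ler_wpM2l (powR_ge0 _ _) h) _.
  rewrite mulrDr [X in X + _]mulrC lerD2l mulrCA ler_wpM2l// mulr_sumr.
  by apply: ler_sum => i _; rewrite mul1r natrM mulrA [X in X * _]mulrC.
apply: le_trans (ler_sum _ (fun k _ => pw k)) _.
rewrite big_split /= -!mulr_sumr.
set A := \sum_k (e k l)%:R * _.
apply: le_trans (_ : 2 * A + 3 * (32 * A) <= _); last by lra.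
rewrite lerD2l ler_wpM2l// exchange_big /=.
apply: le_trans (_ : \sum_(l.+1 <= l' < n.+1) 32 * \sum_k H l' k <= _).
  rewrite [leLHS]big_nat_cond [leRHS]big_nat_cond.
  by apply: ler_sum => l'; rewrite andbT ltnS => /andP[ll' l'n]; exact: step.
rewrite -mulr_sumr ler_wpM2l// exchange_big /=; apply: ler_sum => k _.
rewrite /H -mulr_suml -mulr_sumr ler_wpM2r ?powR_ge0// -[leRHS]mulr1 ler_wpM2l ?ler0n//.
by rewrite -natr_sum -[1]/(1%:R) ler_nat nextb_le1.
Qed.

Lemma carleson_sum (p : R) : 0 < p <= 2 ->
  \sum_k (\sum_(l < n.+1) (e k l)%:R * g l k) `^ p <=
  98 * \sum_k \sum_(l < n.+1) (e k l)%:R * g l k `^ p.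
Proof.
move=> p02.
apply: le_trans (_ : \sum_k \sum_(l < n.+1)
    (e k l)%:R * (m k l * (m k l).+1)%:R * g l k `^ p <= _).
  apply: ler_sum => k _; have := chain_powR (e k) n (g0^~ k) p02.
  by rewrite !big_mkord.
rewrite exchange_big [X in _ <= _ * X]exchange_big /= mulr_sumr.
by apply: ler_sum => l _; apply: level_sum; rewrite -ltnS.
Qed.

End tree.

(** * Step functions on dyadic intervals *)

Lemma dy_intervalE (R : realType) (m k : nat) (t : R) :
  dy_interval R m k t <-> k%:R <= 2 ^+ m * t < k.+1%:R.
Proof.
have p0 : 0 < 2 ^+ m :> R by rewrite exprn_gt0.
rewrite /dy_interval /= in_itv /= ler_pdivrMr// ltr_pdivlMr//.
by rewrite mulrC.
Qed.

Lemma dy_interval_truncn (R : realType) (m k : nat) (t : R) : 0 <= t ->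
  dy_interval R m k t <-> Num.truncn (2 ^+ m * t) = k.
Proof.
move=> t0; rewrite dy_intervalE; have h : 0 <= 2 ^+ m * t by rewrite mulr_ge0.
rewrite -truncn_eq//; split=> [/eqP//|/eqP//].
Qed.

Lemma dy_interval_ge0 (R : realType) (m k : nat) (t : R) :
  dy_interval R m k t -> 0 <= t.
Proof.
rewrite /dy_interval /= in_itv /= => /andP[h _]; apply: le_trans h.
by rewrite divr_ge0.
Qed.

Lemma truncn_anc (R : realType) (m i : nat) (t : R) : 0 <= t -> (i <= m)%N ->
  Num.truncn (2 ^+ i * t) = anc m (Num.truncn (2 ^+ m * t)) i.
Proof.
move=> t0 im; apply/eqP; rewrite truncn_eq ?mulr_ge0//.
have pi : 0 < 2 ^+ (m - i) :> R by rewrite exprn_gt0.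
have := truncn_itv (_ : 0 <= 2 ^+ m * t); rewrite mulr_ge0// => /(_ isT).
set k := Num.truncn _ => /andP[h1 h2].
have tE : 2 ^+ i * t = 2 ^+ m * t / 2 ^+ (m - i).
  have -> : 2 ^+ m = 2 ^+ (m - i) * 2 ^+ i :> R by rewrite -exprD subnK.
  by rewrite -[_ * _ * t]mulrA [RHS]mulrC mulKf// gt_eqF.
rewrite tE ler_pdivlMr// ltr_pdivrMr// -(natrX _ 2 (m - i)) -!natrM.
have p' : (0 < 2 ^ (m - i))%N by rewrite expn_gt0.
apply/andP; split.
  by apply: le_trans h1; rewrite ler_nat /anc leq_trunc_div.
by apply: lt_le_trans h2 _; rewrite ler_nat /anc ltn_ceil.
Qed.

Lemma truncn_lt_pow (R : realType) (m : nat) (t : R) : 0 <= t < 1 ->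
  (Num.truncn (2 ^+ m * t) < 2 ^ m)%N.
Proof.
move=> /andP[t0 t1]; rewrite truncn_lt_nat ?mulr_ge0// natrX.
by rewrite -[ltRHS]mulr1 ltr_pM2l// exprn_gt0.
Qed.

Lemma measurable_dy_interval (R : realType) (m k : nat) :
  measurable (dy_interval R m k).
Proof. exact: measurable_itv. Qed.

Lemma lebesgue_dy_interval (R : realType) (m k : nat) :
  lebesgue_measure (dy_interval R m k) = ((2 ^+ m)^-1)%:E.
Proof.
rewrite /dy_interval lebesgue_measure_itv /= lte_fin.
have p0 : 0 < (2 ^+ m)^-1 :> R by rewrite invr_gt0 exprn_gt0.
rewrite ltr_pM2r// ltr_nat ltnSn -EFinB; congr EFin.
by rewrite -mulrBl -natrB// subSnn mul1r.
Qed.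

Lemma dy_interval01 (R : realType) (m k : nat) (t : R) : (k < 2 ^ m)%N ->
  dy_interval R m k t -> 0 <= t < 1.
Proof.
move=> km kt; rewrite (dy_interval_ge0 kt)/=; move/dy_intervalE: kt => /andP[_ h].
have p0 : 0 < 2 ^+ m :> R by rewrite exprn_gt0.
rewrite -(ltr_pM2l p0) mulr1; apply: lt_le_trans h _.
by rewrite -natrX ler_nat.
Qed.

Section step.
Variables (R : realType) (m : nat) (f : R -> R) (G : nat -> R).
Hypothesis f0 : forall t, 0 <= f t.
Hypothesis fG : forall k t, (k < 2 ^ m)%N -> dy_interval R m k t -> f t = G k.

Let I1 : set R := `[1%R, 1%R]%classic.
(** The extra index carries the endpoint 1, a null set which lies in [0, 1] but in no half-open
    cell. *)
Let h (k : 'I_(2 ^ m).+1) (t : R) : \bar R :=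
  (if (k < 2 ^ m)%N then (G k)%:E * (\1_(dy_interval R m k) t)%:E
  else (f 1%R)%:E * (\1_I1 t)%:E)%E.

Let fE : (EFin \o f) \_ `[0, 1]%classic = fun t => (\sum_k h k t)%E.
Proof.
apply/funext => t; rewrite patchE big_ord_recr /= {2}/h ltnn.
under eq_bigr => k _ do rewrite /h /= ltn_ord.
have [t01|t01] := boolP ((0 <= t) && (t < 1)).
  have [t0 t1] := andP t01.
  have -> : t \in `[0, 1]%classic by rewrite inE /= in_itv /= t0 ltW.
  have -> : \1_I1 t = 0 :> R.
    by rewrite indicE memNset//= /I1/= in_itv /= => /andP[/le_lt_trans/(_ t1)]; rewrite ltxx.
  rewrite mule0 adde0 (bigD1 (Ordinal (truncn_lt_pow m t01)))//= big1 => [|k kt].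
    have ht : dy_interval R m (Num.truncn (2 ^+ m * t)) t by apply/dy_interval_truncn.
    by rewrite indicE mem_set// mule1 adde0 (fG (truncn_lt_pow m t01) ht).
  rewrite indicE memNset ?mule0// => /(dy_interval_truncn _ _ t0) kE.
  by move/eqP: kt; apply; apply: val_inj.
rewrite big1 => [|k _]; last first.
  rewrite indicE memNset ?mule0// => kt.
  by move/negP: t01; apply; exact: dy_interval01 kt.
rewrite add0e.
have [->|/eqP t1] := eqVneq t 1.
  by rewrite indicE !mem_set/= ?mule1// /I1 /= in_itv /= ?ler01 lexx.
have n1 : ~ I1 t.
  by rewrite /I1 /= in_itv /= => /andP[ta tb]; apply: t1; apply: le_anti; rewrite ta tb.
have n2 : ~ `[0, 1]%classic t.
  rewrite /= in_itv /= => /andP[ta tb]; move/negP: t01; apply.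
  by rewrite ta/= lt_neqAle tb andbT; apply/eqP.
by rewrite indicE !memNset// mule0.
Qed.

Let mh k : measurable_fun [set: R] (h k).
Proof.
by rewrite /h; case: (k < 2 ^ m)%N; apply: measurable_funeM; apply/measurable_EFinP;
  apply: measurable_indic; exact: measurable_itv.
Qed.

Let h0 k t : (0 <= h k t)%E.
Proof.
rewrite /h; case: ifP => [km|_]; rewrite mule_ge0 ?lee_fin//.
have p0 : 0 < 2 ^+ m :> R by rewrite exprn_gt0.
rewrite -(@fG k (k%:R / 2 ^+ m))//; apply/dy_intervalE.
by rewrite mulrC divfK ?gt_eqF// lexx ltr_nat ltnSn.
Qed.

Lemma measurable_step :
  measurable_fun [set: R] ((EFin \o f) \_ `[0, 1]%classic).
Proof. by rewrite fE; apply: emeasurable_sum. Qed.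

Lemma integral_step :
  (\int[@lebesgue_measure R]_t ((EFin \o f) \_ `[0%R, 1%R]%classic) t =
   ((2 ^+ m)^-1 * \sum_(k < 2 ^ m) G k)%R%:E)%E.
Proof.
rewrite fE ge0_integral_sum//.
have hE k : (\int[@lebesgue_measure R]_t h k t =
    if (k < 2 ^ m)%N then (G k * (2 ^+ m)^-1)%R%:E else 0)%E.
  rewrite /h; case km : (k < 2 ^ m)%N.
    rewrite ge0_integralZl_EFin//.
    - rewrite integral_indic//; last exact: measurable_dy_interval.
      by rewrite setIT EFinM; congr (_ * _)%E; exact: lebesgue_dy_interval.
    - by apply/measurable_EFinP; apply: measurable_indic; exact: measurable_dy_interval.
    - have := h0 k (k%:R / 2 ^+ m); rewrite /h km indicE mem_set ?mule1 ?lee_fin//.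
      apply/dy_intervalE; have p0 : 0 < 2 ^+ m :> R by rewrite exprn_gt0.
      by rewrite mulrC divfK ?gt_eqF// lexx ltr_nat ltnSn.
  rewrite ge0_integralZl_EFin//.
  - rewrite integral_indic//; last exact: measurable_itv.
    have I10 : lebesgue_measure I1 = 0%E by rewrite /I1 lebesgue_measure_itv /= ltxx.
    by rewrite setIT -(mule0 (f 1)%:E); congr (_ * _)%E; exact: I10.
  - by apply/measurable_EFinP; apply: measurable_indic; rewrite /I1; exact: measurable_itv.
under eq_bigr do rewrite hE.
rewrite big_ord_recr /= ltnn adde0.
under eq_bigr do rewrite ltn_ord.
by rewrite sumEFin -mulr_suml mulrC.
Qed.

End step.

Lemma Lp01_step (R : realType) (m : nat) (p : R) (f : R -> R) (G : nat -> R) :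
  p != 0 -> (forall t, 0 <= f t) ->
  (forall k t, (k < 2 ^ m)%N -> dy_interval R m k t -> f t = G k) ->
  (Lp01 p%:E (fun t => (f t)%:E) =
   (((2 ^+ m)^-1 * \sum_(k < 2 ^ m) G k `^ p) `^ p^-1)%R%:E)%E.
Proof.
move=> p0 f0 fG; rewrite /Lp01 unlock.
rewrite -poweR_EFin -(@integral_step R m (fun t => f t `^ p) (fun k => G k `^ p)).
- congr (_ `^ _)%E; apply: eq_integral => t _; rewrite !patchE; case: ifP => _.
    by rewrite /= ger0_norm.
  by rewrite abse0 poweR0r.
- by move=> t; exact: powR_ge0.
- by move=> k t km kt; rewrite (fG k t).
Qed.

(** * Rademacher functions *)

Lemma rademacher_interval (R : realType) (m j k : nat) (s : R) :
  (j < m)%N -> dy_interval R m k s ->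
  rademacher j s = (-1) ^+ odd (anc m k j.+1).
Proof.
move=> jm ks; have s0 := dy_interval_ge0 ks.
rewrite /rademacher (truncn_anc s0 jm); move/(dy_interval_truncn _ _ s0): ks => ->.
by rewrite signr_odd.
Qed.

(** The signs of the first [m] Rademacher functions on cell [k]. Every pattern occurs on exactly one
    cell, which turns integrals into averages over patterns. *)
Definition bits (m : nat) (k : 'I_(2 ^ m)) : {ffun 'I_m -> bool} :=
  [ffun j : 'I_m => odd (anc m k j.+1)].

Lemma bits_inj (m : nat) : injective (@bits m).
Proof.
move=> k k' /ffunP bkk.
have h i : (i <= m)%N -> anc m k i = anc m k' i.
  elim: i => [_|i IH im].
    by rewrite /anc subn0 !divn_small.
  have hd q : anc m q i = (anc m q i.+1)./2.
    by rewrite (@anc_anc m q i i.+1)// ?leqnSn// subSnn expn1 divn2.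
  have := bkk (Ordinal im); rewrite !ffunE /= => bk.
  by rewrite -(odd_double_half (anc m k i.+1)) -(odd_double_half (anc m k' i.+1)) -!hd bk IH// ltnW.
by apply: val_inj; have := h m (leqnn m); rewrite /anc subnn expn0 !divn1.
Qed.

Lemma sum_bits (R : realType) (m : nat) (F : {ffun 'I_m -> bool} -> R) :
  \sum_(k < 2 ^ m) F (bits k) = \sum_e F e.
Proof.
rewrite [RHS](reindex (@bits m))//.
apply: onW_bij; apply: inj_card_bij; first exact: bits_inj.
by rewrite card_ffun card_bool !card_ord.
Qed.

Lemma Lp01_rademacher (R : realType) (X : normedModType R) (m : nat)
    (y : 'I_m -> X) :
  (Lp01 2%:E (fun s => `|\sum_(j < m) rademacher j s *: y j|%R%:E) =
   (rad y)%:E)%E.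
Proof.
pose G (k : nat) := `|\sum_(j < m) (-1) ^+ odd (anc m k j.+1) *: y j|.
rewrite (@Lp01_step R m _ _ G)//; last first.
  move=> k s km ks; rewrite /G; congr `|_|; apply: eq_bigr => j _.
  by rewrite (rademacher_interval (ltn_ord j) ks).
congr EFin; rewrite powR12_sqrt; last first.
  by rewrite mulr_ge0// ?invr_ge0// ?exprn_ge0// sumr_ge0// => k _; exact: powR_ge0.
rewrite /rad card_ord; congr (Num.sqrt (_ * _)).
rewrite -sum_bits; apply: eq_bigr => k _; rewrite powR_mulrn ?normr_ge0//.
by congr (`|_| ^+ 2); apply: eq_bigr => j _; rewrite ffunE.
Qed.

Lemma cotype_disc (R : realType) (X : normedModType R) (r C : R) :
  cotype_bound X r C -> disc_cotype X r C.
Proof.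
move=> [C0 h]; split => // n y; have := h n y.
by rewrite Lp01_rademacher -EFinM lee_fin.
Qed.

Lemma cotype_const_disc (R : realType) (X : normedModType R) (r : R) :
  has_cotype X r -> disc_cotype X r (cotype_const X r).
Proof.
move=> [C hC].
have ne : [set C | cotype_bound X r C] !=set0 by exists C.
split; first by apply: lb_le_inf => // D [].
move=> n y.
(* The infimum of the admissible constants is itself admissible: divide by [rad y]. If [rad y]
   vanishes, any admissible constant makes the left side zero. *)
have [r0|r0] := eqVneq (rad y) 0.
  by have [_ /(_ n y)] := cotype_disc hC; rewrite r0 !mulr0.
have rp : 0 < rad y by rewrite lt_neqAle eq_sym r0 rad_ge0.
rewrite -ler_pdivrMr//; apply: lb_le_inf => // D /cotype_disc[_ /(_ n y)].
by rewrite ler_pdivrMr.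
Qed.

(** * Discretization of the square function *)

(** Reduction modulo [2 ^ l] makes the function total in [q]; it changes nothing for genuine
    positions. *)
Definition mkdy (l q : nat) : dyadic :=
  existT _ l (Ordinal (ltn_pmod q (expn_gt0 2 l : (0 < 2 ^ l)%N))).

Lemma mkdyE (I : dyadic) : mkdy (dy_level I) (dy_pos I) = I.
Proof.
case: I => l q; rewrite /mkdy /dy_level /dy_pos /=; congr existT.
by apply: val_inj => /=; rewrite modn_small.
Qed.

Lemma mkdy_pos (l q : nat) : (q < 2 ^ l)%N -> dy_pos (mkdy l q) = q.
Proof. by move=> h; rewrite /dy_pos /= modn_small. Qed.

Lemma dy_pos_lt (I : dyadic) : (dy_pos I < 2 ^ dy_level I)%N.
Proof. exact: ltn_ord. Qed.

Lemma dy_ext (I J : dyadic) : dy_level I = dy_level J -> dy_pos I = dy_pos J -> I = J.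
Proof. by move=> h1 h2; rewrite -(mkdyE I) -(mkdyE J) h1 h2. Qed.

Definition dyT (n : nat) : finType := {l : 'I_n.+1 & 'I_(2 ^ l)}.

Definition dyT_val (n : nat) (t : dyT n) : dyadic :=
  existT (fun l => 'I_(2 ^ l)) (nat_of_ord (tag t)) (tagged t).

Lemma dyT_val_inj (n : nat) : injective (@dyT_val n).
Proof.
move=> [l q] [l' q'] e.
have el : l = l' by apply: val_inj; exact: (congr1 dy_level e).
case: _ / el q' e => q' e; congr existT.
by apply: val_inj; exact: (congr1 dy_pos e).
Qed.

Lemma dy_uptoE (R : realType) (n : nat) (I : dyadic) :
  dy_upto R n I <-> (dy_level I <= n)%N.
Proof.
rewrite /dy_upto /= /dy_len lef_pV2 ?posrE ?exprn_gt0//.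
by rewrite ler_eXn2l// ltr1n.
Qed.

Lemma fsum_dy_upto (R : realType) (V : nmodType) (n : nat) (F : dyadic -> V) :
  \sum_(I \in dy_upto R n) F I = \sum_(t : dyT n) F (dyT_val t).
Proof.
rewrite (fsbigE (map (@dyT_val n) (enum (dyT n)))).
- rewrite big_map big_enum_cond /=; apply: eq_bigl => t.
  by rewrite mem_set//; apply/dy_uptoE; rewrite -ltnS ltn_ord.
- by rewrite map_inj_uniq ?enum_uniq//; exact: dyT_val_inj.
- by move=> I /= /mapP[t _ ->]; apply/dy_uptoE; rewrite -ltnS ltn_ord.
- move=> I /dy_uptoE In /negP; case; apply/mapP.
  exists (existT _ (Ordinal (In : (dy_level I < n.+1)%N)) (tagged I)).
    by rewrite mem_enum.
  by case: I In.
Qed.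

(** The parity of the position one level further down tells the left half from the right one. *)
Lemma haarE (R : realType) (I : dyadic) (t : R) : 0 <= t ->
  haar I t = (Num.truncn (2 ^+ dy_level I * t) == dy_pos I)%:R *
             (-1) ^+ odd (Num.truncn (2 ^+ (dy_level I).+1 * t)).
Proof.
move=> t0; rewrite (truncn_anc t0 (leqnSn (dy_level I))).
set j := Num.truncn _; rewrite /anc subSnn expn1 divn2 /haar.
have E q : \1_(dy_interval R (dy_level I).+1 q) t = (j == q)%:R.
  rewrite indicE; congr (_%:R); congr nat_of_bool.
  by apply/idP/eqP; rewrite inE => /dy_interval_truncn; apply.
rewrite !E -{1 2}(odd_double_half j); move: (j./2) (odd j) (dy_pos I) => a b q.
have [->|aq] := eqVneq a q.
  by case: b; rewrite ?add0n ?add1n ?eqxx ?eqn_leq ?ltnn ?leqnSn ?mul1r /= ?sub0r ?subr0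
    ?andbF ?ltnn ?andbT; rewrite ?expr1 ?expr0 ?subr0 ?sub0r.
rewrite mul0r; move: aq; rewrite -(inj_eq double_inj) => aq.
case: b; rewrite ?add0n ?add1n ?eqSS (negbTE aq).
  case: eqP => [h|]; last by rewrite subr0.
  by have := congr1 odd h; rewrite /= !odd_double.
case: eqP => [h|]; last by rewrite subr0.
by have := congr1 odd h; rewrite /= !odd_double.
Qed.

(** Exactly one interval of each level contains [t], so the double sum over levels and positions
    collapses to the levels. *)
Lemma haar_sum (R : realType) (X : normedModType R) (n : nat) (c : dyadic -> R)
    (x : dyadic -> X) (t : R) : 0 <= t < 1 ->
  \sum_(I \in dy_upto R n) (c I * haar I t) *: x I =
  \sum_(l < n.+1) (c (mkdy l (Num.truncn (2 ^+ l * t))) *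
     (-1) ^+ odd (Num.truncn (2 ^+ l.+1 * t))) *: x (mkdy l (Num.truncn (2 ^+ l * t))).
Proof.
move=> t01; have [t0 t1] := andP t01; rewrite fsum_dy_upto.
rewrite -(@sig_big_dep _ _ _ _ (fun l : 'I_n.+1 => 'I_(2 ^ l)) (fun=> true) (fun _ _ => true)
  (fun (l : 'I_n.+1) (q : 'I_(2 ^ l)) =>
  (c (existT _ (l : nat) q) * haar (existT _ (l : nat) q : dyadic) t) *:
    x (existT _ (l : nat) q)))/=.
apply: eq_bigr => l _.
have tl := truncn_lt_pow l t01.
have E : existT (fun l : nat => 'I_(2 ^ l)) (l : nat) (Ordinal tl) =
    mkdy l (Num.truncn (2 ^+ l * t)).
  by apply: dy_ext => //; rewrite mkdy_pos.
rewrite (bigD1 (Ordinal tl))//= [X in _ + X]big1 ?addr0.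
  by rewrite haarE//= /dy_pos/= eqxx mul1r E.
move=> q ql; rewrite haarE// /dy_pos /dy_level /=.
case: eqP => [h|]; last by rewrite mul0r mulr0 scale0r.
by case/eqP: ql; apply: val_inj.
Qed.

(** The value on cell [k] of the square function of the truncation to level [n]; the Haar signs are
    absent because [rad] ignores signs. *)
Definition srad (R : realType) (X : normedModType R) (n : nat) (x : dyadic -> X)
    (k : nat) : R :=
  rad (fun l : 'I_n.+1 => x (mkdy l (anc n k l))).

Lemma square_partial (R : realType) (X : normedModType R) (n : nat)
    (x : dyadic -> X) (t : R) : 0 <= t < 1 ->
  (Lp01 2%:E (fun s =>
    `|\sum_(I \in dy_upto R n) (rademacherD I s * haar I t) *: x I|%R%:E) =
  (srad n x (Num.truncn (2 ^+ n * t)))%:E)%E.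
Proof.
move=> t01; have [t0 t1] := andP t01.
pose q l := Num.truncn (2 ^+ l * t).
have ql l : (q l < 2 ^ l)%N by exact: truncn_lt_pow.
pose c (l : 'I_n.+1) := (2 ^ l + q l).-1.
have cm l : (c l < 2 ^ n.+1)%N.
  have := ql l; rewrite /c => h.
  have : (2 ^ l <= 2 ^ n)%N by rewrite leq_exp2l// -ltnS ltn_ord.
  by rewrite expnS; have := expn_gt0 2 n; lia.
pose c' l := Ordinal (cm l).
have c'_inj : injective c'.
  move=> l l' /(congr1 val); rewrite /= /c => h; apply: val_inj => /=.
  have key (a b : nat) : (a < b)%N -> ((2 ^ a + q a).-1 < (2 ^ b + q b).-1)%N.
    move=> ab; have : (2 ^ a.+1 <= 2 ^ b)%N by rewrite leq_exp2l.
    by rewrite expnS; have := ql a; have := expn_gt0 2 a; lia.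
  case: (ltngtP l l') => [ll|ll|//]; have := key _ _ ll; rewrite h ltnn => f.
    by exfalso; move: f.
  by exfalso; move: f.
pose sg (l : 'I_n.+1) := odd (Num.truncn (2 ^+ l.+1 * t)).
pose z (l : 'I_n.+1) := (-1) ^+ sg l *: x (mkdy l (q l)).
(* The coefficients active at [t] are spread over all Rademacher functions of index below
   [2 ^ n.+1], the remaining ones being zero; [rad_inj] discards these again. *)
pose y (j : 'I_(2 ^ n.+1)) := \sum_(l < n.+1 | c' l == j) z l.
transitivity (Lp01 2%:E (fun s : R => `|\sum_(j < 2 ^ n.+1) rademacher j s *: y j|%R%:E)).
  congr Lp01; apply/funext => s; rewrite haar_sum//; congr (`|_|%:E).
  under [RHS]eq_bigr do rewrite scaler_sumr.
  rewrite (exchange_big_dep xpredT)//=; apply: eq_bigr => l _.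
  rewrite (bigD1 (c' l))//= [X in _ + X]big1 ?addr0; last first.
    by move=> j /andP[/eqP <-]; rewrite eqxx.
  rewrite /z scalerA; congr ((_ * _) *: _).
  by rewrite /rademacherD (mkdy_pos (ql l)).
rewrite Lp01_rademacher; congr EFin.
rewrite (rad_inj c'_inj); last first.
  move=> j jc; rewrite /y big1// => l /eqP h.
  by move/negP: jc; case; rewrite -h codom_f.
have -> : y \o c' = z.
  apply/funext => l; rewrite /= /y (bigD1 l)//= big1 ?addr0// => l' /andP[/eqP/c'_inj->].
  by rewrite eqxx.
rewrite rad_sign /srad; congr rad; apply/funext => l.
by rewrite -truncn_anc// -ltnS ltn_ord.
Qed.

Lemma square_partial1 (R : realType) (X : normedModType R) (n : nat)
    (x : dyadic -> X) :
  (Lp01 2%:E (fun s =>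
    `|\sum_(I \in dy_upto R n) (rademacherD I s * haar I 1%R) *: x I|%R%:E) = 0)%E.
Proof.
rewrite (_ : (fun _ => _) = (fun s : R => (0%R)%:E)).
  by rewrite (@Lp01_step R 0 2 (fun=> 0) (fun=> 0))// big1 ?mulr0 ?powR0 ?invr_eq0// => k _; rewrite powR0.
apply/funext => s; rewrite fsbig1 ?normr0// => I _.
rewrite haarE// mulr1 -natrX natrK; case: eqP => [h|]; last first.
  by rewrite mul0r mulr0 scale0r.
by have := dy_pos_lt I; rewrite -h ltnn.
Qed.

(** * Truncated square functions and Hardy norms *)

Lemma rad_ord_mono (R : realType) (X : normedModType R) (n m : nat) (z : nat -> X) :
  (n <= m)%N -> rad (fun l : 'I_n => z l) <= rad (fun l : 'I_m => z l).
Proof.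
move=> nm.
have := sign_seminorm_le (f := fun l : 'I_m => (l < n)%N%:R) (g := fun=> 1)
  (rad_sign_seminorm (fun l : 'I_m => z l)).
rewrite (rad_inj (f := widen_ord nm)).
- move=> h; have -> : (fun l : 'I_n => z l) =
    (fun l : 'I_m => (l < n)%N%:R *: z l) \o widen_ord nm.
    by apply/funext => l /=; rewrite ltn_ord scale1r.
  apply: le_trans (h _) _.
    by move=> l; case: (l < n)%N; rewrite ?normr1 ?normr0.
  by under [X in rad X <= _]eq_fun do rewrite scale1r.
- by move=> l l' /(congr1 val) /= h; apply: val_inj.
- move=> l lc; case: ltnP => [ln|]; last by rewrite scale0r.
  by move/negP: lc; case; apply/codomP; exists (Ordinal ln); apply: val_inj.
Qed.

(** The value 0 is the correct one at [t = 1], where every Haar function vanishes. *)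
Definition spart (R : realType) (X : normedModType R) (n : nat) (x : dyadic -> X)
    (t : R) : R :=
  if 0 <= t < 1 then srad n x (Num.truncn (2 ^+ n * t)) else 0.

Lemma spart_ge0 (R : realType) (X : normedModType R) (n : nat) (x : dyadic -> X)
    (t : R) : 0 <= spart n x t.
Proof. by rewrite /spart; case: ifP => // _; exact: rad_ge0. Qed.

Lemma spart_mono (R : realType) (X : normedModType R) (n m : nat)
    (x : dyadic -> X) (t : R) : (n <= m)%N -> spart n x t <= spart m x t.
Proof.
move=> nm; rewrite /spart; case: ifP => // t01; have [t0 _] := andP t01.
have E i : srad i x (Num.truncn (2 ^+ i * t)) =
    rad (fun l : 'I_i.+1 => x (mkdy l (Num.truncn (2 ^+ l * t)))).
  congr rad; apply/funext => l; by rewrite -truncn_anc// -ltnS ltn_ord.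
rewrite !E; exact: (@rad_ord_mono R X n.+1 m.+1 (fun l => x (mkdy l (Num.truncn (2 ^+ l * t))))).
Qed.

Lemma spart_interval (R : realType) (X : normedModType R) (n : nat)
    (x : dyadic -> X) (k : nat) (t : R) : (k < 2 ^ n)%N ->
  dy_interval R n k t -> spart n x t = srad n x k.
Proof.
move=> kn kt; rewrite /spart (dy_interval01 kn kt).
by have /(dy_interval_truncn _ _ (dy_interval_ge0 kt)) -> := kt.
Qed.

Lemma square_funE (R : realType) (X : normedModType R) (x : dyadic -> X) (t : R) :
  0 <= t <= 1 ->
  square_fun x t = ereal_sup (range (fun n => (spart n x t)%:E)).
Proof.
move=> /andP[t0 t1]; rewrite /square_fun.
have -> : (fun n : nat => Lp01 2%:E (fun s =>
    `|\sum_(I \in dy_upto R n) (rademacherD I s * haar I t) *: x I|%:E)) =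
    (fun n => (spart n x t)%:E).
  apply/funext => n; rewrite /spart t0 /=.
  move: t1; rewrite le_eqVlt => /predU1P[->|t1]; first by rewrite ltxx square_partial1.
  by rewrite t1 square_partial// t0 t1.
apply: cvg_lim => //; apply: ereal_nondecreasing_cvgn => n m nm.
by rewrite lee_fin spart_mono.
Qed.

Definition savg (R : realType) (X : normedModType R) (p : R) (n : nat)
    (x : dyadic -> X) : R :=
  (2 ^+ n)^-1 * \sum_(k < 2 ^ n) srad n x k `^ p.

Lemma integral_spart (R : realType) (X : normedModType R) (p : R) (n : nat)
    (x : dyadic -> X) :
  (\int[@lebesgue_measure R]_t
     ((EFin \o (fun t => spart n x t `^ p)%R) \_ `[0%R, 1%R]%classic) t =
   (savg p n x)%:E)%E.
Proof.
apply: (@integral_step R n _ (fun k => srad n x k `^ p)) => [t|k t kn kt].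
  exact: powR_ge0.
by rewrite (spart_interval x kn kt).
Qed.

Lemma measurable_spart (R : realType) (X : normedModType R) (p : R) (n : nat)
    (x : dyadic -> X) :
  measurable_fun [set: R] ((EFin \o (fun t => spart n x t `^ p)) \_ `[0, 1]%classic).
Proof.
apply: (@measurable_step R n _ (fun k => srad n x k `^ p)) => k t kn kt.
by rewrite (spart_interval x kn kt).
Qed.

Lemma patch_spart_mono (R : realType) (X : normedModType R) (p : R) (n m : nat)
    (x : dyadic -> X) (t : R) : 0 < p -> (n <= m)%N ->
  ((((EFin \o (fun t => spart n x t `^ p)%R) \_ `[0%R, 1%R]%classic) t) <=
   (((EFin \o (fun t => spart m x t `^ p)%R) \_ `[0%R, 1%R]%classic) t))%E.
Proof.
move=> p0 nm; rewrite !patchE; case: ifP => // _.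
by rewrite /= lee_fin ge0_ler_powR ?nnegrE ?spart_ge0 ?(ltW p0) ?spart_mono.
Qed.

Lemma patch_spart_ge0 (R : realType) (X : normedModType R) (p : R) (n : nat)
    (x : dyadic -> X) (t : R) :
  (0 <= ((EFin \o (fun t => spart n x t `^ p)%R) \_ `[0%R, 1%R]%classic) t)%E.
Proof.
by rewrite patchE; case: ifP => // _; rewrite /= lee_fin powR_ge0.
Qed.

Lemma savg_ge0 (R : realType) (X : normedModType R) (p : R) (n : nat)
    (x : dyadic -> X) : 0 <= savg p n x.
Proof.
rewrite /savg mulr_ge0 ?invr_ge0 ?exprn_ge0// sumr_ge0// => k _; exact: powR_ge0.
Qed.

Lemma savg_mono (R : realType) (X : normedModType R) (p : R) (n m : nat)
    (x : dyadic -> X) : 0 < p -> (n <= m)%N -> savg p n x <= savg p m x.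
Proof.
move=> p0 nm; rewrite -lee_fin -!integral_spart.
apply: ge0_le_integral => //.
- by move=> t _; exact: patch_spart_ge0.
- exact: measurable_spart.
- exact: measurable_spart.
- by move=> t _; exact: patch_spart_mono.
Qed.

Lemma ereal_sup_powR (R : realType) (p : R) (u : nat -> R) : 0 < p ->
  (forall n, 0 <= u n) ->
  (ereal_sup (range (fun n => (u n)%:E)) `^ p)%E =
  ereal_sup (range (fun n => (u n `^ p)%:E)).
Proof.
move=> p0 u0; set S := ereal_sup _; set S' := ereal_sup _.
have uS n : ((u n)%:E <= S)%E by apply: ereal_sup_ubound; exists n.
have uS' n : ((u n `^ p)%:E <= S')%E by apply: ereal_sup_ubound; exists n.
have S0 : (0 <= S)%E by apply: le_trans (uS 0%N); rewrite lee_fin.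
have S'0 : (0 <= S')%E by apply: le_trans (uS' 0%N); rewrite lee_fin powR_ge0.
apply/eqP; rewrite eq_le; apply/andP; split.
  have : (S <= S' `^ p^-1)%E.
    apply: ge_ereal_sup => _ [n _ <-].
    have -> : (u n)%:E = ((u n `^ p)%:E `^ p^-1)%E.
      by rewrite poweR_EFin -powRrM mulfV ?gt_eqF// powRr1.
    apply: gt0_ler_poweR; rewrite ?invr_ge0 ?(ltW p0)// in_itv /= ?andbT leey ?andbT //.
    by rewrite lee_fin powR_ge0.
  move=> h; have -> : S' = ((S' `^ p^-1) `^ p)%E.
    by rewrite -poweRrM mulVf ?gt_eqF// poweRe1.
  by apply: gt0_ler_poweR; rewrite ?(ltW p0)// in_itv /= ?leey ?andbT ?poweR_ge0.
apply: ge_ereal_sup => _ [n _ <-]; rewrite -poweR_EFin.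
by apply: gt0_ler_poweR; rewrite ?(ltW p0)// in_itv /= ?leey ?andbT// lee_fin.
Qed.

Lemma hardy_norm_powR (R : realType) (X : normedModType R) (p : R)
    (x : dyadic -> X) : 0 < p ->
  (hardy_norm p x `^ p)%E = ereal_sup (range (fun n => (savg p n x)%:E)).
Proof.
move=> p0; rewrite /hardy_norm /Lp01 poweR_Lnorm ?gt_eqF//.
pose g n := (EFin \o (fun t => spart n x t `^ p)) \_ `[0, 1]%classic.
have gnd t : nondecreasing_seq (g^~ t).
  by move=> n m nm; exact: patch_spart_mono.
have -> : (\int[@lebesgue_measure R]_t (`|((square_fun x) \_ `[0%R, 1%R]%classic) t| `^ p) =
    \int[@lebesgue_measure R]_t limn (g^~ t))%E.
  apply: eq_integral => t _.
  have -> : limn (g^~ t) = ereal_sup (range (g^~ t)).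
    by apply: cvg_lim => //; exact: ereal_nondecreasing_cvgn.
  rewrite /g !patchE; case: ifP => t01; last first.
    rewrite abse0 poweR0r ?gt_eqF//; apply/eqP; rewrite eq_le; apply/andP; split.
      by apply: ereal_sup_ubound; exists 0%N => //; rewrite patchE t01.
    by apply: ge_ereal_sup => _ [n _ <-]; rewrite patchE t01.
  have t01' : 0 <= t <= 1 by move: t01; rewrite inE /= in_itv /=.
  rewrite (square_funE x t01') gee0_abs; last first.
    apply: le_trans (_ : (0 <= (spart 0 x t)%:E)%E) _; first by rewrite lee_fin spart_ge0.
    by apply: ereal_sup_ubound; exists 0%N.
  rewrite ereal_sup_powR//; last by move=> n; exact: spart_ge0.
  by congr ereal_sup; apply: eq_imagel => n _; rewrite patchE t01.
rewrite monotone_convergence//.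
- apply: cvg_lim => //.
  have -> : (fun n => \int[@lebesgue_measure R]_t g n t)%E = (fun n => (savg p n x)%:E).
    by apply/funext => n; exact: integral_spart.
  by apply: ereal_nondecreasing_cvgn => n m nm; rewrite lee_fin savg_mono.
- by move=> n; exact: measurable_spart.
- by move=> n t _; exact: patch_spart_ge0.
Qed.

(** The square function is at least [srad n x k] on the whole cell, which has positive measure, so
    no null set can hide this value. *)
Lemma srad_le_ess_sup (R : realType) (X : normedModType R) (n k : nat)
    (x : dyadic -> X) : (k < 2 ^ n)%N ->
  ((srad n x k)%:E <= Lp01 +oo (square_fun x))%E.
Proof.
move=> kn.
have I0 : (0 < lebesgue_measure (dy_interval R n k))%E.
  by rewrite lebesgue_dy_interval lte_fin invr_gt0 exprn_gt0.
rewrite /Lp01 unlock ifT; last first.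
  apply: lt_le_trans I0 _; apply: le_measure; rewrite ?inE//.
  exact: measurable_dy_interval.
set f := abse \o _; rewrite leNgt; apply/negP => lt.
have := ess_sup_ge lebesgue_measure f => -[A [mA A0 sub]].
have : (lebesgue_measure (dy_interval R n k) <= lebesgue_measure A)%E.
  apply: le_measure; rewrite ?inE//; first exact: measurable_dy_interval.
  move=> t kt; apply: sub => /= ft.
  have := le_lt_trans ft lt; rewrite ltNge => /negP; apply.
  have /andP[t0 t1] := dy_interval01 kn kt.
  have t01 : 0 <= t <= 1 by rewrite t0 ltW.
  rewrite /f /= patchE ifT; last by rewrite inE /= in_itv.
  apply: le_trans (lee_abs _); rewrite (square_funE x t01) -(spart_interval x kn kt).
  by apply: ereal_sup_ubound; exists n.
by rewrite A0 leNgt I0.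
Qed.

(** * Combinatorics of dyadic intervals and blocks *)

Lemma dy_itvE (R : realType) (I : dyadic) (t : R) : 0 <= t ->
  dy_itv R I t <-> Num.truncn (2 ^+ dy_level I * t) = dy_pos I.
Proof. exact: dy_interval_truncn. Qed.

Lemma dy_itv_ge0 (R : realType) (I : dyadic) (t : R) : dy_itv R I t -> 0 <= t.
Proof. exact: dy_interval_ge0. Qed.

Lemma dy_subE (R : realType) (I J : dyadic) :
  dy_sub R I J <->
  (dy_level J <= dy_level I)%N /\ anc (dy_level I) (dy_pos I) (dy_level J) = dy_pos J.
Proof.
split=> [IJ|[lJI aE] t It]; last first.
  have t0 := dy_itv_ge0 It; apply/(dy_itvE _ t0).
  by rewrite (truncn_anc t0 lJI); move/(dy_itvE _ t0) : It => ->.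
pose t0 : R := (dy_pos I)%:R / 2 ^+ dy_level I.
have p0 l : 0 < 2 ^+ l :> R by rewrite exprn_gt0.
have t00 : 0 <= t0 by rewrite divr_ge0.
have It0 : dy_itv R I t0.
  by apply/dy_intervalE; rewrite mulrC divfK ?gt_eqF// lexx ltr_nat ltnSn.
have Jt0 := IJ _ It0; move/(dy_itvE _ t00) : (It0) => E0.
have [lJI|lIJ] := leqP (dy_level J) (dy_level I).
  split => //; rewrite -E0 -truncn_anc//; exact/(dy_itvE _ t00).
(* If [I] were longer than [J], moving from its left endpoint by the length of [J] would stay in [I]
   but leave [J]. *)
pose t1 := t0 + (2 ^+ dy_level J)^-1.
have t10 : 0 <= t1 by rewrite addr_ge0 ?invr_ge0 ?(ltW (p0 _)).
have It1 : dy_itv R I t1.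
  apply/dy_intervalE; rewrite mulrDr {1 2}mulrC divfK ?gt_eqF//.
  rewrite lerDl divr_ge0 ?(ltW (p0 _))//= -[X in _ < X]natr1 ltrD2l ltr_pdivrMr// mul1r.
  by rewrite ltr_eXn2l// ltr1n.
have Jt1 := IJ _ It1; move/dy_intervalE : Jt0 => /andP[h1 _].
move/dy_intervalE : Jt1 => /andP[_]; rewrite mulrDr mulfV ?gt_eqF// -[X in _ < X]natr1.
by rewrite ltrD2r ltNge h1.
Qed.

Lemma dy_sub_anti (R : realType) (I J : dyadic) :
  dy_sub R I J -> dy_sub R J I -> I = J.
Proof.
move=> /dy_subE[l1 e1] /dy_subE[l2 e2].
have l12 : dy_level I = dy_level J by apply/eqP; rewrite eqn_leq l2 l1.
by apply: dy_ext => //; rewrite -e1 l12 /anc subnn expn0 divn1.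
Qed.

Lemma anc_lt (n k l : nat) : (k < 2 ^ n)%N -> (l <= n)%N -> (anc n k l < 2 ^ l)%N.
Proof. by move=> kn iln; rewrite /anc ltn_divLR ?expn_gt0// -expnD subnKC. Qed.

Lemma dy_sub_anc (R : realType) (n k l l' : nat) :
  (k < 2 ^ n)%N -> (l' <= l)%N -> (l <= n)%N ->
  dy_sub R (mkdy l (anc n k l)) (mkdy l' (anc n k l')).
Proof.
move=> kn ll ln; apply/dy_subE; split => //=.
rewrite !mkdy_pos ?anc_lt ?(leq_trans ll)//.
by rewrite (anc_anc k ll ln).
Qed.

Lemma anc_dy_sub (R : realType) (n k l : nat) (J : dyadic) :
  (k < 2 ^ n)%N -> (l <= n)%N -> dy_sub R (mkdy l (anc n k l)) J ->
  J = mkdy (dy_level J) (anc n k (dy_level J)).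
Proof.
move=> kn ln /dy_subE[/= lJ]; rewrite mkdy_pos ?anc_lt// => e.
apply: dy_ext => //; rewrite mkdy_pos ?anc_lt ?(leq_trans lJ)//.
by rewrite -e (anc_anc k lJ ln).
Qed.

(** A member that is not maximal lies in a strictly larger member, of smaller level; climbing ends
    at the unique maximal one, which must then be the union. *)
Lemma block_top (R : realType) (C : set dyadic) (T : dyadic) :
  dy_block R C -> \bigcup_(J in C) dy_itv R J = dy_itv R T ->
  [/\ C T, forall J, C J -> dy_sub R J T
    & forall J K, C J -> dy_sub R J K -> dy_sub R K T -> C K].
Proof.
move=> [M [[[CM maxM] uniM] conv]] CT.
have leM J : C J -> dy_sub R J M.
  have [d dE] : exists d, d = dy_level J by eexists.
  elim/ltn_ind: d J dE => d IH J dE CJ.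
  have [maxJ|nmaxJ] := pselect (dy_maximal R C J).
    by rewrite (uniM _ maxJ).
  have [K [CK JK KJ]] : exists K, [/\ C K, dy_sub R J K & K <> J].
    apply: contrapT => nK; apply: nmaxJ; split => // K CK JK.
    by apply: contrapT => KJ; apply: nK; exists K.
  have [lKJ eKJ] := (dy_subE R J K).1 JK.
  apply: subset_trans JK _; apply: (IH (dy_level K)) => //.
  rewrite dE ltn_neqAle lKJ andbT.
  apply/eqP => lE; apply: KJ; apply: dy_ext => //.
  by rewrite -eKJ lE /anc subnn expn0 divn1.
have MT : M = T.
  apply: (@dy_sub_anti R); first by rewrite /dy_sub -CT => t Mt; exists M.
  by rewrite /dy_sub -CT => t [J CJ Jt]; exact: (leM J CJ).
by rewrite -MT.
Qed.

Lemma sum_anc (V : nmodType) (n l : nat) (F : 'I_(2 ^ n) -> V) : (l <= n)%N ->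
  \sum_k F k = \sum_(q < 2 ^ l) \sum_(k : 'I_(2 ^ n) | anc n k l == q) F k.
Proof.
move=> ln.
rewrite (partition_big (fun k : 'I_(2 ^ n) => Ordinal (anc_lt (ltn_ord k) ln)) predT)//=.
Qed.

Lemma sum_cells (V : nmodType) (n : nat) (F : dyadic -> 'I_(2 ^ n) -> V) :
  \sum_(k < 2 ^ n) \sum_(l < n.+1) F (mkdy l (anc n k l)) k =
  \sum_(t : dyT n) \sum_(k : 'I_(2 ^ n) | anc n k (dy_level (dyT_val t)) == dy_pos (dyT_val t))
    F (dyT_val t) k.
Proof.
rewrite exchange_big /=.
rewrite -(@sig_big_dep _ _ _ _ (fun l : 'I_n.+1 => 'I_(2 ^ l)) (fun=> true) (fun _ _ => true)
  (fun (l : 'I_n.+1) (q : 'I_(2 ^ l)) =>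
   \sum_(k : 'I_(2 ^ n) | anc n k l == q) F (existT _ (l : nat) q) k))/=.
apply: eq_bigr => l _; rewrite (sum_anc _ (_ : (l <= n)%N)); last by rewrite -ltnS.
apply: eq_bigr => q _; apply: eq_bigr => k /eqP kq; congr F.
by apply: dy_ext => //; rewrite mkdy_pos kq//; exact: ltn_ord.
Qed.

Lemma count_cells (R : realType) (n l q : nat) : (l <= n)%N -> (q < 2 ^ l)%N ->
  \sum_(k < 2 ^ n | anc n k l == q) 1 = 2 ^+ (n - l) :> R.
Proof.
move=> ln ql; pose d := (2 ^ (n - l))%N.
have d0 : (0 < d)%N by rewrite expn_gt0.
have dE : (2 ^ n = 2 ^ l * d)%N by rewrite /d -expnD subnKC.
rewrite big_mkcond /= -(big_mkord predT (fun k => if anc n k l == q then 1 else 0)).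
(* The cells below position [q] are the [d] consecutive ones starting at [q * d]. *)
have qd : (q * d + d <= 2 ^ n)%N by rewrite dE -mulSnr leq_mul2r ql orbT.
rewrite (big_cat_nat (n := (q * d)%N))//=; last by rewrite (leq_trans _ qd)// leq_addr.
rewrite (big_cat_nat (m := (q * d)%N) (n := (q * d + d)%N))//=; last by rewrite leq_addr.
rewrite big_nat_cond big1 ?add0r => [|k /andP[/andP[_ kq] _]]; last first.
  rewrite /anc -/d; case: eqP => // h.
  by move: kq; rewrite -h ltnNge leq_trunc_div.
rewrite [X in _ + X]big_nat_cond [X in _ + X]big1 ?addr0 => [|k /andP[/andP[kq _] _]]; last first.
  rewrite /anc -/d; case: eqP => // h.
  have := ltn_ceil k d0; rewrite h mulSnr => h'.
  by have := leq_ltn_trans kq h'; rewrite ltnn.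
rewrite big_nat_cond (eq_bigr (fun=> 1)) => [|k /andP[/andP[k1 k2] _]]; last first.
  rewrite /anc -/d ifT//; apply/eqP/eqP; rewrite eqn_leq; apply/andP; split.
    by rewrite -ltnS ltn_divLR// mulSnr.
  by rewrite leq_divRL.
by rewrite -big_nat_cond sumr_const_nat addKn natrX.
Qed.

(** * Sums over all dyadic intervals as suprema of finite sums *)

Lemma finite_dy_upto (R : realType) (n : nat) : finite_set (dy_upto R n).
Proof.
apply: (sub_finite_set (B := [set` map (@dyT_val n) (enum (dyT n))])) => // I /dy_uptoE In /=.
apply/mapP; exists (existT _ (Ordinal (In : (dy_level I < n.+1)%N)) (tagged I)).
  by rewrite mem_enum.
by case: I In.
Qed.

Lemma fin_le_esum (R : realType) (n : nat) (S : set dyadic) (f : dyadic -> R) :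
  (forall I, S I -> 0 <= f I) ->
  ((\sum_(t : dyT n | `[< S (dyT_val t) >]) f (dyT_val t))%:E <=
   \esum_(I in S) (f I)%:E)%E.
Proof.
move=> f0; apply: esum_ge; exists (dy_upto R n `&` S).
  by split; [apply: finite_setIl; exact: finite_dy_upto | move=> I []].
rewrite fsbig_mkcondr fsum_dy_upto -sumEFin big_mkcond /=; apply: lee_sum => t _.
by rewrite /patch; case: asboolP => St; [rewrite mem_set | rewrite memNset].
Qed.

Lemma esum_le_fin (R : realType) (S : set dyadic) (f : dyadic -> R) (c : \bar R) :
  (forall I, S I -> 0 <= f I) ->
  (forall n, (\sum_(t : dyT n | `[< S (dyT_val t) >]) f (dyT_val t))%:E <= c)%E ->
  (\esum_(I in S) (f I)%:E <= c)%E.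
Proof.
move=> f0 fc; apply: ge_ereal_sup => _ [F [finF FS] <-].
have [n hn] : exists n, F `<=` dy_upto R n.
  move/finite_seqP : finF => [r rE].
  exists (\max_(I <- r) dy_level I) => I; rewrite rE /= => Ir.
  by apply/dy_uptoE; rewrite (leq_bigmax_seq (F := dy_level)).
apply: le_trans (fc n).
have -> : ((\sum_(t : dyT n | `[< S (dyT_val t) >]) f (dyT_val t))%:E =
    \sum_(I \in dy_upto R n `&` S) (f I)%:E)%E.
  rewrite fsbig_mkcondr fsum_dy_upto -sumEFin big_mkcond /=; apply: eq_bigr => t _.
  by rewrite /patch; case: asboolP => St; [rewrite mem_set | rewrite memNset].
apply: lee_fsum_nneg_subset => //.
- by apply: finite_setIl; exact: finite_dy_upto.
- by move=> I; rewrite !inE => FI; split; [exact: hn | exact: FS].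
- by move=> I /andP[_ /set_mem[_ SI]]; rewrite lee_fin; exact: f0.
Qed.

Lemma pow2_sub (R : realType) (n l : nat) : (l <= n)%N ->
  2 ^+ (n - l) = 2 ^+ n / 2 ^+ l :> R.
Proof.
by move=> ln; rewrite -[n in RHS](subnK ln) exprD mulfK// expf_neq0.
Qed.

Section blocks.
(* [T J] is the maximal interval of the block containing [J]. *)
Variables (R : realType) (X : normedModType R) (T : dyadic -> dyadic).
Hypothesis T_idem : forall J, T (T J) = T J.
Hypothesis sub_T : forall J, dy_sub R J (T J).
Hypothesis T_convex : forall J K, dy_sub R J K -> dy_sub R K (T J) -> T K = T J.
Hypothesis T_carleson : forall I, T I = I ->
  (\esum_(J in [set J | T J = J /\ dy_sub R J I]) (dy_len R J)%:E <=
   (4 * dy_len R I)%:E)%E.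

Let E (l q : nat) : bool := `[< T (mkdy l q) = mkdy l q >].

Let cells_len (n : nat) (t : dyT n) :
  \sum_(k : 'I_(2 ^ n) | anc n k (dy_level (dyT_val t)) == dy_pos (dyT_val t)) 1 =
  2 ^+ n * dy_len R (dyT_val t).
Proof.
have ln : (dy_level (dyT_val t) <= n)%N by rewrite -ltnS; exact: ltn_ord.
rewrite count_cells//; last exact: dy_pos_lt.
exact: pow2_sub.
Qed.

(** Both sides count cells: a top J of level at most [n] inside the given one is seen by exactly
    [2 ^+ n * dy_len R J] cells, so the Carleson condition is read off after exchanging the sums. *)
Lemma T_carleson_cells (n l : nat) (k0 : 'I_(2 ^ n)) : (l <= n)%N ->
  E l (anc n k0 l) ->
  \sum_(k : 'I_(2 ^ n) | anc n k l == anc n k0 l)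
    (mult (fun i => E i (anc n k i)) n l)%:R <=
  4 * \sum_(k : 'I_(2 ^ n) | anc n k l == anc n k0 l) 1 :> R.
Proof.
move=> ln /asboolP TI0; set I0 := mkdy _ _ in TI0.
have q0 := anc_lt (ltn_ord k0) ln.
pose F (J : dyadic) (k : 'I_(2 ^ n)) : R :=
  (anc n k l == anc n k0 l)%:R * (l <= dy_level J)%N%:R * `[< T J = J >]%:R.
have -> : \sum_(k : 'I_(2 ^ n) | anc n k l == anc n k0 l)
    (mult (fun i => E i (anc n k i)) n l)%:R =
    \sum_(k < 2 ^ n) \sum_(i < n.+1) F (mkdy i (anc n k i)) k.
  rewrite big_mkcond /=; apply: eq_bigr => k _.
  rewrite /F; case: eqP => _; last by rewrite big1// => i _; rewrite !mul0r.
  rewrite /mult (@big_nat_widenl _ _ _ _ 0)// big_mkord natr_sum big_mkcond /=.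
  by apply: eq_bigr => i _; rewrite mul1r; case: (l <= i)%N; rewrite ?mul1r ?mul0r.
rewrite sum_cells.
have sumF (t : dyT n) :
    \sum_(k : 'I_(2 ^ n) | anc n k (dy_level (dyT_val t)) == dy_pos (dyT_val t)) F (dyT_val t) k =
    if `[< T (dyT_val t) = dyT_val t /\ dy_sub R (dyT_val t) I0 >]
    then 2 ^+ n * dy_len R (dyT_val t) else 0.
  have tn : (dy_level (dyT_val t) <= n)%N by rewrite -ltnS; exact: ltn_ord.
  rewrite -cells_len; case: asboolP => [[Tt /dy_subE[/= lt et]]|nt].
    apply: eq_bigr => k /eqP kt; rewrite /F lt asboolT// !mulr1.
    have -> : anc n k l = anc n k0 l; last by rewrite eqxx.
    rewrite (anc_anc k lt tn) kt; move: et; rewrite mkdy_pos//.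
  apply: big1 => k /eqP kt; rewrite /F.
  case: eqP => [kl|]; last by rewrite !mul0r.
  case: leqP => [lt|]; last by rewrite mulr0 mul0r.
  case: asboolP => [Tt|]; last by rewrite mulr0.
  exfalso; apply: nt; split => //; apply/dy_subE; split => //=.
  by rewrite mkdy_pos// -kl (anc_anc k lt tn) kt.
under eq_bigr do rewrite sumF.
rewrite -big_mkcond -mulr_sumr count_cells//.
have -> : 4 * 2 ^+ (n - l) = 2 ^+ n * (4 * dy_len R I0) :> R.
  by rewrite pow2_sub// mulrCA.
rewrite ler_wpM2l ?exprn_ge0// -lee_fin.
apply: le_trans (T_carleson TI0).
apply: (@fin_le_esum R n [set J | T J = J /\ dy_sub R J I0] (dy_len R)) => J _.
by rewrite /dy_len invr_ge0 exprn_ge0.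
Qed.

Definition fiber (I : dyadic) (f : dyadic -> X) : dyadic -> X :=
  haar_restr [set J | T J = I] f.

Lemma fiberE (I J : dyadic) (f : dyadic -> X) :
  fiber I f J = if `[< T J = I >] then f J else 0.
Proof.
rewrite /fiber /haar_restr /patch.
by case: asboolP => h; [rewrite mem_set | rewrite memNset].
Qed.

(** By convexity, a block contains no interval inside a strictly smaller top of another block. Cells
    sharing that smaller top therefore see the same coefficients. *)
Lemma srad_fiber_const (n l l' : nat) (k k' : 'I_(2 ^ n)) (f : dyadic -> X) :
  (l < l')%N -> (l' <= n)%N -> E l (anc n k l) -> E l' (anc n k l') ->
  anc n k l' = anc n k' l' ->
  srad n (fiber (mkdy l (anc n k l)) f) k = srad n (fiber (mkdy l (anc n k' l)) f) k'.
Proof.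
move=> ll' l'n /asboolP Tl /asboolP Tl' kk'.
have kl : anc n k l = anc n k' l by exact: anc_eq_le (ltnW ll') l'n kk'.
rewrite /srad; congr rad; apply/funext => i; rewrite -kl.
have iln : (i <= n)%N by rewrite -ltnS.
have [il'|l'i] := leqP i l'; first by rewrite (anc_eq_le il' l'n kk').
have out (k1 : 'I_(2 ^ n)) : anc n k1 l' = anc n k l' ->
    fiber (mkdy l (anc n k l)) f (mkdy i (anc n k1 i)) = 0.
  move=> k1l'; rewrite fiberE; case: asboolP => // Ti; exfalso.
  have k1l : anc n k1 l = anc n k l by exact: anc_eq_le (ltnW ll') l'n k1l'.
  have s1 : dy_sub R (mkdy i (anc n k1 i)) (mkdy l' (anc n k l')).
    by rewrite -k1l'; apply: dy_sub_anc => //; exact: ltnW.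
  have s2 : dy_sub R (mkdy l' (anc n k l')) (T (mkdy i (anc n k1 i))).
    by rewrite Ti; apply: dy_sub_anc => //; exact: ltnW.
  have := T_convex s1 s2; rewrite Tl' Ti => /(congr1 dy_level) /= h.
  by move: ll'; rewrite h ltnn.
by rewrite !out.
Qed.

(** The interval of each level belongs to one block, whose top is an ancestor of the same cell;
    summing the fibres recovers [f], and the triangle inequality for [rad] applies. *)
Lemma srad_le_fibers (n : nat) (k : 'I_(2 ^ n)) (f : dyadic -> X) :
  srad n f k <= \sum_(l < n.+1) (E l (anc n k l))%:R *
    srad n (fiber (mkdy l (anc n k l)) f) k.
Proof.
under eq_bigr do rewrite big_mulb.
rewrite -big_mkcond /=; apply: le_trans (rad_sum _ _ _).
rewrite /srad; set y1 := fun l => _; set y2 := fun l => _.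
rewrite (_ : y1 = y2)//; apply/funext => i; rewrite /y1 /y2 {y1 y2}.
have iln : (i <= n)%N by rewrite -ltnS.
set J := mkdy i (anc n k i).
have TJ : T J = mkdy (dy_level (T J)) (anc n k (dy_level (T J))).
  exact: anc_dy_sub (ltn_ord k) iln (@sub_T J).
have lTn : (dy_level (T J) < n.+1)%N.
  by have /dy_subE[/= h _] := @sub_T J; rewrite ltnS (leq_trans h).
rewrite (bigD1 (Ordinal lTn))/=; last by apply/asboolP; rewrite -TJ T_idem.
rewrite big1 ?addr0 => [|l /andP[/asboolP _ ll]].
  by rewrite fiberE -TJ asboolT.
rewrite fiberE; case: asboolP => // h; case/eqP: ll; apply: val_inj => /=.
by have := congr1 dy_level h => /= <-.
Qed.

Lemma srad_fiber0 (n : nat) (k : 'I_(2 ^ n)) (I : dyadic) (f : dyadic -> X) :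
  ~~ ((dy_level I <= n)%N && (anc n k (dy_level I) == dy_pos I)) ->
  srad n (fiber I f) k = 0.
Proof.
move=> nI; rewrite /srad -[RHS](rad0 X 'I_n.+1); congr rad; apply/funext => i.
have iln : (i <= n)%N by rewrite -ltnS.
rewrite fiberE; case: asboolP => // TJ; exfalso; move/negP: nI; apply.
have := @sub_T (mkdy i (anc n k i)); rewrite TJ => s.
have /dy_subE[/= h _] := s.
rewrite (leq_trans h iln)/=; apply/eqP.
have {2}-> := anc_dy_sub (ltn_ord k) iln s.
by rewrite mkdy_pos// anc_lt// (leq_trans h iln).
Qed.

Lemma savg_le_fibers (p : R) (n : nat) (f : dyadic -> X) : 0 < p <= 2 ->
  savg p n f <= 98 * \sum_(t : dyT n | `[< T (dyT_val t) = dyT_val t >])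
    dy_len R (dyT_val t) `^ (1 - p / 2) *
    savg 2 n (fiber (dyT_val t) f) `^ (p / 2).
Proof.
move=> /[dup] p02 /andP[p0 p2].
have w0 : 0 <= (2 ^+ n)^-1 :> R by rewrite invr_ge0 exprn_ge0.
pose g l (k : 'I_(2 ^ n)) := srad n (fiber (mkdy l (anc n k l)) f) k.
have g0 l k : 0 <= g l k by exact: rad_ge0.
have tree := carleson_sum (@T_carleson_cells n) g0
  (fun l l' k k' ll' l'n => @srad_fiber_const n l l' k k' f ll' l'n) p02.
pose F (J : dyadic) (k : 'I_(2 ^ n)) := `[< T J = J >]%:R * srad n (fiber J f) k `^ p.
apply: le_trans (_ : (2 ^+ n)^-1 * (98 * \sum_(k < 2 ^ n) \sum_(l < n.+1)
    F (mkdy l (anc n k l)) k) <= _).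
  rewrite /savg ler_wpM2l//; apply: le_trans tree; apply: ler_sum => k _.
  rewrite ge0_ler_powR ?nnegrE ?rad_ge0 ?(ltW p0) ?srad_le_fibers//.
  by apply: sumr_ge0 => l _; rewrite mulr_ge0 ?ler0n.
rewrite sum_cells mulrCA ler_wpM2l// mulr_sumr [leRHS]big_mkcond /=.
apply: ler_sum => t _; rewrite /F; case: asboolP => Tt; last first.
  by rewrite big1 ?mulr0// => k _; rewrite mul0r.
under eq_bigr do rewrite mul1r.
pose P (k : 'I_(2 ^ n)) := anc n k (dy_level (dyT_val t)) == dy_pos (dyT_val t).
pose a (k : 'I_(2 ^ n)) := srad n (fiber (dyT_val t) f) k.
suff : (2 ^+ n)^-1 * \sum_(k | P k) a k `^ p <= dy_len R (dyT_val t) `^ (1 - p / 2) *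
    savg 2 n (fiber (dyT_val t) f) `^ (p / 2) by [].
have a0 k : 0 <= a k by exact: rad_ge0.
set L := dy_len R _; have L0 : 0 < L by rewrite invr_gt0 exprn_gt0.
have PN : \sum_(k | P k) 1 = 2 ^+ n * L by exact: cells_len.
have n0 : 0 < 2 ^+ n :> R by rewrite exprn_gt0.
pose w : R := (2 ^+ n * L)^-1.
have w'0 : 0 <= w by rewrite invr_ge0 mulr_ge0 ?(ltW n0) ?(ltW L0).
have q1 : 1 <= 2 / p by rewrite ler_pdivlMr// mul1r.
have q0 : 0 < p / 2 by rewrite divr_gt0.
(* Jensen with uniform weights on the cells of the top interval raises p to 2; this normalization
   produces the power 1 - p / 2 of the length. *)
have jen : (\sum_(k | P k) w * a k `^ p) `^ (2 / p) <=
    \sum_(k | P k) w * (a k `^ p) `^ (2 / p).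
  apply: powR_jensen => //; first by move=> k; exact: powR_ge0.
  by rewrite -[w]mulr1 -mulr_sumr PN /w mulVf// mulf_neq0 ?gt_eqF.
have S0 : 0 <= \sum_(k | P k) w * a k `^ p.
  by apply: sumr_ge0 => k _; rewrite mulr_ge0 ?powR_ge0.
have ap k : (a k `^ p) `^ (2 / p) = a k `^ 2.
  by rewrite -powRrM mulrC divfK ?gt_eqF.
have jen2 : \sum_(k | P k) w * a k `^ p <= (L^-1 * savg 2 n (fiber (dyT_val t) f)) `^ (p / 2).
  have -> : \sum_(k | P k) w * a k `^ p =
      ((\sum_(k | P k) w * a k `^ p) `^ (2 / p)) `^ (p / 2).
    rewrite -powRrM (_ : 2 / p * (p / 2) = 1) ?powRr1//.
    by field; rewrite gt_eqF.
  apply: ge0_ler_powR; rewrite ?nnegrE ?powR_ge0 ?(ltW q0)//.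
    by rewrite mulr_ge0 ?invr_ge0 ?(ltW L0) ?savg_ge0.
  apply: le_trans jen _; under eq_bigr do rewrite ap.
  rewrite -mulr_sumr /w /savg invfM [_ / L]mulrC -mulrA.
  rewrite ler_wpM2l ?invr_ge0 ?(ltW L0)// ler_wpM2l// big_mkcond /=; apply: ler_sum => k _.
  by case: ifP => // _; exact: powR_ge0.
have -> : (2 ^+ n)^-1 * \sum_(k | P k) a k `^ p = L * \sum_(k | P k) w * a k `^ p.
  by rewrite -mulr_sumr /w invfM [_ / L]mulrC !mulrA mulfV ?gt_eqF// mul1r.
apply: le_trans (ler_wpM2l (ltW L0) jen2) _.
rewrite powRM ?invr_ge0 ?(ltW L0) ?savg_ge0// mulrA.
rewrite (_ : L * L^-1 `^ (p / 2) = L `^ (1 - p / 2))//.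
have -> : L `^ (1 - p / 2) = L `^ 1 / L `^ (p / 2).
  by rewrite powRB// (gt_eqF L0) implybT.
rewrite powRr1 ?(ltW L0)//; congr (_ * _).
by rewrite -powR_inv1 ?(ltW L0)// -powRrM mulN1r powRN.
Qed.

Lemma savg_fiber_le (n : nat) (I : dyadic) (f : dyadic -> X) (M : R) :
  0 <= M -> (forall k, (k < 2 ^ n)%N -> srad n (fiber I f) k <= M) ->
  savg 2 n (fiber I f) <= dy_len R I * M ^+ 2.
Proof.
move=> M0 hM; have L0 : 0 <= dy_len R I by rewrite invr_ge0 exprn_ge0.
have n0 : 0 < 2 ^+ n :> R by rewrite exprn_gt0.
have [In|nI] := leqP (dy_level I) n; last first.
  rewrite /savg big1 ?mulr0 ?mulr_ge0 ?sqr_ge0// => k _.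
  by rewrite srad_fiber0 ?powR0 ?pnatr_eq0// negb_and -ltnNge nI.
rewrite /savg; apply: le_trans (_ : (2 ^+ n)^-1 *
   \sum_(k : 'I_(2 ^ n) | anc n k (dy_level I) == dy_pos I) M ^+ 2 <= _).
  rewrite ler_wpM2l ?invr_ge0 ?(ltW n0)// [leRHS]big_mkcond /=; apply: ler_sum => k _.
  case: ifPn => [_|kI]; last by rewrite srad_fiber0 ?powR0 ?pnatr_eq0// In.
  by rewrite powR_mulrn ?rad_ge0// ler_pXn2r ?nnegrE ?rad_ge0// hM.
under eq_bigr do rewrite -[M ^+ 2]mul1r.
rewrite -mulr_suml count_cells//; last exact: dy_pos_lt.
rewrite mulrA ler_wpM2r ?sqr_ge0// /dy_len.
by rewrite pow2_sub// mulKf// expf_neq0.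
Qed.

End blocks.

(** * Dominating measures for atoms *)

(** By compactness there is a cluster point, to which an ultrafilter must converge. One ultrafilter
    thus gives limits at all intervals at once. *)
Lemma ultra_bounded_cvg (R : realType) (U : set_system nat) (u : nat -> R) (a b : R) :
  UltraFilter U -> (forall n, a <= u n <= b) -> exists l : R, u @ U --> l.
Proof.
move=> UU uab; have UP : ProperFilter U by exact: ultra_proper.
have [l [_ cl]] := @segment_compact R a b (u @ U) _ (filterS (fun n _ => uab n) filterT).
exists l => B lB.
have [//|UB] := in_ultra_setVsetC (u @^-1` B) UU.
by have [y [/= nBy By]] := cl (~` B) B UB lB.
Qed.

Lemma cvg_bigsum (R : realType) (U : set_system nat) (I : Type) (s : seq I)
    (P : pred I) (u : I -> nat -> R) (l : I -> R) :
  ProperFilter U -> (forall i, u i @ U --> l i) ->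
  (fun n => \sum_(i <- s | P i) u i n) @ U --> \sum_(i <- s | P i) l i.
Proof.
move=> UP ul; elim: s => [|i s IH].
  rewrite big_nil (_ : (fun _ => _) = (fun=> 0)); first exact: cvg_cst.
  by apply/funext => n; rewrite big_nil.
rewrite big_cons; case: ifP => Pi; last first.
  rewrite (_ : (fun _ => _) = (fun n => \sum_(i <- s | P i) u i n))//.
  by apply/funext => n; rewrite big_cons Pi.
rewrite (_ : (fun _ => _) = (fun n => u i n + \sum_(i <- s | P i) u i n)).
  exact: cvgD.
by apply/funext => n; rewrite big_cons Pi.
Qed.

Definition cellT (n : nat) (k : 'I_(2 ^ n)) (l : 'I_n.+1) : dyT n :=
  existT (fun l : 'I_n.+1 => 'I_(2 ^ l)) l
    (Ordinal (anc_lt (ltn_ord k) (ltn_ord l : (l <= n)%N))).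

Lemma cellT_val (n : nat) (k : 'I_(2 ^ n)) (l : 'I_n.+1) :
  dyT_val (cellT k l) = mkdy l (anc n k l).
Proof.
have ln : (l <= n)%N by rewrite -ltnS ltn_ord.
by apply: dy_ext => //; rewrite mkdy_pos// anc_lt.
Qed.

Definition liftT (k n : nat) (kn : (k <= n)%N) (t : dyT k) : dyT n :=
  existT (fun l : 'I_n.+1 => 'I_(2 ^ l)) (widen_ord (kn : (k.+1 <= n.+1)%N) (tag t)) (tagged t).

Lemma liftT_val (k n : nat) (kn : (k <= n)%N) (t : dyT k) :
  dyT_val (liftT kn t) = dyT_val t.
Proof. by []. Qed.

Section atom.
Variables (R : realType) (X : normedModType R) (f : dyadic -> X).

Let bn (n : nat) (phi : dyT n -> R) : R :=
  bnorm (2 ^+ n)^-1 (@cellT n) (fun k l => f (mkdy l (anc n k l))) phi.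

Let w0 n : 0 <= (2 ^+ n)^-1 :> R.
Proof. by rewrite invr_ge0 exprn_ge0. Qed.

Let bn_seminorm n : sign_seminorm (bn (n := n)).
Proof. exact: bnorm_sign_seminorm. Qed.

Let bnE n (phi : dyadic -> R) :
  bn (fun t : dyT n => phi (dyT_val t)) = Num.sqrt (savg 2 n (fun I => phi I *: f I)).
Proof.
congr (Num.sqrt (_ * _)); apply: eq_bigr => k _; rewrite powR_mulrn ?rad_ge0//.
by congr (rad _ ^+ 2); apply/funext => l; rewrite cellT_val.
Qed.

(** Lets a domination proved at a finer level [n] be tested on a set of intervals of level at most
    [k]. *)
Let bn_lift k n (kn : (k <= n)%N) (B : {set dyT k}) :
  bn (ind R _ B) <= bn (ind R _ (liftT kn @: B)%SET).
Proof.
pose phi (I : dyadic) : R := `[< exists2 t, t \in B & dyT_val t = I >]%:R.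
have -> : ind R _ B = (fun t => phi (dyT_val t)).
  apply/funext => t; rewrite /ind /phi; congr (_%:R); congr nat_of_bool.
  apply/idP/asboolP => [tB|[t' t'B /dyT_val_inj <-//]].
  by exists t.
have -> : ind R _ (liftT kn @: B)%SET = (fun t => phi (dyT_val t)).
  apply/funext => t; rewrite /ind /phi; congr (_%:R); congr nat_of_bool.
  apply/imsetP/asboolP => [[t' t'B ->]|[t' t'B e]]; first by exists t'.
  by exists t' => //; apply: dyT_val_inj; rewrite -e.
by rewrite !bnE ler_wsqrtr// savg_mono.
Qed.

Variables (r C B : R) (S : set dyadic) (I0 : dyadic).
Hypothesis r2 : 2 <= r.
Hypothesis cot : disc_cotype X r C.
Hypothesis B0 : 0 <= B.
Hypothesis SI0 : S I0.
Hypothesis fS : forall I, ~ S I -> f I = 0.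
Hypothesis fB : forall n, savg 2 n f <= B ^+ 2.

Let C0 : 0 <= C. Proof. exact: cot.1. Qed.
Let r0 : 0 < r. Proof. by apply: lt_le_trans r2. Qed.
Let V := (C * B) `^ r.
Let V0 : 0 <= V. Proof. exact: powR_ge0. Qed.

Let bn1 n : bn (fun _ : dyT n => 1) <= B.
Proof.
rewrite (@bnE n (fun=> 1)).
under [X in savg 2 n X]eq_fun do rewrite scale1r.
by rewrite -(ger0_norm B0) -sqrtr_sqr ler_wsqrtr.
Qed.

Let finite_dom n : exists nu : dyT n -> R, [/\ forall t, 0 <= nu t, \sum_t nu t <= V
    & forall D : {set dyT n}, bn (ind R _ D) `^ r <= r * \sum_(t in D) nu t].
Proof.
apply: pisier_domination; [exact: bn_seminorm | by apply: le_trans r2; rewrite ler1n |] => chi.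
apply: le_trans (bnorm_lower _ _ _ (w0 n) r2 cot) _.
apply: ge0_ler_powR; rewrite ?nnegrE ?(ltW r0) ?mulr_ge0 ?sqrtr_ge0//.
by rewrite ler_wpM2l// bn1.
Qed.

Let nu n : dyT n -> R := projT1 (cid (finite_dom n)).

Let nu_ge0 n (t : dyT n) : 0 <= nu t.
Proof. by rewrite /nu; case: cid => ? []. Qed.

Let nu_sum n : \sum_(t : dyT n) nu t <= V.
Proof. by rewrite /nu; case: cid => ? []. Qed.

Let nu_dom n (D : {set dyT n}) : bn (ind R _ D) `^ r <= r * \sum_(t in D) nu t.
Proof. by rewrite /nu; case: cid => ? []. Qed.

(** Extension by zero, so that the measures for different [n] live on one index set. *)
Let wn n (I : dyadic) : R :=
  if [pick t : dyT n | `[< dyT_val t = I >]] is Some t then nu t else 0.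

Let wn_val n (t : dyT n) : wn n (dyT_val t) = nu t.
Proof.
rewrite /wn; case: pickP => [t' /asboolP /dyT_val_inj ->//|/(_ t)].
by rewrite asboolT.
Qed.

Let wn_ge0 n I : 0 <= wn n I.
Proof. by rewrite /wn; case: pickP. Qed.

Let wn_le n I : wn n I <= V.
Proof.
rewrite /wn; case: pickP => // t _; apply: le_trans (nu_sum n).
by rewrite (bigD1 t)//= lerDl sumr_ge0.
Qed.

Let wn_lift k n (kn : (k <= n)%N) (D : {set dyT k}) :
  \sum_(t in D) wn n (dyT_val t) = \sum_(t in (liftT kn @: D)%SET) nu t.
Proof.
rewrite big_imset/=; last first.
  by move=> t t' _ _ /(congr1 (@dyT_val n)) h; apply: (@dyT_val_inj k); exact: h.
by apply: eq_bigr => t _; rewrite -(liftT_val kn) wn_val.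
Qed.

(** For a fixed finite set [D] both bounds hold at every level n >= k and involve finitely many
    masses, so they pass to the limit along the ultrafilter. *)
Let limit_dom : exists nu' : dyadic -> R, [/\ forall I, 0 <= nu' I,
    forall k (D : {set dyT k}), \sum_(t in D) nu' (dyT_val t) <= V
  & forall k (D : {set dyT k}), bn (ind R _ D) `^ r <= r * \sum_(t in D) nu' (dyT_val t)].
Proof.
have [U [UU ooU]] := @ultraFilterLemma nat eventually _.
have UP : ProperFilter U by exact: ultra_proper.
have lim I := ultra_bounded_cvg UU (fun n => introT andP (conj (wn_ge0 n I) (wn_le n I))).
pose nu' I := projT1 (cid (lim I)).
have cvg I : (fun n => wn n I) @ U --> nu' I by rewrite /nu'; case: cid.
have cvgD k (D : {set dyT k}) :
    (fun n => \sum_(t in D) wn n (dyT_val t)) @ U --> \sum_(t in D) nu' (dyT_val t).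
  exact: (@cvg_bigsum R U _ _ _ (fun t n => wn n (dyT_val t)) (fun t => nu' (dyT_val t))).
have near k : U [set n | (k <= n)%N] by apply: ooU; exact: nbhs_infty_ge.
exists nu'; split.
- by move=> I; apply: (cvgr_to_ge (cvg I)); apply: filterS (near 0%N) => n _; exact: wn_ge0.
- move=> k D; apply: (cvgr_to_le (cvgD k D)); apply: filterS (near k) => n kn.
  rewrite /= (wn_lift kn); apply: le_trans (nu_sum n).
  by rewrite big_mkcond /=; apply: ler_sum => t _; case: ifP.
- move=> k D; rewrite -ler_pdivrMl//; apply: (cvgr_to_ge (cvgD k D)).
  apply: filterS (near k) => n kn; rewrite /= ler_pdivrMl// (wn_lift kn).
  apply: le_trans (nu_dom _); apply: ge0_ler_powR; rewrite ?nnegrE ?(ltW r0) ?sqrtr_ge0//.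
Qed.

Lemma pietsch_atom : exists mu : dyadic -> R,
  [/\ forall I, 0 <= mu I, (\esum_(I in S) (mu I)%:E = 1)%E
    & forall (n : nat) (s : R) (phi : dyadic -> R), r < s ->
      savg 2 n (fun I => phi I *: f I) <=
      (r `^ r^-1 * C * B * lorentz_const s r *
       (\sum_(t : dyT n | `[< S (dyT_val t) >])
          `|phi (dyT_val t)| `^ s * mu (dyT_val t)) `^ s^-1) ^+ 2].
Proof.
have [nu' [nu'0 nu'V nu'dom]] := limit_dom.
(* If [V = 0] this is zero, and the whole mass comes from the correction at [I0]. *)
pose v I := nu' I / V.
have v0 I : 0 <= v I by rewrite divr_ge0.
have vS n : (\sum_(t : dyT n | `[< S (dyT_val t) >]) v (dyT_val t) <= 1)%R.
  rewrite -mulr_suml; have [V00|Vn0] := eqVneq V 0; first by rewrite V00 invr0 mulr0.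
  rewrite ler_pdivrMr ?mul1r ?lt_neqAle 1?eq_sym ?Vn0//.
  apply: le_trans (nu'V n [set t | `[< S (dyT_val t) >]]%SET).
  by under [leRHS]eq_bigl do rewrite inE.
have vS1 : (\esum_(I in S) (v I)%:E <= 1)%E by apply: esum_le_fin => // n; rewrite lee_fin.
pose m := fine (\esum_(I in S) (v I)%:E)%E.
have vSfin : (\esum_(I in S) (v I)%:E)%E \is a fin_num.
  rewrite ge0_fin_numE ?(le_lt_trans vS1) ?ltry//.
  by apply: esum_ge0 => I _; rewrite lee_fin.
have mE : (\esum_(I in S) (v I)%:E = m%:E)%E by rewrite fineK.
have m1 : m <= 1 by rewrite -lee_fin -mE.
(* The mass lost in the limit or outside [S] is placed on [I0], which belongs to [S]. *)
pose mu I := v I + (1 - m) * `[< I = I0 >]%:R.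
have mu0 I : 0 <= mu I by rewrite addr_ge0// mulr_ge0 ?ler0n// subr_ge0.
have musum : (\esum_(I in S) (mu I)%:E = 1)%E.
  under eq_esum do rewrite EFinD.
  rewrite esumD; last 2 first.
  - by move=> I _; rewrite lee_fin.
  - by move=> I _; rewrite lee_fin mulr_ge0 ?ler0n// subr_ge0.
  rewrite mE.
  have -> : (\esum_(I in S) ((1 - m) * `[< I = I0 >]%:R)%:E = (1 - m)%:E)%E.
    have <- : (\esum_(I in [set I0]) ((1 - m)%R * `[< I = I0 >]%:R)%:E = (1 - m)%:E)%E.
      by rewrite esum_set1 asboolT// mulr1// lee_fin subr_ge0.
    rewrite esum_mkcond [RHS]esum_mkcond; apply: eq_esum => I _.
    case: (pselect (I = I0)) => [->|nI]; first by rewrite !mem_set.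
    rewrite [in RHS]memNset//; case: ifP => // _.
    by rewrite asboolF// mulr0.
  by rewrite -EFinD addrC subrK.
exists mu; split => // n s phi rs.
pose mu' (t : dyT n) := if `[< S (dyT_val t) >] then mu (dyT_val t) else 0.
have mu'0 t : 0 <= mu' t by rewrite /mu'; case: ifP.
have mu'1 : \sum_t mu' t <= 1.
  by rewrite -big_mkcond -lee_fin -musum; exact: fin_le_esum.
have kap0 : 0 <= r `^ r^-1 * C * B by rewrite !mulr_ge0 ?powR_ge0.
have dom (D : {set dyT n}) :
    bn (ind R _ D) <= r `^ r^-1 * C * B * (\sum_(t in D) mu' t) `^ r^-1.
  (* Indices outside [S] carry no mass, but [f] vanishes there and the seminorm ignores them. *)
  pose D' := [set t in D | `[< S (dyT_val t) >]]%SET.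
  have -> : bn (ind R _ D) = bn (ind R _ D').
    congr (Num.sqrt (_ * _)); apply: eq_bigr => k _; congr (rad _ ^+ 2).
    apply/funext => l; rewrite /ind inE cellT_val.
    case: asboolP => [_|nS]; first by rewrite andbT.
    by rewrite fS// !scaler0.
  have D'E : \sum_(t in D) mu' t = \sum_(t in D') mu (dyT_val t).
    by rewrite /mu' -big_mkcondr/=; apply: eq_bigl => t; rewrite inE.
  rewrite D'E.
  have bn0 : 0 <= bn (ind R _ D') by exact: sqrtr_ge0.
  have -> : bn (ind R _ D') = (bn (ind R _ D') `^ r) `^ r^-1.
    by rewrite -powRrM mulfV ?gt_eqF// powRr1.
  have -> : r `^ r^-1 * C * B * (\sum_(t in D') mu (dyT_val t)) `^ r^-1 =
      (r * (V * \sum_(t in D') mu (dyT_val t))) `^ r^-1.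
    have s0 : 0 <= \sum_(t in D') mu (dyT_val t) by apply: sumr_ge0.
    rewrite powRM ?(ltW r0) ?mulr_ge0// powRM// /V -powRrM mulfV ?gt_eqF//.
    by rewrite powRr1 ?mulr_ge0// !mulrA.
  apply: ge0_ler_powR; rewrite ?nnegrE ?invr_ge0 ?(ltW r0) ?powR_ge0//.
    by rewrite !mulr_ge0 ?(ltW r0)// sumr_ge0.
  apply: le_trans (nu'dom n D') _; rewrite ler_wpM2l ?(ltW r0)//.
  have [V00|Vn0] := eqVneq V 0; first by have := nu'V n D'; rewrite V00 mul0r.
  rewrite mulr_sumr; apply: ler_sum => t _.
  rewrite /mu mulrDr /v mulrC divfK// lerDl mulr_ge0// mulr_ge0 ?ler0n// subr_ge0//.
have := @lorentz_le R (dyT n) (bn (n := n)) _ r s mu' (fun t => phi (dyT_val t))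
  (bn_seminorm n) _ rs kap0 mu'0 mu'1 dom.
have -> : 1 <= r by apply: le_trans r2; rewrite ler1n.
move=> /(_ isT); rewrite bnE.
have -> : \sum_t `|phi (dyT_val t)| `^ s * mu' t =
    \sum_(t : dyT n | `[< S (dyT_val t) >]) `|phi (dyT_val t)| `^ s * mu (dyT_val t).
  rewrite [RHS]big_mkcond /=; apply: eq_bigr => t _; rewrite /mu'.
  by case: ifP => // _; rewrite mulr0.
move=> h; rewrite -[leLHS]sqr_sqrtr ?savg_ge0// ler_pXn2r ?nnegrE ?sqrtr_ge0//.
exact: le_trans (sqrtr_ge0 _) h.
Qed.

End atom.

(** * Summing over the atoms *)

Lemma dyT_of (n : nat) (I : dyadic) : (dy_level I <= n)%N ->
  exists t : dyT n, dyT_val t = I.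
Proof.
by case: I => l q ln; exists (existT _ (Ordinal (ln : (l < n.+1)%N)) q).
Qed.

(** Jensen for the concave power th, obtained from the convex power 1 / th. If Z <= 0, every weight
    in the sum is zero. *)
Lemma powR_weighted_sum_le (R : realType) (I : finType) (P : pred I) (a D : I -> R)
    (Z th : R) :
  0 < th <= 1 -> (forall i, 0 <= a i) -> (forall i, 0 <= D i) ->
  \sum_(i | P i) a i <= Z ->
  \sum_(i | P i) a i * D i `^ th <= Z * (\sum_(i | P i) a i / Z * D i) `^ th.
Proof.
move=> /andP[th0 th1] a0 D0 aZ.
have [Z0|Z0] := lerP Z 0.
  have ai0 i : P i -> a i = 0.
    move=> Pi; apply/eqP; rewrite eq_le a0 andbT.
    apply: le_trans Z0; apply: le_trans aZ.
    by rewrite (bigD1 i)//= lerDl sumr_ge0.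
  rewrite big1 => [|i Pi]; last by rewrite ai0// mul0r.
  have -> : Z = 0.
    by apply/eqP; rewrite eq_le Z0 (le_trans _ aZ)// sumr_ge0.
  by rewrite mul0r.
have th1' : 1 <= th^-1 by rewrite invf_ge1.
have w0 i : 0 <= a i / Z by rewrite divr_ge0// ltW.
have wD0 : 0 <= \sum_(i | P i) a i / Z * D i.
  by apply: sumr_ge0 => i _; rewrite mulr_ge0.
have wDt0 : 0 <= \sum_(i | P i) a i / Z * D i `^ th.
  by apply: sumr_ge0 => i _; rewrite mulr_ge0 ?powR_ge0.
have := @powR_jensen R I P (fun i => a i / Z) (fun i => D i `^ th) th^-1 th1' w0
  (fun i => powR_ge0 _ _).
rewrite -mulr_suml ler_pdivrMr// mul1r => /(_ aZ).
under [X in _ <= X -> _]eq_bigr do rewrite -powRrM mulfV ?gt_eqF// powRr1//.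
move=> jen.
have -> : \sum_(i | P i) a i * D i `^ th = Z * \sum_(i | P i) a i / Z * D i `^ th.
  by rewrite mulr_sumr; apply: eq_bigr => i _; rewrite mulrA [Z * _]mulrC divfK ?gt_eqF.
rewrite ler_wpM2l ?(ltW Z0)//.
have -> : \sum_(i | P i) a i / Z * D i `^ th =
    ((\sum_(i | P i) a i / Z * D i `^ th) `^ th^-1) `^ th.
  by rewrite -powRrM mulVf ?gt_eqF// powRr1.
by apply: ge0_ler_powR; rewrite ?nnegrE ?(ltW th0) ?powR_ge0.
Qed.

Section decomposition.
Variables (R : realType) (X : normedModType R) (A p : R) (x : dyadic -> X).
Variables (N : set nat) (G : nat -> set dyadic) (top : nat -> dyadic).
Hypothesis p02 : 0 < p <= 2.
Hypothesis hx : hardy p x.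
Hypothesis blk : forall i, N i -> dy_block R (G i).
Hypothesis triv : trivIset N G.
Hypothesis cov : \bigcup_(i in N) G i = setT.
Hypothesis tops : forall i, N i -> \bigcup_(J in G i) dy_itv R J = dy_itv R (top i).
Hypothesis carl : (carleson R (top @` N) <= 4%:E)%E.
Hypothesis norms : (\esum_(i in N) (dy_len R (top i))%:E *
    Lp01 +oo (square_fun (haar_restr (G i) x)) `^ p <= A%:E * hardy_norm p x `^ p)%E.

Let p0 : 0 < p. Proof. by case/andP: p02. Qed.
Let p2 : p <= 2. Proof. by case/andP: p02. Qed.

Let own_ex I : exists i, N i /\ G i I.
Proof. by have : setT I by []; rewrite -cov => -[i Ni GiI]; exists i. Qed.

Definition own (I : dyadic) : nat := projT1 (cid (own_ex I)).

Let own_N I : N (own I). Proof. by rewrite /own; case: cid => ? []. Qed.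
Let own_G I : G (own I) I. Proof. by rewrite /own; case: cid => ? []. Qed.
Let own_uniq i I : N i -> G i I -> own I = i.
Proof. by move=> Ni GI; apply: triv => //; exists I. Qed.

Let top_in i : N i -> G i (top i).
Proof. by move=> Ni; have [] := block_top (blk Ni) (tops Ni). Qed.
Let own_top i : N i -> own (top i) = i.
Proof. by move=> Ni; apply: own_uniq => //; exact: top_in. Qed.

(** The partition is encoded by this retraction onto tops, the form required for the estimates on
    blocks. *)
Let T I := top (own I).

Let T_idem J : T (T J) = T J.
Proof. by rewrite /T own_top. Qed.
Let sub_T J : dy_sub R J (T J).
Proof.
have [_ h _] := block_top (blk (own_N J)) (tops (own_N J)); exact: h.
Qed.
Let T_convex J K : dy_sub R J K -> dy_sub R K (T J) -> T K = T J.
Proof.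
have [_ _ h] := block_top (blk (own_N J)) (tops (own_N J)) => JK KT.
by rewrite /T (@own_uniq (own J) K)//; exact: (h J).
Qed.

Let topsE : [set I | T I = I] = top @` N.
Proof.
apply/seteqP; split => [I /= TI|_ [i Ni <-]]; first by exists (own I).
by rewrite /= /T own_top.
Qed.

Let T_carleson I : T I = I ->
  (\esum_(J in [set J | T J = J /\ dy_sub R J I]) (dy_len R J)%:E <=
   (4 * dy_len R I)%:E)%E.
Proof.
move=> TI; have L0 : 0 < dy_len R I by rewrite invr_gt0 exprn_gt0.
have EI : (top @` N) I by rewrite -topsE.
have : ((dy_len R I)^-1%:E *
    (\esum_(J in [set J | (top @` N) J /\ dy_sub R J I]) (dy_len R J)%:E) <= 4%:E)%E.
  by apply: le_trans carl; apply: ereal_sup_ubound; exists I.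
rewrite -topsE => h.
have L0' : (0 <= (dy_len R I)%:E)%E by rewrite lee_fin ltW.
have := lee_wpmul2l L0' h.
by rewrite muleA -!EFinM mulfV ?gt_eqF// mul1e mulrC.
Qed.

Let GE i : N i -> G i = [set J | T J = top i].
Proof.
move=> Ni; apply/seteqP; split => [J GJ|J /= TJ]; first by rewrite /= /T (own_uniq Ni GJ).
by have := own_top (own_N J); rewrite -/(T J) TJ own_top// => ->; exact: own_G.
Qed.

Let fiberG i (f : dyadic -> X) : N i -> fiber T (top i) f = haar_restr (G i) f.
Proof. by move=> Ni; rewrite /fiber -GE. Qed.

Definition xnorm : R := fine (hardy_norm p x).

Let hnorm_ge0 (q : R) (f : dyadic -> X) : (0 <= hardy_norm q f)%E.
Proof. exact: Lnorm_ge0. Qed.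

Let xnormE : hardy_norm p x = xnorm%:E.
Proof. by rewrite fineK// ge0_fin_numE. Qed.

Let xnorm0 : 0 <= xnorm. Proof. exact: fine_ge0. Qed.

Definition Znorm : R := A * xnorm `^ p.

Let len0 I : 0 < dy_len R I. Proof. by rewrite invr_gt0 exprn_gt0. Qed.

Let M i : R := fine (Lp01 +oo (square_fun (haar_restr (G i) x))).

(** Its p-th power, times a positive length, is one term of a sum bounded by a finite number. *)
Let ME i : N i -> Lp01 +oo (square_fun (haar_restr (G i) x)) = (M i)%:E.
Proof.
move=> Ni; rewrite fineK// ge0_fin_numE ?Lnorm_ge0//.
have : ((dy_len R (top i))%:E * Lp01 +oo (square_fun (haar_restr (G i) x)) `^ p < +oo)%E.
  apply: (@le_lt_trans _ _ (Znorm%:E)); last by rewrite ltry.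
  have -> : (Znorm%:E = A%:E * hardy_norm p x `^ p)%E by rewrite xnormE poweR_EFin -EFinM.
  apply: le_trans norms; apply: esum_ge; exists [set i].
    by split; [exact: finite_set1 | move=> _ ->].
  by rewrite fsbig_set1.
move=> h; apply: (@lty_poweRy _ _ p); first by rewrite gt_eqF.
by rewrite ltey; apply/eqP => e; move: h; rewrite e gt0_muley ?ltxx// lte_fin len0.
Qed.

Let M0 i : 0 <= M i. Proof. by apply: fine_ge0; exact: Lnorm_ge0. Qed.

Let savgM i n : N i -> savg 2 n (haar_restr (G i) x) <= dy_len R (top i) * M i ^+ 2.
Proof.
move=> Ni; rewrite -fiberG//; apply: savg_fiber_le => // k kn.
by rewrite fiberG// -lee_fin -ME//; exact: srad_le_ess_sup.
Qed.

Definition anorm i : R := fine (hardy_norm 2 (haar_restr (G i) x)).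

Let anormE i : N i -> hardy_norm 2 (haar_restr (G i) x) = (anorm i)%:E.
Proof.
move=> Ni; rewrite fineK// ge0_fin_numE//.
apply: (@lty_poweRy _ _ 2); first by rewrite pnatr_eq0.
rewrite hardy_norm_powR//.
apply: (@le_lt_trans _ _ (dy_len R (top i) * M i ^+ 2)%:E); last by rewrite ltry.
by apply: ge_ereal_sup => _ [n _ <-]; rewrite lee_fin savgM.
Qed.

Let anorm0 i : 0 <= anorm i. Proof. exact: fine_ge0. Qed.

Let anorm_sup i : N i ->
  ((anorm i ^+ 2)%:E = ereal_sup (range (fun n => (savg 2 n (haar_restr (G i) x))%:E)))%E.
Proof. by move=> Ni; rewrite -hardy_norm_powR// anormE// poweR_EFin powR_mulrn. Qed.

Lemma savg_le_anorm i n : N i -> savg 2 n (haar_restr (G i) x) <= anorm i ^+ 2.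
Proof.
by move=> Ni; rewrite -lee_fin anorm_sup//; apply: ereal_sup_ubound; exists n.
Qed.

Definition aweight i : R := anorm i `^ p * dy_len R (top i) `^ (1 - p / 2).

Lemma aweight_ge0 i : 0 <= aweight i.
Proof. by rewrite mulr_ge0 ?powR_ge0. Qed.

(** The square function of the atom lives on its top interval, so its squared L^2 norm is at most
    the length times the squared supremum; the powers p / 2 and 1 - p / 2 of the length then combine
    to the length itself. *)
Let aweight_le i : N i -> aweight i <= dy_len R (top i) * M i `^ p.
Proof.
move=> Ni; have L := len0 (top i).
have aM : anorm i ^+ 2 <= dy_len R (top i) * M i ^+ 2.
  rewrite -lee_fin anorm_sup//; apply: ge_ereal_sup => _ [n _ <-].
  by rewrite lee_fin savgM.
have sq c : 0 <= c -> c `^ p = (c ^+ 2) `^ (p / 2).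
  by move=> c0; rewrite -powR_mulrn// -powRrM mulrCA divff ?mulr1.
rewrite /aweight sq//; apply: le_trans (_ : (dy_len R (top i) * M i ^+ 2) `^ (p / 2) *
    dy_len R (top i) `^ (1 - p / 2) <= _).
  rewrite ler_wpM2r ?powR_ge0// ge0_ler_powR ?nnegrE ?divr_ge0 ?(ltW p0)// ?sqr_ge0//.
  by rewrite mulr_ge0 ?sqr_ge0// ltW.
rewrite powRM ?sqr_ge0 ?(ltW L)// -sq// mulrAC -powRD; last first.
  by rewrite (gt_eqF L) implybT.
by rewrite addrC subrK powRr1// ltW.
Qed.

Lemma sum_aweight n :
  \sum_(t : dyT n | `[< T (dyT_val t) = dyT_val t >]) aweight (own (dyT_val t)) <= Znorm.
Proof.
rewrite -lee_fin; apply: le_trans (@fin_le_esum R n [set I | T I = I]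
  (fun I => aweight (own I)) (fun _ _ => aweight_ge0 _)) _.
rewrite -(@reindex_esum R _ _ [set I | T I = I] N own (fun i => (aweight i)%:E)); last first.
  split.
  - by move=> I _; exact: own_N.
  - by move=> I J; rewrite !inE /T => TI TJ e; rewrite -TI -TJ e.
  - by move=> i Ni; exists (top i); rewrite /= /T ?own_top.
have -> : (Znorm%:E = A%:E * hardy_norm p x `^ p)%E by rewrite xnormE poweR_EFin -EFinM.
apply: le_trans norms; apply: le_esum => i Ni.
by rewrite ME// poweR_EFin -EFinM lee_fin aweight_le.
Qed.

(** The truncation is compatible with the blocks: the top of an interval of level at most [n] again
    has level at most [n]. *)
Lemma sum_by_top (V : nmodType) n (F : nat -> dyT n -> V) :
  \sum_(t : dyT n) F (own (dyT_val t)) t =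
  \sum_(u : dyT n | `[< T (dyT_val u) = dyT_val u >])
    \sum_(t : dyT n | `[< G (own (dyT_val u)) (dyT_val t) >]) F (own (dyT_val u)) t.
Proof.
rewrite (exchange_big_dep xpredT)//=; apply: eq_bigr => t _.
have tn : (dy_level (dyT_val t) <= n)%N by rewrite -ltnS; exact: ltn_ord.
have [u uE] : exists u : dyT n, dyT_val u = T (dyT_val t).
  by apply: dyT_of; have /dy_subE[h _] := @sub_T (dyT_val t); exact: leq_trans h tn.
have ou : own (dyT_val u) = own (dyT_val t) by rewrite uE /T own_top.
rewrite (bigD1 u)/=; last by rewrite !asboolT ?ou ?uE ?T_idem.
rewrite ou big1 ?addr0// => u' /andP[/andP[/asboolP Tu' /asboolP Gu'] /eqP u'u].
exfalso; apply: u'u; apply: dyT_val_inj.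
by rewrite uE -Tu' /T (own_uniq _ Gu').
Qed.

Variables (r C : R).
Hypothesis r2 : 2 <= r.
Hypothesis cot : disc_cotype X r C.

Let mu_ex i : exists mu : dyadic -> R, N i ->
  [/\ forall I, 0 <= mu I, (\esum_(I in G i) (mu I)%:E = 1)%E
    & forall (n : nat) (s : R) (phi : dyadic -> R), r < s ->
      savg 2 n (fun I => phi I *: haar_restr (G i) x I) <=
      (r `^ r^-1 * C * anorm i * lorentz_const s r *
       (\sum_(t : dyT n | `[< G i (dyT_val t) >])
          `|phi (dyT_val t)| `^ s * mu (dyT_val t)) `^ s^-1) ^+ 2].
Proof.
have [Ni|nNi] := pselect (N i); last by exists (fun=> 0).
have fS I : ~ G i I -> haar_restr (G i) x I = 0.
  by move=> nGI; rewrite /haar_restr /patch memNset.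
have [mu h] := pietsch_atom r2 cot (anorm0 i) (top_in Ni) fS (fun n => savg_le_anorm n Ni).
by exists mu.
Qed.

Definition mu i : dyadic -> R := projT1 (cid (mu_ex i)).

Lemma mu_ge0 i I : N i -> 0 <= mu i I.
Proof. by move=> Ni; rewrite /mu; case: cid => ? /= /(_ Ni)[]. Qed.

Lemma mu_sum i : N i -> (\esum_(I in G i) (mu i I)%:E = 1)%E.
Proof. by move=> Ni; rewrite /mu; case: cid => ? /= /(_ Ni)[]. Qed.

Let mu_dom i n s (phi : dyadic -> R) : N i -> r < s ->
  savg 2 n (fun I => phi I *: haar_restr (G i) x I) <=
  (r `^ r^-1 * C * anorm i * lorentz_const s r *
   (\sum_(t : dyT n | `[< G i (dyT_val t) >])
      `|phi (dyT_val t)| `^ s * mu i (dyT_val t)) `^ s^-1) ^+ 2.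
Proof. by move=> Ni rs; rewrite /mu; case: cid => ? /= /(_ Ni)[_ _]; apply. Qed.

Definition omega (I : dyadic) : R := aweight (own I) / Znorm * mu (own I) I.

Lemma omegaE i I : N i -> G i I -> omega I = aweight i / Znorm * mu i I.
Proof. by move=> Ni GI; rewrite /omega (own_uniq Ni GI). Qed.

Let Z0 : 0 <= Znorm.
Proof.
apply: le_trans (sum_aweight 0); apply: sumr_ge0 => t _; exact: aweight_ge0.
Qed.

Lemma omega_ge0 I : 0 <= omega I.
Proof. by rewrite mulr_ge0 ?mu_ge0// divr_ge0 ?aweight_ge0. Qed.

Let omega_fin n : \sum_(t : dyT n) omega (dyT_val t) <= 1.
Proof.
rewrite /omega (sum_by_top (fun i t => aweight i / Znorm * mu i (dyT_val t))).
apply: le_trans (_ : \sum_(u : dyT n | `[< T (dyT_val u) = dyT_val u >])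
  aweight (own (dyT_val u)) / Znorm <= _).
  apply: ler_sum => u _; rewrite -mulr_sumr -[leRHS]mulr1 ler_wpM2l//.
    by rewrite divr_ge0 ?aweight_ge0.
  rewrite -lee_fin -(mu_sum (own_N (dyT_val u))); apply: fin_le_esum => I _.
  exact: mu_ge0.
rewrite -mulr_suml; have [->|Zn0] := eqVneq Znorm 0; first by rewrite invr0 mulr0.
by rewrite ler_pdivrMr ?mul1r ?sum_aweight// lt_neqAle eq_sym Zn0.
Qed.

Lemma omega_sum : (\esum_(I in setT) (omega I)%:E <= 1)%E.
Proof.
apply: esum_le_fin => [I _|n]; first exact: omega_ge0.
rewrite lee_fin; apply: le_trans (omega_fin n).
by rewrite big_mkcond /=; apply: ler_sum => t _; case: ifP => // _; exact: omega_ge0.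
Qed.

Variables (s : R) (phi : dyadic -> R).
Hypothesis rs : r < s.
Hypothesis phi_bd : linfty phi.

Let r0 : 0 < r. Proof. by apply: lt_le_trans r2. Qed.
Let s0 : 0 < s. Proof. exact: lt_trans rs. Qed.
Let C0 : 0 <= C. Proof. exact: cot.1. Qed.

Definition Wnorm : R := fine (\esum_(I in setT) (`|phi I| `^ s * omega I)%:E)%E.

Let phio0 I : 0 <= `|phi I| `^ s * omega I.
Proof. by rewrite mulr_ge0 ?powR_ge0 ?omega_ge0. Qed.

Lemma WnormE : (\esum_(I in setT) (`|phi I| `^ s * omega I)%:E = Wnorm%:E)%E.
Proof.
rewrite fineK// ge0_fin_numE; last by apply: esum_ge0 => I _; rewrite lee_fin.
have [K hK] := phi_bd; have K0 : 0 <= K by exact: le_trans (hK (mkdy 0 0)).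
apply: (@le_lt_trans _ _ (K `^ s)%:E); last by rewrite ltry.
apply: esum_le_fin => // n; rewrite lee_fin.
apply: le_trans (_ : \sum_(t : dyT n) K `^ s * omega (dyT_val t) <= _).
  rewrite big_mkcond /=; apply: ler_sum => t _; case: ifP => _.
    by rewrite ler_wpM2r ?omega_ge0// ge0_ler_powR ?nnegrE// ltW.
  by rewrite mulr_ge0 ?powR_ge0 ?omega_ge0.
by rewrite -mulr_sumr -[leRHS]mulr1 ler_wpM2l ?powR_ge0.
Qed.

Let W0 : 0 <= Wnorm.
Proof. by rewrite -lee_fin -WnormE; apply: esum_ge0 => I _; rewrite lee_fin. Qed.

Let kap := r `^ r^-1 * C * lorentz_const s r.

Let kap0 : 0 <= kap.
Proof.
by rewrite !mulr_ge0 ?powR_ge0// (le_trans ler01)// lorentz_const_ge1.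
Qed.

(** After the measure of each atom bounds its H^2 norm, what remains is an average, with weights
    [aweight / Znorm], of the power p / s <= 1 of the sums [D]. Concavity moves the power outside
    and leaves [Wnorm]. *)
Let savg_bound n :
  savg p n (haar_mul phi x) <= 98 * (kap `^ p * (Znorm * Wnorm `^ (p / s))).
Proof.
apply: le_trans (savg_le_fibers T_idem sub_T T_convex T_carleson _ _ p02) _.
rewrite ler_wpM2l//.
pose D (u : dyT n) := \sum_(t : dyT n | `[< G (own (dyT_val u)) (dyT_val t) >])
  `|phi (dyT_val t)| `^ s * mu (own (dyT_val u)) (dyT_val t).
have D0 u : 0 <= D u by apply: sumr_ge0 => t _; rewrite mulr_ge0 ?powR_ge0 ?mu_ge0.
have th : 0 < p / s <= 1.
  rewrite divr_gt0//= ler_pdivrMr// mul1r (le_trans p2)//.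
  exact: le_trans r2 (ltW rs).
have := @powR_weighted_sum_le R (dyT n) (fun u => `[< T (dyT_val u) = dyT_val u >])
  (fun u => aweight (own (dyT_val u))) D Znorm (p / s) th
  (fun u => aweight_ge0 _) D0 (sum_aweight n).
have DW : \sum_(u : dyT n | `[< T (dyT_val u) = dyT_val u >])
    aweight (own (dyT_val u)) / Znorm * D u <= Wnorm.
  have -> : \sum_(u : dyT n | `[< T (dyT_val u) = dyT_val u >])
      aweight (own (dyT_val u)) / Znorm * D u =
      \sum_(t : dyT n) `|phi (dyT_val t)| `^ s * omega (dyT_val t).
    rewrite /omega (sum_by_top (fun i t => `|phi (dyT_val t)| `^ s *
      (aweight i / Znorm * mu i (dyT_val t)))).
    by apply: eq_bigr => u _; rewrite /D mulr_sumr; apply: eq_bigr => t _; rewrite mulrCA.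
  rewrite -lee_fin -WnormE.
  have := @fin_le_esum R n setT (fun I => `|phi I| `^ s * omega I) (fun I _ => phio0 I).
  by under eq_bigl do rewrite asboolT//.
move=> h; apply: le_trans (_ : kap `^ p * (\sum_(u : dyT n | `[< T (dyT_val u) = dyT_val u >])
  aweight (own (dyT_val u)) * D u `^ (p / s)) <= _); last first.
  rewrite ler_wpM2l ?powR_ge0//; apply: le_trans h _; rewrite ler_wpM2l//.
  apply: ge0_ler_powR => //; rewrite ?nnegrE//.
    by case/andP: th => /ltW.
  by apply: sumr_ge0 => u _; rewrite mulr_ge0// divr_ge0// aweight_ge0.
rewrite mulr_sumr; apply: ler_sum => u /asboolP Tu.
have Nu := own_N (dyT_val u).
have fE : fiber T (dyT_val u) (haar_mul phi x) =
    (fun I => phi I *: haar_restr (G (own (dyT_val u))) x I).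
  rewrite -{1}Tu /T fiberG//; apply/funext => I; rewrite /haar_restr /patch /haar_mul.
  by case: ifP => // _; rewrite scaler0.
rewrite fE; set L := dy_len R _.
have -> : aweight (own (dyT_val u)) = anorm (own (dyT_val u)) `^ p * L `^ (1 - p / 2).
  by rewrite /aweight -/(T _) Tu.
set b := anorm _; have b0 : 0 <= b by exact: anorm0.
have kb0 : 0 <= kap * b by exact: mulr_ge0.
have kbD0 : 0 <= kap * b * D u `^ s^-1 by apply: mulr_ge0 => //; exact: powR_ge0.
have -> : kap `^ p * (b `^ p * L `^ (1 - p / 2) * D u `^ (p / s)) =
    L `^ (1 - p / 2) * ((kap * b * D u `^ s^-1) ^+ 2) `^ (p / 2).
  have e2 : 2 * (p / 2) = p by rewrite mulrC divfK.
  rewrite -powR_mulrn// -powRrM e2.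
  rewrite (powRM _ kb0 (powR_ge0 _ _)) (powRM _ kap0 b0) -powRrM [s^-1 * p]mulrC.
  ring.
rewrite ler_wpM2l ?powR_ge0//; apply: ge0_ler_powR; rewrite ?nnegrE ?savg_ge0 ?sqr_ge0//.
  by rewrite divr_ge0// ltW.
apply: le_trans (mu_dom n phi Nu rs) _; rewrite -/b -/(D u) /kap.
by rewrite [_ * C * b * _]mulrAC.
Qed.

Lemma haar_mul_bound : (hardy_norm p (haar_mul phi x) <=
  ((98 * A) `^ p^-1 * r `^ r^-1 * lorentz_const s r * C * xnorm * Wnorm `^ s^-1)%:E)%E.
Proof.
set Y := 98 * (kap `^ p * (Znorm * Wnorm `^ (p / s))).
have hY : (hardy_norm p (haar_mul phi x) `^ p <= Y%:E)%E.
  by rewrite hardy_norm_powR//; apply: ge_ereal_sup => _ [n _ <-]; rewrite lee_fin savg_bound.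
have -> : hardy_norm p (haar_mul phi x) = ((hardy_norm p (haar_mul phi x) `^ p) `^ p^-1)%E.
  by rewrite -poweRrM mulfV ?gt_eqF// poweRe1.
apply: (@le_trans _ _ (Y%:E `^ p^-1)%E).
  have Y0 : (0 <= Y%:E)%E by apply: le_trans hY; exact: poweR_ge0.
  by apply: gt0_ler_poweR; rewrite ?invr_ge0 ?(ltW p0)// in_itv /= ?leey ?andbT ?poweR_ge0.
rewrite poweR_EFin lee_fin.
have cancel c : 0 <= c -> (c `^ p) `^ p^-1 = c.
  by move=> c0; rewrite -powRrM mulfV ?gt_eqF// powRr1.
(* The sign of [A] is read off [0 <= Znorm], which requires a nonzero norm of [x]. *)
have [x00|xn0] := eqVneq xnorm 0.
  by rewrite /Y /Znorm x00 powR0 ?gt_eqF// mulr0 mul0r !mulr0 powR0 ?invr_eq0 ?gt_eqF// mul0r.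
have A0 : 0 <= A.
  have xp : 0 < xnorm `^ p by rewrite powR_gt0// lt_neqAle eq_sym xn0.
  by rewrite -(pmulr_lge0 _ xp).
have kx0 : 0 <= kap * xnorm by exact: mulr_ge0.
have kxW0 : 0 <= kap * xnorm * Wnorm `^ s^-1 by apply: mulr_ge0 => //; exact: powR_ge0.
have A98 : 0 <= 98 * A by rewrite mulr_ge0.
have -> : Y = 98 * A * (kap * xnorm * Wnorm `^ s^-1) `^ p.
  rewrite (powRM _ kx0 (powR_ge0 _ _)) (powRM _ kap0 xnorm0) -powRrM [s^-1 * p]mulrC.
  by rewrite /Y /Znorm; ring.
rewrite (powRM _ A98 (powR_ge0 _ _)) cancel// /kap.
by rewrite le_eqVlt; apply/predU1P; left; ring.
Qed.

End decomposition.

Theorem theorem3p3 (R : realType) (a A : R -> R)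
  (aA0 : forall p : R, 0 < p <= 2 -> 0 < a p /\ 0 < A p) :
  exists K : R -> R -> R -> R,
    (forall s r p : R, 0 < K s r p) /\
    forall (X : completeNormedModType R) (r p : R) (x : dyadic -> X)
      (N : set nat) (G : nat -> set dyadic) (top : nat -> dyadic),
      2 <= r -> has_cotype X r ->
      0 < p <= 2 ->
      hardy p x -> x <> (fun=> 0) ->
      atomic_decomposition (a p) (A p) p x N G top ->
      exists mu : nat -> dyadic -> R,
        (forall i, N i ->
          [/\ summable (G i) (EFin \o mu i),
              forall I, G i I -> 0 <= mu i I
            & (\esum_(I in G i) (mu i I)%:E = 1)%E]) /\
        exists omega : dyadic -> R,
          [/\ (* the two norms below are finite, so [fine] loses nothing *)
              forall i I, N i -> G i I ->
                omega I = fine (hardy_norm 2 (haar_restr (G i) x)) `^ p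
                          * dy_len R (top i) `^ (1 - p / 2)
                          / (A p * fine (hardy_norm p x) `^ p)
                          * mu i I,
              (\esum_(I in setT) (omega I)%:E <= 1)%E
            & forall s : R, r < s -> forall phi : dyadic -> R, linfty phi ->
                (hardy_norm p (haar_mul phi x) <=
                 (K s r p * cotype_const X r)%:E * hardy_norm p x *
                 (\esum_(I in setT) (`|phi I| `^ s * omega I)%:E) `^ s^-1)%E].
Proof.
pose c s r p : R := (98 * A p) `^ p^-1 * r `^ r^-1 * lorentz_const s r.
(* The default 1 only secures positivity for all real triples; whenever the estimate is applied,
   [c s r p] is positive. *)
exists (fun s r p => if 0 < c s r p then c s r p else 1); split.
  by move=> s r p; case: ifP.
move=> X r p x N G top r2 hcot p02 hx _ [blk [triv cov] [tops carl] [_ _ norms]].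
have cot := cotype_const_disc hcot.
have r0 : 0 < r by apply: lt_le_trans r2.
exists (mu p02 hx blk triv cov tops norms r2 cot); split.
  move=> i Ni; have m1 := mu_sum p02 hx blk triv cov tops norms r2 cot Ni.
  have m0 I := mu_ge0 p02 hx blk triv cov tops norms r2 cot I Ni.
  split => //; rewrite /summable.
  under eq_esum do rewrite /= ger0_norm//.
  by rewrite m1 ltry.
exists (omega p02 hx blk triv cov tops norms r2 cot); split.
- exact: omegaE.
- exact: omega_sum.
- move=> s rs phi phib.
  rewrite ifT; last first.
    rewrite /c !mulr_gt0 ?powR_gt0 ?mulr_gt0//; first by have [] := aA0 p p02.
    by rewrite (lt_le_trans ltr01)// lorentz_const_ge1.
  have := haar_mul_bound p02 hx blk triv cov tops carl norms r2 cot rs phib.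
  rewrite WnormE// poweR_EFin => /le_trans; apply.
  have -> : hardy_norm p x = (xnorm p x)%:E.
    by rewrite fineK// ge0_fin_numE// Lnorm_ge0.
  by rewrite -!EFinM.
Qed.
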